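(* Let $n\ge2$ and let $X=\mathbb{P}^n\subset\mathbb{P}^{n+2}=\operatorname{Proj}k[z_0,\dots,z_n,x,y]$ be the linear subspace with ideal $(x,y)$. The type I structures on $X$ of multiplicity less than or equal to three are, up to linear equivalence, those with ideals $$(x,y),\quad (x^2,y),\quad (x^3,y),\quad (x^2,xy,y^2),\quad (x^2+z_0y,\,xy,\,y^2).$$
   Context: A scheme is Cohen-Macaulay if all its local rings are. A multiple structure on $X$ is a closed subscheme $Y\subset\mathbb{P}^{n+2}$ with $Y_{\mathrm{red}}=X$; its multiplicity (= degree) is the length of its local ring at the generic point of $X$. Linear (projective) equivalence means equality up to a linear change of coordinates on $\mathbb{P}^{n+2}$. Type I: let $I=(x,y)$, let $X^{(i)}$ be the subscheme with ideal sheaf $\mathcal{I}_X^{i+1}$, and let $m$ be the unique integer with $Y\subset X^{(m)}$, $Y\not\subset X^{(m-1)}$. For $j\le m$ let $Y_j$ be obtained from $Y\cap X^{(j)}$ by removing the embedded components (its ideal is the $I$-primary component of $I_Y+I^{j+1}$). The chain $X=Y_0\subset\dots\subset Y_m\subset Y$ is the $S_1$-filtration of $Y$. $Y$ is of type I if $Y$ is Cohen-Macaulay and all the $Y_j$ are Cohen-Macaulay. *)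

(* Defs.v *)
From HB Require Import structures.
From mathcomp Require Import all_boot all_order all_algebra.
From mathcomp Require Import boolp classical_sets.
From mathcomp Require Import mpoly.

Set Implicit Arguments.
Unset Strict Implicit.
Unset Printing Implicit Defensive.

Import GRing.Theory.

Local Open Scope classical_set_scope.
Local Open Scope ring_scope.

Section Ideals.
Variable A : comNzRingType.
Implicit Types (I J P Q : set A).

Definition is_ideal I :=
  [/\ I 0, forall a b, I a -> I b -> I (a + b) & forall c a, I a -> I (c * a)].

Definition ideal_gen (G : set A) : set A := smallest is_ideal G.

Definition ideal_add I J : set A := [set a + b | a in I & b in J].

Definition ideal_mul I J : set A := ideal_gen [set a * b | a in I & b in J].

Definition ideal_pow I (j : nat) : set A := iter j (ideal_mul I) setT.

Definition radical I : set A := [set a | exists r : nat, I (a ^+ r)].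

Definition prime_ideal P :=
  [/\ is_ideal P, ~ P 1 & forall a b, P (a * b) -> P a \/ P b].

Definition primary_ideal Q :=
  [/\ is_ideal Q, ~ Q 1 & forall a b, Q (a * b) -> Q a \/ radical Q b].

Definition minimal_primary_decomposition J (r : nat) (q : 'I_r -> set A) :=
  [/\ forall i, primary_ideal (q i),
      J = [set a | forall i, q i a],
      forall i j, radical (q i) = radical (q j) -> i = j
    & forall i, ~ ([set a | forall j, j != i -> q j a] `<=` q i)].

(* When P is minimal over J, which is the case of interest, Q is unique. *)
Definition primary_component P J Q :=
  exists r (q : 'I_r -> set A),
    minimal_primary_decomposition J q /\
    exists2 i, radical (q i) = P & q i = Q.

Definition is_maximum (E : set nat) (d : nat) :=
  E d /\ forall e, E e -> (e <= d)%N.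

Definition krull_dimension : nat -> Prop :=
  is_maximum [set d | exists P : nat -> set A,
    (forall i, (i <= d)%N -> prime_ideal (P i)) /\
    (forall i, (i < d)%N -> P i `<` P i.+1)].

(* The length of A as a module over itself. *)
Definition ring_length : nat -> Prop :=
  is_maximum [set l | exists I : nat -> set A,
    (forall i, (i <= l)%N -> is_ideal (I i)) /\
    (forall i, (i < l)%N -> I i `<` I i.+1)].

Definition nonunits : set A := [set a | ~ exists b, a * b = 1].

(* Regular sequences in the maximal ideal; only used when A is local, so that
   this ideal is [nonunits] and the quotient by the sequence is nonzero. *)
Definition regular_sequence (s : seq A) :=
  forall i, (i < size s)%N ->
    nonunits s`_i /\
    let I := ideal_gen [set` take i s] in
    forall a, I (s`_i * a) -> I a.

Definition depth : nat -> Prop :=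
  is_maximum [set d | exists2 s : seq A, size s = d & regular_sequence s].

(* For A a local ring. *)
Definition cohen_macaulay_local :=
  exists2 d, krull_dimension d & depth d.

End Ideals.

Section ProjectiveSpace.
Variables (k : fieldType) (N : nat).

(* The homogeneous coordinate ring of P^N. *)
Local Notation S := {mpoly k[N.+1]}.
Local Notation F := {fraction S}.

Definition homogeneous (I : set S) :=
  forall f, I f -> forall d, I (pihomog mdeg d f).

Definition saturated (I : set S) :=
  forall f, (forall i : 'I_N.+1, exists r : nat, I ('X_i ^+ r * f)) -> I f.

(* Closed subschemes of P^N correspond to saturated homogeneous ideals, with
   inclusions reversed; I = S is the empty subscheme. *)
Record closed_subscheme := ClosedSubscheme {
  ideal_of : set S;
  ideal_of_ideal : is_ideal ideal_of;
  ideal_of_homogeneous : homogeneous ideal_of;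
  ideal_of_saturated : saturated ideal_of
}.

(* The points of the scheme Proj S, closed or not. *)
Record proj_point := ProjPoint {
  prime_of : set S;
  prime_of_prime : prime_ideal prime_of;
  prime_of_homogeneous : homogeneous prime_of;
  prime_of_relevant : exists i, ~ prime_of 'X_i
}.

Record point_of (Y : closed_subscheme) := PointOf {
  ambient_point :> proj_point;
  point_on : ideal_of Y `<=` prime_of ambient_point
}.

(* Fractions f / g with f in I, f and g homogeneous of the same degree and g
   not in p, inside the fraction field of S. For I = S this is the local ring
   S_(p) of P^N at p, for I the ideal of Y the stalk at p of the ideal sheaf
   of Y. *)
Definition hfractions (p : proj_point) (I : set S) : set F :=
  [set u | exists d f g, [/\ f \is d.-homog, g \is d.-homog, I f, ~ prime_of p g
                           & u = tofrac f / tofrac g]].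

Lemma hfracD (f1 g1 f2 g2 : S) : g1 != 0 -> g2 != 0 ->
  tofrac f1 / tofrac g1 + tofrac f2 / tofrac g2
    = tofrac (g2 * f1 + g1 * f2) / tofrac (g1 * g2).
Proof.
move=> g10 g20; rewrite addf_div ?tofrac_eq0 // -!tofracM -tofracD.
by rewrite (mulrC f1) (mulrC f2).
Qed.

Lemma hfracM (f1 g1 f2 g2 : S) :
  tofrac f1 / tofrac g1 * (tofrac f2 / tofrac g2)
    = tofrac (f1 * f2) / tofrac (g1 * g2).
Proof. by rewrite mulf_div -!tofracM. Qed.

Section HFractions.
Variable p : proj_point.

Lemma notin_primeM a b : ~ prime_of p a -> ~ prime_of p b -> ~ prime_of p (a * b).
Proof. by move=> pa pb; case: (prime_of_prime p) => _ _ /[apply] -[]. Qed.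

Lemma notin_prime_neq0 a : ~ prime_of p a -> a != 0.
Proof.
by move=> pa; apply/eqP => a0; apply: pa; rewrite a0; case: (prime_of_prime p) => -[].
Qed.

Lemma hfractions0 I : I 0 -> hfractions p I 0.
Proof.
move=> I0; exists 0%N, 0, 1; split => //; rewrite ?dhomog0 ?dhomog1 //.
  by case: (prime_of_prime p).
by rewrite tofrac0 mul0r.
Qed.

Lemma hfractionsD I : is_ideal I -> forall u v,
  hfractions p I u -> hfractions p I v -> hfractions p I (u + v).
Proof.
move=> [_ ID IM] _ _ [d [f [g [hf hg If pg ->]]]] [e [f' [g' [hf' hg' If' pg' ->]]]].
exists (d + e)%N, (g' * f + g * f'), (g * g'); split.
- by apply: dhomogD; [rewrite addnC|]; apply: dhomogM.
- exact: dhomogM.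
- by apply: ID; apply: IM.
- exact: notin_primeM.
- by rewrite hfracD // notin_prime_neq0.
Qed.

Lemma hfractionsM I : is_ideal I -> forall u v,
  hfractions p setT u -> hfractions p I v -> hfractions p I (u * v).
Proof.
move=> [_ ID IM] _ _ [d [f [g [hf hg If pg ->]]]] [e [f' [g' [hf' hg' If' pg' ->]]]].
exists (d + e)%N, (f * f'), (g * g'); split.
- exact: dhomogM.
- exact: dhomogM.
- exact: IM.
- exact: notin_primeM.
- exact: hfracM.
Qed.

Lemma hfractionsN I : is_ideal I -> forall u,
  hfractions p I u -> hfractions p I (- u).
Proof.
move=> [_ ID IM] _ [d [f [g [hf hg If pg ->]]]].
exists d, (- f), g; split => //; first by rewrite dhomogN.
  by rewrite -mulN1r; apply: IM.
by rewrite tofracN mulNr.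
Qed.

Lemma hfractions1 : hfractions p setT 1.
Proof.
exists 0%N, 1, 1; split => //; rewrite ?dhomog1 //.
  by case: (prime_of_prime p).
by rewrite tofrac1 divff ?oner_eq0.
Qed.

Lemma hfractionsN1 I : I `<=` prime_of p -> ~ hfractions p I 1.
Proof.
move=> Ip [d [f [g [hf hg If pg /esym/eqP]]]].
rewrite -subr_eq0 -(@divff _ (tofrac g)) ?tofrac_eq0 ?notin_prime_neq0 //.
rewrite -mulrBl -tofracB mulf_eq0 invr_eq0 !tofrac_eq0 subr_eq0.
rewrite (negPf (notin_prime_neq0 pg)) orbF => /eqP fg.
by apply: pg; rewrite -fg; apply: Ip.
Qed.

Lemma is_idealT : is_ideal [set: S]. Proof. by []. Qed.

Definition hfraction_pred : {pred F} := fun u => `[< hfractions p setT u >].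

Lemma hfraction_subring : subring_closed hfraction_pred.
Proof.
split=> [|u v /asboolP hu /asboolP hv|u v /asboolP hu /asboolP hv].
- by apply/asboolP/hfractions1.
- apply/asboolP/hfractionsD => //; exact: hfractionsN.
- by apply/asboolP/hfractionsM.
Qed.
HB.instance Definition _ :=
  GRing.isSubringClosed.Build F hfraction_pred hfraction_subring.

Definition ambient_local_ring := {u : F | hfraction_pred u}.
HB.instance Definition _ := SubChoice.on ambient_local_ring.
HB.instance Definition _ :=
  [SubChoice_isSubComNzRing of ambient_local_ring by <:].

End HFractions.

Section LocalRing.
Variables (Y : closed_subscheme) (p : point_of Y).

Definition stalk_ideal : ambient_local_ring p -> bool :=
  fun u => `[< hfractions p (ideal_of Y) (val u) >].

Lemma stalk_ideal_closed : idealr_closed stalk_ideal.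
Proof.
have IY := ideal_of_ideal Y.
split=> [||a u v /asboolP hu /asboolP hv].
- by apply/asboolP/hfractions0; case: IY.
- by apply/asboolP/hfractionsN1/point_on.
- apply/asboolP/hfractionsD => //; apply: hfractionsM => //.
  exact: asboolW (valP a).
Qed.
HB.instance Definition _ :=
  isIdealr.Build (ambient_local_ring p) stalk_ideal stalk_ideal_closed.

(* The local ring of Y at p. *)
Definition local_ring : comNzRingType :=
  {ideal_quot (stalk_ideal : idealr (ambient_local_ring p))}.

End LocalRing.

Definition cohen_macaulay (Y : closed_subscheme) :=
  forall p : point_of Y, cohen_macaulay_local (local_ring p).

Definition linear_forms (g : 'M[k]_N.+1) : N.+1.-tuple S :=
  [tuple \sum_(j < N.+1) g i j *: 'X_j | i < N.+1].

Definition linearly_equivalent (Y Z : closed_subscheme) :=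
  exists2 g : 'M[k]_N.+1, g \in unitmx &
    forall f : S, ideal_of Z f <-> ideal_of Y (f \mPo linear_forms g).

End ProjectiveSpace.

Section MultipleStructures.
Variables (k : fieldType) (n : nat).

(* The coordinates z_0, ..., z_n, x, y of P^(n+2). *)
Local Notation S := {mpoly k[n.+3]}.
Definition coord_z0 : S := 'X_ord0.
Definition coord_x : S := 'X_(inord n.+1).
Definition coord_y : S := 'X_(inord n.+2).
Local Notation z0 := coord_z0.
Local Notation x := coord_x.
Local Notation y := coord_y.

Definition IX : set S := ideal_gen [set x; y].

(* Y_red is the closed subscheme with ideal the radical of that of Y. *)
Definition multiple_structure (Y : closed_subscheme k n.+2) :=
  radical (ideal_of Y) = IX.

Definition multiplicity (Y : closed_subscheme k n.+2) (mu : nat) :=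
  exists2 p : point_of Y, prime_of p = IX & ring_length (local_ring p) mu.

(* The first two conditions say that Y is contained in X^(m) but not in
   X^(m-1), X^(i) being the subscheme defined by the power IX^(i+1); for m = 0,
   X^(-1) is empty. *)
Definition S1_filtration (Y : closed_subscheme k n.+2) (m : nat)
    (Yj : nat -> closed_subscheme k n.+2) :=
  [/\ ideal_pow IX m.+1 `<=` ideal_of Y,
      ~ (ideal_pow IX m `<=` ideal_of Y)
    & forall j, (j <= m)%N ->
        primary_component IX
          (ideal_add (ideal_of Y) (ideal_pow IX j.+1)) (ideal_of (Yj j))].

Definition type_I (Y : closed_subscheme k n.+2) :=
  [/\ multiple_structure Y,
      cohen_macaulay Y
    & exists m Yj, S1_filtration Y m Yj /\
        forall j, (j <= m)%N -> cohen_macaulay (Yj j)].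

Definition normal_forms : seq (seq S) :=
  [:: [:: x; y];
      [:: x ^+ 2; y];
      [:: x ^+ 3; y];
      [:: x ^+ 2; x * y; y ^+ 2];
      [:: x ^+ 2 + z0 * y; x * y; y ^+ 2]].

End MultipleStructures.

(* Main.v *)
(* Let I = (x, y), R = k[z_0, ..., z_n] and let J be the ideal of Y.

   The five normal forms have filtrations J = J_r < ... < J_1 < J_0 = S with
   quotients S/I up to shift. Hence S/J is free over R, so that the local rings
   are Cohen-Macaulay, and of length at most r over the generic point of X.

   Conversely, if Y is Cohen-Macaulay then J is I-primary, and its length shows
   that the filtration has m <= 2. The main tool: let e_1, e_2 be homogeneous,
   killed by I modulo J, with J + (e_1, e_2) I-primary and rank one over R
   modulo J. By unique factorization the relations a e_1 + b e_2 in J with a, b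
   in R are multiples of a single one, and the quotient is isomorphic to the
   ideal (a, b) of R. If neither a nor b were a nonzero constant, Y would have
   dimension at least 2 at a minimal prime p of (a, b, x, y), and a regular
   sequence of length 2 in its local ring would be regular on (a, b) as well,
   although S/(a, b, x, y) has depth 0 at p. Such a p is relevant because 4 < n
   + 3. With e = (x, y) this determines the double structures inside the first
   neighbourhood of X, namely (l) + I^2 with l a linear form in x and y. With e
   = (l, l'^2), where (l, l') = I, it determines the triple structures with m =
   2: either (l, l'^3), or (l'^2 + a l, l l', l^2) with a a nonzero linear form
   in the z_i. *)
From HB Require Import structures.
Require Import Defs.
From mathcomp Require Import all_boot all_order all_algebra.
From mathcomp Require Import boolp classical_sets.
From mathcomp Require Import mpoly ring zify.

Set Implicit Arguments.
Unset Strict Implicit.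
Unset Printing Implicit Defensive.

Import GRing.Theory.

Local Open Scope classical_set_scope.
Local Open Scope ring_scope.

(** * Ideals, primes and regular sequences *)

Section IdealTheory.
Variable A : comNzRingType.
Implicit Types (I J K P M : set A) (s : seq A) (a b c : A).

(** Local rings of Proj consist of fractions of degree 0, so ideals, denominators and regular
    sequences have to be kept homogeneous. Ideals of a local ring become homogeneous ideals of S by
    comparing forms of degree d with z^d, where z is a coordinate that does not vanish at the point.

    Dimensions are controlled from both sides. A regular sequence produces a chain of primes,
    because elements of minimal primes are zero divisors. Chains are bounded by counting: [growth]
    measures how many polynomials of degree O(s) are linearly independent modulo a prime, and the
    exponent rises with each strict step down. Counting also shows that fewer forms than variables
    have a common zero.

    At a point of a normal form the regular sequence consists of one algebraic relation for each z_i
    outside a transcendence basis T of the coordinates. It is regular after inverting leading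
    coefficients, which lie in k[T] and are nonzero at the point.

    Multiplicities enter through inequalities: towers bound the length above, chains of ideals bound
    it below. Chains of four steps exclude both m >= 3 and the case where Y_1 is the whole first
    neighbourhood but Y is larger. *)

Lemma ideal_Ml I c a : is_ideal I -> I a -> I (c * a).
Proof. by case=> _ _; apply. Qed.

Lemma ideal_Mr I c a : is_ideal I -> I a -> I (a * c).
Proof. by rewrite mulrC; apply: ideal_Ml. Qed.

Lemma ideal_D I a b : is_ideal I -> I a -> I b -> I (a + b).
Proof. by case=> _ + _; apply. Qed.

Lemma ideal_0 I : is_ideal I -> I 0.
Proof. by case. Qed.

Lemma ideal_N I a : is_ideal I -> I a -> I (- a).
Proof. by move=> hI Ia; rewrite -mulN1r; apply: ideal_Ml. Qed.

Lemma ideal_B I a b : is_ideal I -> I a -> I b -> I (a - b).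
Proof. by move=> hI Ia Ib; apply: ideal_D => //; apply: ideal_N. Qed.

Lemma ideal_sum I (T : Type) (r : seq T) (p : pred T) (F : T -> A) :
  is_ideal I -> (forall i, p i -> I (F i)) -> I (\sum_(i <- r | p i) F i).
Proof.
by move=> hI IF; apply: big_ind => //; [exact: ideal_0 | move=> *; exact: ideal_D].
Qed.

Lemma ideal_Dl I a b : is_ideal I -> I a -> I (a + b) -> I b.
Proof. by move=> hI Ia Iab; rewrite -(addKr a b) addrC; apply: ideal_B. Qed.

Lemma ideal_sub_mod I a b : is_ideal I -> I (a - b) -> I a <-> I b.
Proof.
move=> hI Iab; split=> [Ia|Ib]; last by rewrite -(subrK b a); apply: ideal_D.
by rewrite -(subKr a b); apply: ideal_B.
Qed.

(** Coefficients are a function on all of [nat], of which only the values below [size s] count; this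
    avoids ordinals depending on the list. *)
Definition lincomb s : set A :=
  [set a | exists c : nat -> A, a = \sum_(i < size s) c i * s`_i].

Lemma lincomb_ideal s : is_ideal (lincomb s).
Proof.
split.
- by exists (fun=> 0); rewrite big1 // => i _; rewrite mul0r.
- move=> _ _ [c ->] [d ->]; exists (fun i => c i + d i).
  by rewrite -big_split /=; apply: eq_bigr => i _; rewrite mulrDl.
- move=> e _ [c ->]; exists (fun i => e * c i).
  by rewrite mulr_sumr; apply: eq_bigr => i _; rewrite mulrA.
Qed.

Lemma lincomb_mem s i : (i < size s)%N -> lincomb s s`_i.
Proof.
move=> lti; exists (fun j => (j == i)%:R).
rewrite (bigD1 (Ordinal lti)) //= eqxx mul1r big1 ?addr0 // => j.
by rewrite -val_eqE /= => /negPf ->; rewrite mul0r.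
Qed.

Lemma ideal_gen_is_ideal (G : set A) : is_ideal (ideal_gen G).
Proof.
split.
- by move=> M [[? _ _] _].
- by move=> a b Ga Gb M MG; case: (MG) => -[_ MD _] _; exact: MD (Ga M MG) (Gb M MG).
- by move=> c a Ga M MG; case: (MG) => -[_ _ MM] _; exact: MM (Ga M MG).
Qed.

Lemma ideal_gen_sub (G I : set A) : is_ideal I -> G `<=` I -> ideal_gen G `<=` I.
Proof. exact: smallest_sub. Qed.

Lemma ideal_gen_mem (G : set A) : G `<=` ideal_gen G.
Proof. exact: sub_gen_smallest. Qed.

Lemma ideal_gen_seq s : ideal_gen [set` s] = lincomb s.
Proof.
apply/seteqP; split.
  apply: ideal_gen_sub; first exact: lincomb_ideal.
  move=> a /= /nthP -/(_ 0) [i lti <-]; exact: lincomb_mem.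
move=> _ [c ->]; apply: ideal_sum => [|i _]; first exact: ideal_gen_is_ideal.
apply: (ideal_Ml _ (ideal_gen_is_ideal _)); apply: ideal_gen_mem; exact: mem_nth.
Qed.

Lemma lincomb_sub s I : is_ideal I -> (forall i, (i < size s)%N -> I s`_i) ->
  lincomb s `<=` I.
Proof.
move=> hI Is _ [c ->]; apply: ideal_sum => // i _; apply: ideal_Ml => //.
exact: Is.
Qed.

Lemma ideal_gen_take_nth s i j : (j < i)%N -> (j < size s)%N ->
  ideal_gen [set` take i s] s`_j.
Proof.
move=> ltji ltjs; apply: ideal_gen_mem => /=.
by rewrite -(nth_take 0 ltji) mem_nth // size_take; case: ifP.
Qed.

Lemma ideal_gen_take_sub s i I : is_ideal I ->
  (forall j, (j < i)%N -> (j < size s)%N -> I s`_j) ->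
  ideal_gen [set` take i s] `<=` I.
Proof.
move=> hI Is; apply: ideal_gen_sub => // a /= /nthP -/(_ 0) [j].
rewrite size_take_min leq_min => /andP[ji js] <-.
by rewrite nth_take //; apply: Is.
Qed.

Lemma ideal_add_ideal I J : is_ideal I -> is_ideal J -> is_ideal (ideal_add I J).
Proof.
move=> hI hJ; split.
- by exists 0; [apply: ideal_0 | exists 0; [apply: ideal_0 | rewrite addr0]].
- move=> _ _ [a Ia [b Jb <-]] [c Ic [d Jd <-]].
  by exists (a + c); [apply: ideal_D | exists (b + d); [apply: ideal_D | rewrite addrACA]].
- move=> e _ [a Ia [b Jb <-]].
  by exists (e * a); [apply: ideal_Ml | exists (e * b); [apply: ideal_Ml | rewrite mulrDr]].
Qed.

Lemma ideal_addl I J : is_ideal J -> I `<=` ideal_add I J.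
Proof. by move=> hJ a Ia; exists a => //; exists 0; [apply: ideal_0 | rewrite addr0]. Qed.

Lemma ideal_addr I J : is_ideal I -> J `<=` ideal_add I J.
Proof. by move=> hI a Ja; exists 0; [apply: ideal_0 | exists a; rewrite ?add0r]. Qed.

Lemma ideal_add_sub I J K : is_ideal K -> I `<=` K -> J `<=` K ->
  ideal_add I J `<=` K.
Proof. by move=> hK IK JK _ [a /IK Ka [b /JK Kb <-]]; apply: ideal_D. Qed.

Lemma ideal_pow_ideal I j : is_ideal (ideal_pow I j).
Proof. by case: j => [|j] //; apply: ideal_gen_is_ideal. Qed.

Lemma ideal_powS_sub I K j : is_ideal K ->
  (forall a b, I a -> ideal_pow I j b -> K (a * b)) -> ideal_pow I j.+1 `<=` K.
Proof. by move=> hK IK; apply: ideal_gen_sub => // _ [a Ia [b Ib <-]]; apply: IK. Qed.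

Lemma ideal_powSM I j a b : I a -> ideal_pow I j b -> ideal_pow I j.+1 (a * b).
Proof. by move=> Ia Ib; apply: ideal_gen_mem; exists a => //; exists b. Qed.

Lemma ideal_powX I j a : I a -> ideal_pow I j (a ^+ j).
Proof. by move=> Ia; elim: j => [|j IH] //; rewrite exprS; apply: ideal_powSM. Qed.

Lemma primeX P a r : prime_ideal P -> P (a ^+ r) -> P a.
Proof.
move=> [_ P1 Pp]; elim: r => [|r IH]; first by rewrite expr0.
by rewrite exprS => /Pp[].
Qed.

Lemma prime_is_ideal P : prime_ideal P -> is_ideal P. Proof. by case. Qed.

Lemma primeNM P a b : prime_ideal P -> ~ P a -> ~ P b -> ~ P (a * b).
Proof. by case=> _ _ Pp na nb /Pp[]. Qed.

Lemma primeNX P a r : prime_ideal P -> ~ P a -> ~ P (a ^+ r).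
Proof. by move=> hP na /(primeX hP). Qed.

Lemma prime_pow P I j : prime_ideal P -> ideal_pow I j `<=` P -> I `<=` P.
Proof. by move=> hP IP a Ia; apply: (primeX hP); apply: IP; apply: ideal_powX. Qed.

Definition mulclosed M := M 1 /\ forall a b, M a -> M b -> M (a * b).

Lemma mulclosedX M a r : mulclosed M -> M a -> M (a ^+ r).
Proof. by case=> M1 MM Ma; elim: r => [|r IH]; rewrite ?expr0 // exprS; apply: MM. Qed.

Lemma prime_compl P : prime_ideal P -> mulclosed (~` P).
Proof. by case=> _ P1 Pp; split=> // a b na nb /Pp[]. Qed.

(** Zorn's lemma for multiplicative sets that avoid [K]. With [H] the whole ring the complement of
    [M] is a minimal prime over [K]; with [H] the set of forms it gives a homogeneous one. *)
Lemma maximal_mulclosed (H M0 K : set A) :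
  mulclosed H -> mulclosed M0 -> M0 `<=` H -> is_ideal K ->
  (forall a, M0 a -> ~ K a) ->
  exists M, [/\ M0 `<=` M, M `<=` H, mulclosed M, (forall a, M a -> ~ K a)
   & forall a, H a -> ~ M a -> exists t, M t /\ exists r, K (t * a ^+ r)].
Proof.
move=> hH hM0 M0H hK M0K.
pose ok M := [/\ M `<=` H, mulclosed (M `|` M0) & forall a, M a -> ~ K a].
have [|M [[MH hM MK] maxM]] := @Zorn_bigcup A ok.
  move=> F Fok totF; split.
  - by move=> a [M FM Ma]; case: (Fok _ FM) => MH _ _; apply: MH.
  - split; first by right; case: hM0.
    move=> a b [[M FM Ma]|M0a] [[M' FM' Mb]|M0b].
    + wlog MM' : M M' a b FM FM' Ma Mb / M `<=` M'.
        move=> W; case: (totF _ _ FM FM') => s; first exact: W s.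
        by rewrite mulrC; apply: W s.
      case: (Fok _ FM') => _ [_ +] _ => /(_ a b (or_introl (MM' _ Ma)) (or_introl Mb)).
      by case=> h; [left; exists M'|right].
    + case: (Fok _ FM) => _ [_ +] _ => /(_ a b (or_introl Ma) (or_intror M0b)).
      by case=> h; [left; exists M|right].
    + case: (Fok _ FM') => _ [_ +] _ => /(_ a b (or_intror M0a) (or_introl Mb)).
      by case=> h; [left; exists M'|right].
    + by right; case: hM0 => _; apply.
  - by move=> a [M FM Ma]; case: (Fok _ FM) => _ _; apply.
exists (M `|` M0); split=> //.
- by move=> a [/MH|/M0H].
- by move=> a [/MK|/M0K].
move=> a Ha nMa; apply: contrapT => nex.
(* The multiplicative set generated by [M] and [a]: if it avoided [K], it would contradict
   maximality. *)
pose B := [set b | exists t r, (M `|` M0) t /\ b = t * a ^+ r].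
have MB : M `|` M0 `<=` B by move=> b Mb; exists b, 0%N; rewrite expr0 mulr1.
apply: (maxM B).
  split; first by move=> b Mb; apply: MB; left.
  move=> BM; apply: nMa; left; apply: BM; exists 1, 1%N.
  by rewrite expr1 mul1r; split=> //; case: hM.
have hB : mulclosed B.
  split; first by apply: MB; case: hM.
  move=> _ _ [t [r [Mt ->]]] [t' [r' [Mt' ->]]]; exists (t * t'), (r + r')%N.
  by rewrite exprD mulrACA; split=> //; case: hM => _; apply.
split.
- move=> _ [t [r [Mt ->]]]; case: (hH) => _; apply; last exact: mulclosedX.
  by case: Mt => [/MH|/M0H].
- suff -> : B `|` M0 = B by [].
  by apply/seteqP; split=> b; [case=> // Mb; apply: MB; right | left].
- by move=> _ [t [r [Mt ->]]] KB; apply: nex; exists t; split=> //; exists r.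
Qed.

(** In each term of the binomial expansion the exponent of [a] is at least [r] or that of [b] at
    least [r']. *)
Lemma ideal_powD K t a r t' b r' : is_ideal K -> K (t * a ^+ r) ->
  K (t' * b ^+ r') -> K (t * t' * (a + b) ^+ (r + r')).
Proof.
move=> hK Ka Kb; rewrite exprDn mulr_sumr; apply: ideal_sum => // i _.
rewrite mulrnAr -mulr_natr; apply: (ideal_Mr _ hK).
have [ler|ltr] := leqP r (r + r' - i).
  rewrite -(subnK ler) exprD.
  have -> : t * t' * (a ^+ (r + r' - i - r) * a ^+ r * b ^+ i)
    = (t * a ^+ r) * (t' * a ^+ (r + r' - i - r) * b ^+ i) by ring.
  exact: ideal_Mr.
have ler' : (r' <= i)%N by lia.
rewrite -(subnK ler') exprD.
have -> : t * t' * (a ^+ (r + r' - (i - r' + r')) * (b ^+ (i - r') * b ^+ r'))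
  = (t' * b ^+ r') * (t * a ^+ (r + r' - (i - r' + r')) * b ^+ (i - r')) by ring.
exact: ideal_Mr.
Qed.

Lemma nil_mod_ideal M K : mulclosed M -> is_ideal K ->
  is_ideal [set a | exists t, M t /\ exists r, K (t * a ^+ r)].
Proof.
move=> [M1 MM] hK; split.
- by exists 1; split=> //; exists 1%N; rewrite expr1 mulr0; apply: ideal_0.
- move=> a b [t [Mt [r Kr]]] [t' [Mt' [r' Kr']]].
  by exists (t * t'); split; [apply: MM | exists (r + r')%N; apply: ideal_powD].
- move=> c a [t [Mt [r Kr]]]; exists t; split=> //; exists r.
  by rewrite exprMn mulrCA; apply: ideal_Ml.
Qed.

(** [Q] is the complement of a maximal multiplicative set containing the complement of [P] and
    avoiding [K]. The last clause expresses minimality: modulo [K], elements of [Q] are nilpotent in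
    the localization at [Q]. *)
Lemma minimal_prime K P : is_ideal K -> prime_ideal P -> K `<=` P ->
  exists Q, [/\ prime_ideal Q, K `<=` Q, Q `<=` P
   & forall a, Q a -> exists t, ~ Q t /\ exists r, K (t * a ^+ r)].
Proof.
move=> hK hP KP.
have [//||//|//||M [PM _ hM MK maxM]] := @maximal_mulclosed setT (~` P) K.
- exact: prime_compl.
- by move=> a nPa /KP.
exists (~` M).
pose L := [set a | exists t, M t /\ exists r, K (t * a ^+ r)].
have [hM1 hMM] := hM.
have ML : ~` M = L.
  apply/seteqP; split=> [a nMa|a [t [Mt [r Kr]]] Ma]; first exact: maxM.
  by apply: (MK _ _ Kr); apply: hMM => //; apply: mulclosedX.
split.
- split; first by rewrite ML; apply: nil_mod_ideal.
  + by move=> /(_ hM1).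
  + move=> a b nMab; apply: contrapT => /not_orP[/contrapT Ma /contrapT Mb].
    by apply: nMab; apply: hMM.
- by move=> a Ka Ma; apply: (MK _ Ma).
- by move=> a nMa; apply: contrapT => nPa; apply: nMa; apply: PM.
- by rewrite ML => a [t [Mt Kt]]; exists t; split=> //; rewrite -ML; apply.
Qed.

(* Elements of a minimal prime over K are zero divisors modulo K. *)
Lemma regular_sequence_chain s : prime_ideal (@nonunits A) -> regular_sequence s ->
  forall j, (j <= size s)%N -> exists P : nat -> set A,
    [/\ forall i, (i <= j)%N -> prime_ideal (P i),
        forall i, (i < j)%N -> P i `<` P i.+1
      & ideal_gen [set` take (size s - j) s] `<=` P 0%N].
Proof.
move=> hm reg; elim=> [|j IH] lej.
  exists (fun=> @nonunits A); split=> //.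
  apply: ideal_gen_take_sub; first exact: prime_is_ideal.
  by move=> i _ /reg[].
have [P [Pp Pc KP]] := IH (ltnW lej).
set i := (size s - j.+1)%N in IH *.
have lti : (i < size s)%N by rewrite /i; lia.
have iS : (size s - j = i.+1)%N by rewrite /i; lia.
have [||Q [Qp KQ QP Qnil]] :=
    @minimal_prime (ideal_gen [set` take i s]) (P 0%N) _ (Pp 0%N isT).
- exact: ideal_gen_is_ideal.
- apply: subset_trans KP; apply: ideal_gen_take_sub => [|l li ls].
    exact: ideal_gen_is_ideal.
  by apply: ideal_gen_take_nth => //; lia.
exists (fun l => if l is l'.+1 then P l' else Q); split=> //.
- by case=> // l; apply: Pp.
- case=> [_|l]; last exact: Pc.
  (* Otherwise the regular element number [i] lies in [Q], and t times a power of it lies in the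
     ideal of the earlier ones, for some t outside [Q]. Cancelling the power puts t into [Q]. *)
  split=> //; move=> P0Q.
  have Qs : Q s`_i by apply: P0Q; apply: KP; apply: ideal_gen_take_nth; rewrite ?iS.
  have [t [nQt [r]]] := Qnil _ Qs.
  have [_ /= regi] := reg i lti.
  elim: r => [|r IHr]; first by rewrite expr0 mulr1 => /KQ.
  by rewrite exprS mulrCA => /regi.
Qed.

Lemma regular_sequence_krull (d : nat) s : prime_ideal (@nonunits A) ->
  regular_sequence s -> krull_dimension A d -> (size s <= d)%N.
Proof.
move=> hm reg [_ maxd]; apply: maxd.
have [P [Pp Pc _]] := regular_sequence_chain hm reg (leqnn _).
by exists P.
Qed.

(** The chain of primes built from [s] and the assumed bound make the dimension equal to [size s].
    No regular sequence is longer than the dimension, so [s] also attains the depth. *)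
Lemma cohen_macaulay_of_regular s : prime_ideal (@nonunits A) ->
  regular_sequence s ->
  (forall (P : nat -> set A) l, (forall i, (i <= l)%N -> prime_ideal (P i)) ->
     (forall i, (i < l)%N -> P i `<` P i.+1) -> (l <= size s)%N) ->
  cohen_macaulay_local A.
Proof.
move=> hm reg bound.
have dimA : krull_dimension A (size s).
  split; last by move=> e [P [Pp Pc]]; apply: bound Pp Pc.
  have [P [Pp Pc _]] := regular_sequence_chain hm reg (leqnn _).
  by exists P.
exists (size s) => //; split; first by exists s.
by move=> e [s' <- reg']; apply: regular_sequence_krull dimA.
Qed.

(** * Bounds on the length from a filtration with simple quotients *)

Section Length.
Variables (r : nat) (M : nat -> set A).
Hypothesis M0 : M 0%N = setT.
Hypothesis Mr : M r `<=` [set 0].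
Hypothesis Msimple : forall i, (i < r)%N -> forall a b, M i a -> ~ M i.+1 a ->
  M i b -> exists c, M i.+1 (b - c * a).

(** The number of nonzero graded pieces of [I] for the filtration [M]. As the quotients of [M] are
    simple or zero, it grows strictly with [I]. *)
Let cnt I := (\sum_(i < r) `[< exists2 a, I a & M i a /\ ~ M i.+1 a >] : nat)%N.

Let cnt_mono I J : is_ideal I -> is_ideal J -> I `<` J -> (cnt I < cnt J)%N.
Proof.
move=> hI hJ [IJ nJI].
have le i : (`[< exists2 a, I a & M i a /\ ~ M i.+1 a >] <=
             `[< exists2 a, J a & M i a /\ ~ M i.+1 a >])%N.
  case: asboolP => // -[a Ia h]; case: asboolP => // n; exfalso; apply: n.
  by exists a => //; apply: IJ.
rewrite ltn_neqAle leq_sum ?andbT; last by move=> i _; apply: le.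
apply/negP => /eqP eqc; apply: nJI.
have {eqc}eqi (i : 'I_r) : (exists2 a, J a & M i a /\ ~ M i.+1 a) ->
    exists2 a, I a & M i a /\ ~ M i.+1 a.
  move=> exJ; apply: contrapT => nI.
  have : (cnt I < cnt J)%N.
    rewrite /cnt [X in (X < _)%N](bigD1 i) // [X in (_ < X)%N](bigD1 i) //=.
    rewrite (asboolT exJ) (asboolF nI) add1n add0n ltnS.
    by apply: leq_sum => l _; apply: le.
  by rewrite eqc ltnn.
(* From the small end of the filtration upwards: an element of [J] at level i agrees, up to deeper
   levels, with a multiple of an element of [I], since the piece is simple. *)
have step i : (i <= r)%N -> forall b, J b -> M i b -> I b.
  move=> lei; rewrite -(subKn lei).
  elim: (r - i)%N (leq_subr i r) => [_ b _|l IH lel b Jb Mb].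
    by rewrite subn0 => /Mr ->; apply: ideal_0.
  have ltr : (r - l.+1 < r)%N by lia.
  have eS : ((r - l.+1).+1 = r - l)%N by lia.
  have [Mb'|nMb] := pselect (M (r - l.+1).+1 b).
    by apply: IH => //; [lia|rewrite -eS].
  have [a Ia [Ma nMa]] := eqi (Ordinal ltr) (ex_intro2 _ _ b Jb (conj Mb nMb)).
  have [c] := Msimple ltr Ma nMa Mb; rewrite eS => Mc.
  rewrite -(subrK (c * a) b); apply: ideal_D => //; last exact: ideal_Ml.
  apply: IH => //; first lia.
  by apply: ideal_B => //; apply: IJ; apply: ideal_Ml.
by move=> b Jb; apply: (step 0%N) => //; rewrite M0.
Qed.

Lemma chain_bound (l : nat) (I : nat -> set A) :
  (forall i, (i <= l)%N -> is_ideal (I i)) ->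
  (forall i, (i < l)%N -> I i `<` I i.+1) -> (l <= r)%N.
Proof.
move=> hI cI.
have H i : (i <= l)%N -> (i <= cnt (I i))%N.
  elim: i => [|i IH] // lti; apply: leq_ltn_trans (IH (ltnW lti)) _.
  by apply: cnt_mono; [apply: hI; lia | apply: hI | apply: cI].
apply: leq_trans (H l (leqnn _)) _; rewrite /cnt.
rewrite -[X in (_ <= X)%N]card_ord -sum1_card; apply: leq_sum => i _.
by case: `[< _ >].
Qed.

Lemma ring_length_le : exists2 mu, ring_length A mu & (mu <= r)%N.
Proof.
pose E := [set l | exists I : nat -> set A,
    (forall i, (i <= l)%N -> is_ideal (I i)) /\
    (forall i, (i < l)%N -> I i `<` I i.+1)].
have E0 : exists l, `[< E l >].
  by exists 0%N; apply/asboolP; exists (fun=> setT); split.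
have Eb l : `[< E l >] -> (l <= r)%N.
  by move=> /asboolP[I [hI cI]]; apply: chain_bound hI cI.
case: (ex_maxnP E0 Eb) => mu /asboolP Emu maxmu.
by exists mu; [split=> // e Ee; apply: maxmu; apply/asboolP | apply: Eb; apply/asboolP].
Qed.

End Length.

End IdealTheory.

(** * Factoriality of polynomial rings *)

Section Factorial.
Variable D : idomainType.
Implicit Types (a b c p q u : D) (s : seq D).

Definition divides p a := exists c, a = c * p.

Definition prime_element p :=
  [/\ p != 0, p \isn't a GRing.unit
    & forall a b, divides p (a * b) -> divides p a \/ divides p b].

(** Asking for prime rather than irreducible factors makes uniqueness of the factorization
    automatic. *)
Definition factorial_domain := forall a, a != 0 -> exists u s,
  [/\ u \is a GRing.unit, forall p, p \in s -> prime_element p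
    & a = u * \prod_(p <- s) p].

Lemma dividesMl p a b : divides p b -> divides p (a * b).
Proof. by case=> c ->; exists (a * c); rewrite mulrA. Qed.

Lemma dividesMr p a b : divides p a -> divides p (a * b).
Proof. by rewrite mulrC; apply: dividesMl. Qed.

Lemma prime_divides_unitM p u a : u \is a GRing.unit ->
  divides p (u * a) -> divides p a.
Proof. by move=> uu [c e]; exists (u^-1 * c); rewrite -mulrA -e mulKr. Qed.

Lemma prime_divides_prod p s : prime_element p -> divides p (\prod_(q <- s) q) ->
  exists2 q, q \in s & divides p q.
Proof.
move=> [p0 pu pp]; elim: s => [|q s IH].
  by rewrite big_nil => -[c /esym e]; case/negP: pu; apply/unitrP; exists c; rewrite [p * c]mulrC e.
rewrite big_cons => /pp[dq|/IH[r rs dr]]; first by exists q; rewrite ?mem_head.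
by exists r; rewrite // inE rs orbT.
Qed.

Lemma prime_divides_prime p q : prime_element p -> prime_element q ->
  divides p q -> divides q p.
Proof.
move=> [p0 pu _] [q0 qu qp] [c e].
have [|[d ed]|//] := qp c p; first by exists 1; rewrite mul1r e.
case/negP: pu; apply/unitrP; exists d.
have : (d * p) * q = q by rewrite mulrAC -ed -e.
by rewrite -[RHS]mul1r => /(mulIf q0) dp; rewrite [p * d]mulrC dp.
Qed.

(* Factorial domains are pre-Schreier. *)
Lemma factorial_proportional a b a' b' : factorial_domain -> a != 0 ->
  a * b' = a' * b ->
  exists h h' a0 b0, [/\ a = h * a0, b = h * b0, a' = h' * a0 & b' = h' * b0].
Proof.
move=> fD a0 e; have [u [s [uu ps ea]]] := fD a a0.
rewrite {}ea in a0 e *; elim: s a' b ps a0 e => [|p s IH] a' b ps a0.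
  rewrite big_nil mulr1 => e; exists u, a', 1, (u^-1 * b).
  by split; rewrite ?mulr1 ?mulVKr //; rewrite mulrCA -e mulKr.
have pp : prime_element p by apply: ps; rewrite mem_head.
have pn0 : p != 0 by case: pp.
rewrite big_cons; set m := \prod_(j <- s) j in IH * => e.
have ps' q : q \in s -> prime_element q by move=> qs; apply: ps; rewrite inE qs orbT.
have m0 : u * m != 0.
  by move: a0; rewrite big_cons !mulf_eq0 !negb_or => /and3P[-> _ ->].
(* If [p] divides [a'] it goes into the common factor [a0]; if it divides [b] it goes into [h]. *)
have : divides p (a' * b) by rewrite -e; exists (u * m * b'); ring.
case: (pp) => _ _ /[apply] -[[c ec]|[c ec]]; subst.
  have e' : u * m * b' = c * b by apply: (mulIf pn0); ring: e.
  have [h [h' [x [y [e1 e2 e3 e4]]]]] := IH c b ps' m0 e'.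
  exists h, h', (x * p), y; rewrite e2 e3 e4 mulrCA e1 mulrC; split=> //; ring.
have e' : u * m * b' = a' * c by apply: (mulIf pn0); ring: e.
have [h [h' [x [y [e1 e2 e3 e4]]]]] := IH a' c ps' m0 e'.
exists (h * p), h', x, y; rewrite e2 e3 e4 mulrCA e1; split=> //; ring.
Qed.

End Factorial.

(** * Gauss's lemma and factoriality of D[X] *)

Section FactorialPoly.
Variable D : idomainType.
Hypothesis fD : factorial_domain D.
Implicit Types (f g h q d : {poly D}) (p c : D) (s : seq D).

Let dividesC p f : divides p%:P f <-> forall i, divides p f`_i.
Proof.
split=> [[g ->] i|df]; first by exists g`_i; rewrite coefMC.
have [w ew] := choice df.
exists (\poly_(i < size f) w i); apply/polyP => i; rewrite coefMC coef_poly.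
case: ltnP => [_|lei]; last by rewrite nth_default // mul0r.
exact: ew.
Qed.

(** Let i and j be the lowest indices where the coefficients of f and g are not divisible by [p].
    The coefficient i + j of f g is the product of these two modulo [p]. *)
Let prime_polyC p : prime_element p -> prime_element p%:P.
Proof.
move=> [p0 pu pp]; split; first by rewrite polyC_eq0.
  by rewrite poly_unitE coefC size_polyC p0 eqxx.
move=> f g dfg; apply: contrapT => /not_orP[nf ng].
have least h : ~ divides p%:P h ->
    exists2 i, ~ divides p h`_i & forall j, (j < i)%N -> divides p h`_j.
  move=> nh; have ex : exists i, `[< ~ divides p h`_i >].
    apply: contrapT => nex; apply: nh; apply/dividesC => i; apply: contrapT => nd.
    by apply: nex; exists i; apply/asboolP.
  exists (ex_minn ex); case: ex_minnP => i /asboolP ndi mini // j ltj.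
  by apply: contrapT => nd; have := mini j (asboolT nd); rewrite leqNgt ltj.
have [i ndi dlti] := least f nf; have [j ndj dltj] := least g ng.
have : divides p (f`_i * g`_j); last by move=> /pp[].
have /dividesC/(_ (i + j)%N) := dfg.
rewrite coefM (bigD1 (inord i)) //= inordK ?ltnS ?leq_addr // addKn => -[c ec].
suff [d ed] : divides p (\sum_(l < (i + j).+1 | l != inord i) f`_l * g`_(i + j - l)).
  by exists (c - d); rewrite mulrBl -ec ed addrK.
apply: (big_ind (fun x => divides p x)); first by exists 0; rewrite mul0r.
  by move=> _ _ [c1 ->] [c2 ->]; exists (c1 + c2); rewrite mulrDl.
move=> l; rewrite -val_eqE /= inordK ?ltnS ?leq_addr // => nel.
have [ltl|lel] := ltnP l i; first by apply: dividesMr; apply: dlti.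
by apply: dividesMl; apply: dltj; have := ltn_ord l; lia.
Qed.

Let primitive f := f != 0 /\ forall p, prime_element p -> ~ divides p%:P f.

(** A constant prime dividing [f] divides its leading coefficient and is, up to a unit, one of the
    prime factors of the latter; the induction is on their number. *)
Let primitive_part f : f != 0 -> exists s g,
  [/\ forall p, p \in s -> prime_element p, primitive g & f = \prod_(p <- s) p%:P * g].
Proof.
move=> f0; have lf0 : lead_coef f != 0 by rewrite lead_coef_eq0.
have [u [s [uu ps e]]] := fD lf0.
have [m] := ubnP (size s).
elim: m s f f0 ps e {lf0} => // m IH s f f0 ps e ltm.
have [[p [psp df]]|nex] := pselect (exists p, p \in s /\ divides p%:P f); last first.
  exists [::], f; rewrite big_nil mul1r; split=> //; split=> // p pp dpf.
  have : divides p (lead_coef f) by apply: (proj1 (dividesC _ _)).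
  rewrite e => /(prime_divides_unitM uu) /(prime_divides_prod pp)[q qs dpq].
  have [c ec] := prime_divides_prime pp (ps q qs) dpq.
  apply: nex; exists q; split=> //; case: dpf => g ->.
  by apply: dividesMl; rewrite ec polyCM; exists c%:P.
have [g eg] := df; have p0 : p != 0 by case: (ps p psp).
have g0 : g != 0 by apply: contra_neq f0 => g0; rewrite eg g0 mul0r.
have eg' : lead_coef g = u * \prod_(q <- rem p s) q.
  apply: (mulIf p0); rewrite -[X in _ * X](lead_coefC p) -lead_coefM -eg e.
  by rewrite (perm_big _ (perm_to_rem psp)) /= big_cons mulrCA mulrC.
have [||s' [g' [ps' pg' ef']]] := IH _ g g0 _ eg'.
- by move=> q /mem_rem; apply: ps.
- by rewrite size_rem //; case: (s) psp ltm.
exists (p :: s'), g'; split=> //.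
  by move=> q; rewrite inE => /predU1P[->|/ps' //]; apply: ps.
by rewrite eg ef' big_cons; ring.
Qed.

(** Clearing denominators: by Gauss's lemma each prime factor of [c] divides [q] or [d] and is
    cancelled there, which leaves the degrees alone. *)
Let factor_cancel c f q d : primitive f -> c != 0 -> c *: f = q * d ->
  exists q' d', [/\ f = q' * d', size q' = size q & size d' = size d].
Proof.
move=> pf c0 e; have [u [s [uu ps ec]]] := fD c0.
rewrite {c0}ec in e; elim: s q d ps e => [|p s IH] q d ps e.
  rewrite big_nil mulr1 in e; exists (u^-1 *: q), d; split=> //.
    by rewrite -scalerAl -e scalerA mulVr // scale1r.
  by rewrite size_scale // invr_eq0; apply: contraTneq uu => ->; rewrite unitr0.
have pp : prime_element p by apply: ps; rewrite mem_head.
have p0 : p%:P != 0 by rewrite polyC_eq0; case: pp.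
have ps' r : r \in s -> prime_element r by move=> qs; apply: ps; rewrite inE qs orbT.
have : divides p%:P (q * d).
  by rewrite -e big_cons mulrCA -scalerA -mul_polyC;
    exists (u * \prod_(r <- s) r *: f); rewrite mulrC.
have szC h : size (h * p%:P) = size h.
  by rewrite mulrC mul_polyC size_scale // -polyC_eq0.
case: (prime_polyC pp) => _ _ /[apply] -[[g eg]|[g eg]].
  have [|q' [d' [e1 e2 e3]]] := IH g d ps'.
    apply: (mulIf p0); rewrite [RHS]mulrAC -eg -e big_cons -!mul_polyC !polyCM.
    by ring.
  by exists q', d'; rewrite e1 e2 e3 eg szC.
have [|q' [d' [e1 e2 e3]]] := IH q g ps'.
  apply: (mulIf p0); rewrite -[RHS]mulrA -eg -e big_cons -!mul_polyC !polyCM.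
  by ring.
by exists q', d'; rewrite e1 e2 e3 eg szC.
Qed.

(** [%|] is divisibility up to a nonzero constant, as over the fraction field. The prime factors of
    the constant do not divide the primitive [f], so they cancel against the quotient. *)
Let dvdp_divides f g : primitive f -> f %| g -> divides f g.
Proof.
move=> [f0 pf] /Pdiv.Idomain.dvdpP[[c q] /= c0 e]; have [u [s [uu ps ec]]] := fD c0.
rewrite {c0}ec in e; elim: s q ps e => [|p s IH] q ps e.
  rewrite big_nil mulr1 in e; exists (u^-1 *: q).
  by rewrite -scalerAl -e scalerA mulVr // scale1r.
have pp : prime_element p by apply: ps; rewrite mem_head.
have p0 : p%:P != 0 by rewrite polyC_eq0; case: pp.
have ps' r : r \in s -> prime_element r by move=> qs; apply: ps; rewrite inE qs orbT.
have : divides p%:P (q * f).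
  by rewrite -e big_cons mulrCA -scalerA -mul_polyC;
    exists (u * \prod_(r <- s) r *: g); rewrite mulrC.
case: (prime_polyC pp) => _ _ /[apply] -[[h eh]|/(pf _ pp) //].
apply: (IH h ps'); apply: (mulIf p0).
by rewrite [RHS]mulrAC -eh -e big_cons -!mul_polyC !polyCM; ring.
Qed.

Let primitive_factor f : primitive f -> exists (u : {poly D}) (s : seq {poly D}),
  [/\ u \is a GRing.unit, forall q, q \in s -> prime_element q
    & f = u * \prod_(q <- s) q].
Proof.
have [m] := ubnP (size f); elim: m f => // m IH f ltm pf; have [f0 nf] := pf.
have [le1|lt1] := leqP (size f) 1.
  (* A primitive constant has no prime factor, so it is a unit. *)
  exists f, [::]; rewrite big_nil mulr1; split=> //.
  have ef := size1_polyC le1; rewrite ef.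
  have c0 : f`_0 != 0 by rewrite -polyC_eq0 -ef.
  have [u [s [uu ps e]]] := fD c0.
  case: s => [|p s] in ps e; first by rewrite e big_nil mulr1 rmorph_unit.
  have pp : prime_element p by apply: ps; rewrite mem_head.
  exfalso; apply: (nf p pp); rewrite ef e big_cons mulrCA mulrC polyCM.
  by exists (u * \prod_(r <- s) r)%:P.
have [[g [h [e [g1 h1]]]]|irr] :=
    pselect (exists g h, f = g * h /\ (1 < size g)%N /\ (1 < size h)%N).
  have g0 : g != 0 by apply: contraTneq g1 => ->; rewrite size_poly0.
  have h0 : h != 0 by apply: contraTneq h1 => ->; rewrite size_poly0.
  have ef : size f = (size g + size h).-1 by rewrite e size_mul.
  have [||u [s [uu ps eg]]] := IH g.
  - by lia.
  - by split=> // p /nf + dp; apply; rewrite e; apply: dividesMr.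
  have [||v [t [vv pt eh]]] := IH h.
  - by lia.
  - by split=> // p /nf + dp; apply; rewrite e; apply: dividesMl.
  exists (u * v), (s ++ t); split.
  - by rewrite unitrM uu vv.
  - by move=> p; rewrite mem_cat => /orP[/ps|/pt].
  - by rewrite e {1}eg {1}eh big_cat /=; ring.
exists 1, [:: f]; split; rewrite ?unitr1 ?big_seq1 ?mul1r // => _ /predU1P[->|//].
split=> //; first by rewrite poly_unitE negb_and gtn_eqF.
move=> a b [c ec]; have fab : f %| a * b by rewrite ec dvdp_mull.
(* Over the fraction field [f] is coprime to [a] or divides it: a nonconstant gcd yields, after
   clearing denominators, a factorization of [f], so it has the degree of [f]. *)
have [cop|ncop] := boolP (coprimep f a).
  by right; apply: dvdp_divides => //; rewrite -(Gauss_dvdpr _ cop).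
left; apply: dvdp_divides => //.
have /Pdiv.Idomain.dvdpP[[e q] /= e0 eq] := dvdp_gcdl f a.
have [q' [d' [ef sq sd]]] := factor_cancel pf e0 eq.
have d0 : gcdp f a != 0 by rewrite gcdp_eq0 negb_and f0.
have sd1 : (1 < size (gcdp f a))%N.
  by rewrite ltn_neqAle eq_sym ncop /= lt0n size_poly_eq0.
have sq1 : (size q' <= 1)%N.
  by rewrite leqNgt; apply/negP => lt; apply: irr; exists q', d'; rewrite sd.
have q0 : q' != 0 by apply: contra_neq f0 => q0; rewrite ef q0 mul0r.
have d'0 : d' != 0 by apply: contra_neq f0 => d'0; rewrite ef d'0 mulr0.
have : gcdp f a %= f.
  rewrite -(dvdp_size_eqp (dvdp_gcdl f a)) -sd ef size_mul //.
  by move: q0 sq1; rewrite -size_poly_gt0; case: (size q') => [|[]].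
by move=> /eqp_dvdl <-; apply: dvdp_gcdr.
Qed.

Lemma factorial_poly : factorial_domain {poly D}.
Proof.
move=> f /primitive_part[s [g [ps /primitive_factor[u [t [uu pt ->]]] ->]]].
exists u, ([seq p%:P | p <- s] ++ t); split=> //.
  by move=> q; rewrite mem_cat => /orP[/mapP[p /ps pp ->]|/pt //]; apply: prime_polyC.
by rewrite big_cat big_map /= mulrCA.
Qed.

End FactorialPoly.

Lemma factorial_iso (D E : idomainType) (f : {rmorphism D -> E})
    (g : {rmorphism E -> D}) :
  cancel f g -> cancel g f -> factorial_domain E -> factorial_domain D.
Proof.
move=> fK gK fE a a0.
have fa0 : f a != 0 by rewrite -(can_eq gK) fK rmorph0.
have [u [s [uu ps e]]] := fE _ fa0.
exists (g u), (map g s); split; first exact: rmorph_unit.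
  move=> _ /mapP[p /ps[p0 pu pp] ->]; split.
  - by rewrite -(can_eq fK) gK rmorph0.
  - by apply: contra pu => /(rmorph_unit f); rewrite gK.
  - move=> b c [d ed]; have : divides p (f b * f c).
      by exists (f d); rewrite -rmorphM ed rmorphM gK.
    by case/pp => -[d' ed']; [left|right]; exists (g d'); rewrite -rmorphM -ed' fK.
by rewrite -(fK a) e rmorphM rmorph_prod big_map.
Qed.

Section MPolyMorphisms.
Variables (k : fieldType) (n : nat).

Lemma mpoly_rmorph_ext (T : comNzRingType) (f g : {rmorphism {mpoly k[n]} -> T}) :
  (forall c, f c%:MP = g c%:MP) -> (forall i, f 'X_i = g 'X_i) -> f =1 g.
Proof.
move=> ec eX p; rewrite [p]mpolyE !rmorph_sum; apply: eq_bigr => m _ /=.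
rewrite -mul_mpolyC !rmorphM ec mpolyXE_id !rmorph_prod; congr (_ * _).
by apply: eq_bigr => i _; rewrite !rmorphXn eX.
Qed.

Definition subst_vars (T : comNzRingType) (h : {rmorphism k -> T}) (v : 'I_n -> T) :
  {mpoly k[n]} -> T := mmap h v.
HB.instance Definition _ (T : comNzRingType) (h : {rmorphism k -> T}) v :=
  GRing.RMorphism.copy (subst_vars h v) (mmap h v).

Lemma subst_varsC (T : comNzRingType) (h : {rmorphism k -> T}) v c :
  subst_vars h v c%:MP = h c.
Proof. exact: mmapC. Qed.

Lemma subst_varsX (T : comNzRingType) (h : {rmorphism k -> T}) v i :
  subst_vars h v 'X_i = v i.
Proof. by rewrite /subst_vars mmapX mmap1U. Qed.

End MPolyMorphisms.

(** Induction on [n]: splitting off the variable of index [ord_max] identifies the ring with a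
    polynomial ring in one variable over the previous one. *)
Lemma factorial_mpoly (k : fieldType) n : factorial_domain {mpoly k[n]}.
Proof.
elim: n => [|n IH].
  move=> a; rewrite (nvar0_mpolyC a) mpolyC_eq0 => a0.
  exists (a@_0%MM)%:MP, [::]; rewrite big_nil mulr1; split=> //.
  by apply: rmorph_unit; rewrite unitfE.
pose f : {rmorphism {mpoly k[n.+1]} -> {poly {mpoly k[n]}}} :=
  subst_vars (polyC \o @mpolyC n k)
    (fun i => if unlift ord_max i is Some j then ('X_j)%:P else 'X).
pose w : {rmorphism {mpoly k[n]} -> {mpoly k[n.+1]}} :=
  subst_vars (@mpolyC n.+1 k) (fun j => 'X_(lift ord_max j)).
pose g : {rmorphism {poly {mpoly k[n]}} -> {mpoly k[n.+1]}} :=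
  horner_eval ('X_ord_max : {mpoly k[n.+1]}) \o map_poly w.
have gC p : g p%:P = w p by rewrite /g /= map_polyC /horner_eval hornerC.
have gX : g 'X = 'X_ord_max by rewrite /g /= map_polyX /horner_eval hornerX.
have fC c : f c%:MP = (c%:MP)%:P by exact: subst_varsC.
have fX i : f 'X_i = if unlift ord_max i is Some j then ('X_j)%:P else 'X.
  exact: subst_varsX.
have wC c : w c%:MP = c%:MP by exact: subst_varsC.
have wX j : w 'X_j = 'X_(lift ord_max j) by exact: subst_varsX.
apply: (@factorial_iso _ _ f g); last exact: factorial_poly.
  move=> p; apply: (@mpoly_rmorph_ext _ _ _ (g \o f) idfun) => [c|i].
    by change (g (f c%:MP) = c%:MP); rewrite fC gC wC.
  change (g (f 'X_i) = 'X_i); rewrite fX.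
  by case: unliftP => [j ->|->] //; rewrite gC wX.
have fw p : f (w p) = p%:P.
  apply: (@mpoly_rmorph_ext _ _ _ (f \o w) polyC) => [c|i].
    by change (f (w c%:MP) = c%:MP%:P); rewrite wC fC.
  by change (f (w 'X_i) = ('X_i)%:P); rewrite wX fX liftK.
elim/poly_ind => [|p c IHp]; first by rewrite [g 0]rmorph0 [f 0]rmorph0.
rewrite [g _]rmorphD [g (p * 'X)]rmorphM [f _]rmorphD [f (_ * _)]rmorphM.
by rewrite IHp gC gX fw fX unlift_none.
Qed.

(** * Homogeneous ideals and growth of families *)

Section Restriction.
Variables (k : fieldType) (N : nat).
Local Notation S := {mpoly k[N]}.
Implicit Types (T : {set 'I_N}) (f g : S) (m : 'X_{1..N}).

(** Sets the variables outside [T] to zero, so that [restr T f = f] says that [f] lies in the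
    subring k[T]. Subrings and quotients by variables are both handled inside S in this way. *)
Definition restr T : S -> S :=
  subst_vars (@mpolyC N k) (fun i => if i \in T then 'X_i else 0).
HB.instance Definition _ T := GRing.RMorphism.copy (restr T)
  (subst_vars (@mpolyC N k) (fun i => if i \in T then 'X_i else 0)).

Lemma restrC T c : restr T c%:MP = c%:MP. Proof. exact: subst_varsC. Qed.

Lemma restrX T i : restr T 'X_i = if i \in T then 'X_i else 0.
Proof. exact: subst_varsX. Qed.

Lemma restrD T f g : restr T (f + g) = restr T f + restr T g.
Proof. exact: rmorphD. Qed.

Lemma restrB T f g : restr T (f - g) = restr T f - restr T g.
Proof. exact: rmorphB. Qed.

Lemma restrN T f : restr T (- f) = - restr T f.
Proof. exact: rmorphN. Qed.

Lemma restrM T f g : restr T (f * g) = restr T f * restr T g.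
Proof. exact: rmorphM. Qed.

Lemma restr_exp T f r : restr T (f ^+ r) = restr T f ^+ r.
Proof. exact: rmorphXn. Qed.

Lemma restrXm T m :
  restr T 'X_[m] = if [forall i, (i \notin T) ==> (m i == 0%N)] then 'X_[m] else 0.
Proof.
rewrite [in LHS]mpolyXE_id rmorph_prod; case: ifPn => [/forallP h|].
  rewrite mpolyXE_id; apply: eq_bigr => i _; rewrite rmorphXn /= restrX.
  by case: ifPn => // iT; have := h i; rewrite iT => /eqP ->; rewrite !expr0.
rewrite negb_forall => /existsP[i]; rewrite negb_imply => /andP[iT mi].
by rewrite (bigD1 i) //= rmorphXn /= restrX (negPf iT) expr0n (negPf mi) mul0r.
Qed.

Lemma mcoeff_restr T f m :
  (restr T f)@_m = if [forall i, (i \notin T) ==> (m i == 0%N)] then f@_m else 0.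
Proof.
rewrite {1}[f]mpolyE rmorph_sum /= raddf_sum /=.
have -> : \sum_(m' <- msupp f) (restr T (f@_m' *: 'X_[m']))@_m =
  \sum_(m' <- msupp f) (if m' == m then
    if [forall i, (i \notin T) ==> (m i == 0%N)] then f@_m else 0 else 0).
  apply: eq_bigr => m' _; rewrite -mul_mpolyC rmorphM /= restrC restrXm.
  rewrite mul_mpolyC mcoeffZ; case: eqP => [->|ne].
    by case: ifP; rewrite ?mcoeff0 ?mulr0 // mcoeffX eqxx mulr1.
  by case: ifP; rewrite ?mcoeff0 ?mulr0 // mcoeffX (introF eqP ne) mulr0.
rewrite -big_mkcond /= -big_filter.
have [msf|nmf] := boolP (m \in msupp f).
  by rewrite filter_pred1_uniq ?msupp_uniq // big_seq1.
by rewrite (memN_msupp_eq0 nmf) if_same big1_seq.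
Qed.

Lemma restr_restr T T' f : restr T (restr T' f) = restr (T :&: T')%SET f.
Proof.
apply: (@mpoly_rmorph_ext _ _ _ (restr T \o restr T')) => [c|i] /=.
  by rewrite !restrC.
by rewrite !restrX inE; case: (i \in T'); rewrite ?rmorph0 ?restrX ?andbT ?andbF.
Qed.

Lemma restr_fixed_sub T T' f : T \subset T' -> restr T f = f -> restr T' f = f.
Proof. by move=> /finset.setIidPr TT' <-; rewrite restr_restr TT'. Qed.

Lemma restr_idem T f : restr T (restr T f) = restr T f.
Proof. by rewrite restr_restr finset.setIid. Qed.

Lemma mcoeff_pihomog d f m :
  (pihomog mdeg d f)@_m = if mdeg m == d then f@_m else 0.
Proof.
have [e|ne] := eqVneq (mdeg m) d; last exact: dhomog_nemf_coeff (pihomogP _ _ _) ne.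
have lef : (msize f <= maxn (msize f) d.+1)%N by apply: leq_maxl.
have -> : f@_m = \sum_(i < maxn (msize f) d.+1) (pihomog mdeg i f)@_m.
  by rewrite {1}(pihomog_partitionE lef) raddf_sum.
rewrite [RHS](bigD1 (Ordinal (leq_maxr (msize f) d.+1))) //=.
rewrite [X in _ = _ + X]big1 ?addr0 // => i ne.
apply: dhomog_nemf_coeff (pihomogP _ _ _) _.
by apply: contraNneq ne => di; rewrite -val_eqE /= -di; apply/eqP.
Qed.

Lemma restr_pihomog T d f : restr T (pihomog mdeg d f) = pihomog mdeg d (restr T f).
Proof.
apply/mpolyP => m; rewrite mcoeff_restr !mcoeff_pihomog mcoeff_restr.
by case: ifP; case: ifP.
Qed.

Lemma sub_restr T (I : set S) f : is_ideal I -> (forall i, i \notin T -> I 'X_i) ->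
  I (f - restr T f).
Proof.
move=> hI IX; rewrite {1 2}[f]mpolyE rmorph_sum /= -sumrB.
apply: ideal_sum => // m _; rewrite -mul_mpolyC rmorphM /= restrC restrXm.
case: ifPn => [_|]; first by rewrite subrr; apply: ideal_0.
rewrite negb_forall => /existsP[i]; rewrite negb_imply => /andP[iT mi].
rewrite mulr0 subr0; apply: ideal_Ml => //.
have le : (U_(i) <= m)%MM by rewrite lep1mP.
by rewrite -(submK le) mpolyXD; apply: ideal_Ml => //; apply: IX.
Qed.

Lemma restr_decomp i f : exists g, f = restr (~: [set i])%SET f + g * 'X_i.
Proof.
suff [e ef] : lincomb [:: 'X_i] (f - restr (~: [set i])%SET f).
  by exists (e 0%N); move: ef; rewrite big_ord1 => <-; rewrite addrC subrK.
apply: sub_restr; first exact: lincomb_ideal.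
by move=> j; rewrite !finset.inE negbK => /eqP ->; apply: (@lincomb_mem _ [:: 'X_i] 0%N).
Qed.

Lemma restr_ker_prime T : prime_ideal [set f | restr T f = 0].
Proof.
split=> [||f g]; rewrite /=; last 2 first.
- by rewrite rmorph1; apply/eqP; apply: oner_neq0.
- by rewrite rmorphM => /eqP; rewrite mulf_eq0 => /orP[/eqP|/eqP]; [left|right].
split=> [|f g|c f] /=; first by rewrite rmorph0.
- by move=> ef eg; rewrite rmorphD /= ef eg addr0.
- by move=> ef; rewrite rmorphM /= ef mulr0.
Qed.

Lemma pihomogMl d e f g : f \is d.-homog ->
  pihomog mdeg e (f * g) = if (d <= e)%N then f * pihomog mdeg (e - d) g else 0.
Proof.
move=> hf; rewrite {1}(pihomog_partitionE (leqnn (msize g))) mulr_sumr raddf_sum /=.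
have H i : pihomog mdeg e (f * pihomog mdeg i g) =
    if (i + d == e)%N then f * pihomog mdeg i g else 0.
  have h : f * pihomog mdeg i g \is (i + d).-homog.
    by rewrite addnC; apply: dhomogM => //; apply: pihomogP.
  have [<-|ne] := eqVneq (i + d)%N e; first by rewrite pihomog_dE.
  by rewrite (pihomog_ne0 ne).
rewrite (eq_bigr (fun i : 'I_(msize g) =>
  if (i + d == e)%N then f * pihomog mdeg i g else 0)) => [|i _]; last exact: H.
case: ifPn => [le|]; last first.
  rewrite -ltnNge => lt; rewrite big1 // => i _.
  by rewrite gtn_eqF // (leq_trans lt) // leq_addl.
have [lt|ge] := ltnP (e - d) (msize g).
  rewrite (bigD1 (Ordinal lt)) //= subnK // eqxx big1 ?addr0 // => i.
  by rewrite -val_eqE /= => ne; rewrite ifN //; apply: contraNneq ne => <-; rewrite addnK.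
rewrite big1 => [|i _].
  suff -> : pihomog mdeg (e - d) g = 0 by rewrite mulr0.
  apply/mpolyP => m; rewrite mcoeff_pihomog mcoeff0; case: eqP => // em.
  by apply: memN_msupp_eq0; apply: msize_mdeg_ge; rewrite em.
by rewrite ifN //; have := ltn_ord i; lia.
Qed.

Lemma pihomog_gt d f : (msize f <= d)%N -> pihomog mdeg d f = 0.
Proof.
move=> le; apply/mpolyP => m; rewrite mcoeff_pihomog mcoeff0; case: eqP => // em.
by apply: memN_msupp_eq0; apply: msize_mdeg_ge; rewrite em.
Qed.

Lemma msize_dhomog d f : f \is d.-homog -> (msize f <= d.+1)%N.
Proof.
by move=> /dhomogP hf; rewrite msizeE; apply/bigmax_leqP_seq => m /hf -> _.
Qed.

Lemma msize_mul_le a b f g : (msize f <= a.+1)%N -> (msize g <= b.+1)%N ->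
  (msize (f * g) <= (a + b).+1)%N.
Proof.
have [->|f0] := eqVneq f 0; first by rewrite mul0r msize0.
have [->|g0] := eqVneq g 0; first by rewrite mulr0 msize0.
move=> la lb; rewrite msizeM //.
by move: (msize f) (msize g) la lb => u v; lia.
Qed.

Lemma msize_exp_le a r f : (msize f <= a.+1)%N -> (msize (f ^+ r) <= (r * a).+1)%N.
Proof.
move=> lf; elim: r => [|r IH]; first by rewrite expr0 msize1.
by rewrite exprS mulSn; apply: msize_mul_le.
Qed.

Lemma ideal_homogP (I : set S) f : is_ideal I ->
  (forall d, I (pihomog mdeg d f)) -> I f.
Proof.
move=> hI h; rewrite (pihomog_partitionE (leqnn (msize f))).
by apply: ideal_sum => // i _; apply: h.
Qed.

Lemma dhomog_const f : f \is 0.-homog -> f = (f@_0%MM)%:MP.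
Proof. by move=> /msize_dhomog /msize1_polyC. Qed.

End Restriction.

Section HomogeneousPrimes.
Variables (k : fieldType) (N : nat).
Local Notation S := {mpoly k[N.+1]}.
Implicit Types (f g : S) (K P : set S).

(** For f and g outside [P] take the highest degrees i and j in which their components are outside
    [P]; the component i + j of f g is the product of these modulo [P]. *)
Lemma homogeneous_prime P : is_ideal P -> homogeneous P -> ~ P 1 ->
  (forall d e f g, f \is d.-homog -> g \is e.-homog -> P (f * g) -> P f \/ P g) ->
  prime_ideal P.
Proof.
move=> iP hP P1 hp; split=> // f g Pfg; apply: contrapT => /not_orP[nf ng].
have top h : ~ P h -> exists2 i, ~ P (pihomog mdeg i h) &
    forall j, (i < j)%N -> P (pihomog mdeg j h).
  move=> nh; have ex : exists i, `[< ~ P (pihomog mdeg i h) >].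
    apply: contrapT => nex; apply: nh; apply: ideal_homogP => // d.
    by apply: contrapT => nd; apply: nex; exists d; apply/asboolP.
  have bnd i : `[< ~ P (pihomog mdeg i h) >] -> (i <= msize h)%N.
    move=> /asboolP nPi; rewrite leqNgt; apply/negP => lt; apply: nPi.
    by rewrite pihomog_gt; [apply: ideal_0 | apply: ltnW].
  exists (ex_maxn ex bnd); case: ex_maxnP => i /asboolP ni maxi // j ltj.
  by apply: contrapT => nj; have := maxi j (asboolT nj); rewrite leqNgt ltj.
have [i ni Pi] := top f nf; have [j nj Pj] := top g ng.
suff : P (pihomog mdeg i f * pihomog mdeg j g).
  by move=> /(hp i j _ _ (pihomogP _ _ _) (pihomogP _ _ _))[].
have := hP _ Pfg (i + j)%N.
have e : pihomog mdeg (i + j) (f * g) = \sum_(d < (maxn (msize f) i.+1))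
    (if (d <= i + j)%N then pihomog mdeg d f * pihomog mdeg (i + j - d) g else 0).
  rewrite {1}(pihomog_partitionE (leq_maxl (msize f) i.+1)) mulr_suml raddf_sum /=.
  by apply: eq_bigr => d _; rewrite (pihomogMl _ _ (pihomogP _ _ _)).
rewrite e (bigD1 (Ordinal (leq_maxr (msize f) i.+1))) //= leq_addr addKn addrC.
apply: ideal_Dl => //; apply: ideal_sum => // d; rewrite -val_eqE /= => ne.
case: ifP => // le; last exact: ideal_0.
have [lt|gt|eq] := ltngtP d i; last by rewrite eq eqxx in ne.
  by apply: ideal_Ml => //; apply: Pj; lia.
by apply: (ideal_Mr _ iP); apply: Pi.
Qed.

(** Builds a homogeneous ideal from a condition on forms that may depend on the degree. For an ideal
    of a local ring, [L d] will speak of the fraction f / z^d. *)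
Lemma graded_ideal (L : nat -> set S) : (forall d, L d 0) ->
  (forall d f g, f \is d.-homog -> g \is d.-homog -> L d f -> L d g -> L d (f + g)) ->
  (forall e d c f, c \is e.-homog -> f \is d.-homog -> L d f -> L (e + d)%N (c * f)) ->
  is_ideal [set f | forall d, L d (pihomog mdeg d f)] /\
  (forall d f, f \is d.-homog -> (forall e, L e (pihomog mdeg e f)) <-> L d f).
Proof.
move=> L0 LD LM; split; last first.
  move=> d f hf; split=> [/(_ d)|Lf e]; first by rewrite pihomog_dE.
  have [<-|ne] := eqVneq d e; first by rewrite pihomog_dE.
  by rewrite (pihomog_ne0 ne hf); apply: L0.
split=> [d|f g Lf Lg d|c f Lf d] /=.
- by rewrite pihomog0; apply: L0.
- by rewrite pihomogD; apply: (LD); first [apply: pihomogP | apply: Lf | apply: Lg].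
rewrite (pihomog_partitionE (leqnn (msize c))) mulr_suml raddf_sum /=.
suff [] : L d (\sum_(i < msize c) pihomog mdeg d (pihomog mdeg i c * f)) /\
    \sum_(i < msize c) pihomog mdeg d (pihomog mdeg i c * f) \is d.-homog by [].
apply: (big_ind (fun g => L d g /\ g \is d.-homog)).
- by split; [apply: L0 | apply: dhomog0].
- by move=> g h [Lg hg] [Lh hh]; split; [apply: LD | apply: dhomogD].
move=> i _; split; last exact: pihomogP.
rewrite (pihomogMl _ _ (pihomogP _ _ _)); case: ifP => [le|_]; last exact: L0.
rewrite -[X in L X _](subnKC le).
by apply: LM; [apply: pihomogP | apply: pihomogP | apply: Lf].
Qed.

Definition homogeneous_elts : set S := [set f | exists d, f \is d.-homog].

Lemma homogeneous_elts_mulclosed : mulclosed homogeneous_elts.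
Proof.
split; first by exists 0%N; apply: dhomog1.
by move=> f g [d hf] [e hg]; exists (d + e)%N; apply: dhomogM.
Qed.

(** A maximal multiplicative set of forms avoiding [K] consists of the forms outside the desired
    prime, which is then recovered from the forms that it contains. *)
Lemma minimal_homogeneous_prime K (M0 : set S) : is_ideal K -> mulclosed M0 ->
  M0 `<=` homogeneous_elts -> (forall f, M0 f -> ~ K f) -> homogeneous K ->
  exists P, [/\ prime_ideal P, homogeneous P, K `<=` P, (forall f, M0 f -> ~ P f)
   & forall d f, f \is d.-homog -> P f ->
       exists t, [/\ ~ P t, homogeneous_elts t & exists r, K (t * f ^+ r)]].
Proof.
move=> iK hM0 M0H M0K hK.
have [M [M0M MH hM MK maxM]] :=
  maximal_mulclosed homogeneous_elts_mulclosed hM0 M0H iK M0K.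
pose L := [set f | exists t, M t /\ exists r, K (t * f ^+ r)].
have iL : is_ideal L by apply: nil_mod_ideal.
have ML f : M f -> ~ L f.
  move=> Mf [t [Mt [r Kr]]]; apply: (MK _ _ Kr).
  by case: (hM) => _; apply=> //; apply: mulclosedX.
have LM f d : f \is d.-homog -> ~ M f -> L f.
  by move=> hf; apply: maxM; exists d.
pose P := [set f | forall d, L (pihomog mdeg d f)].
have [iP Ph] : is_ideal P /\ (forall d f, f \is d.-homog -> P f <-> L f).
  apply: (@graded_ideal (fun=> L)) => [_|_ f g _ _|_ _ c f _ _]; first exact: ideal_0.
    exact: ideal_D.
  exact: ideal_Ml.
have hP : homogeneous P by move=> f Pf d; apply/(Ph d); [apply: pihomogP|].
have LP f d : f \is d.-homog -> ~ P f -> M f.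
  by move=> hf nPf; apply: contrapT => /(LM _ _ hf); rewrite -(Ph d f hf).
exists P; split; last 1 first.
- move=> d f hf /(Ph d f hf)[t [Mt Kt]]; have [e ht] := MH _ Mt.
  exists t; split; [|exact: MH|exact: Kt].
  by move=> /(Ph e t ht); apply: ML.
- apply: (homogeneous_prime iP hP).
    by move=> /(Ph 0%N 1 (dhomog1 _ _)); apply: ML; case: hM.
  move=> d e f g hf hg Pfg; apply: contrapT => /not_orP[/(LP _ d hf) Mf /(LP _ e hg) Mg].
  apply: (ML (f * g)); first by case: hM => _; apply.
  by apply/(Ph (d + e)%N) => //; apply: dhomogM.
- exact: hP.
- move=> f Kf d; exists 1; split; first by case: hM.
  by exists 1%N; rewrite expr1 mul1r; apply: hK.
- move=> f M0f; have Mf := M0M _ M0f; have [d hf] := MH _ Mf.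
  by move=> /(Ph d f hf); apply: ML.
Qed.

End HomogeneousPrimes.

(** * Linear independence and spanning families over k *)

Section Counting.
Variables (k : fieldType) (V : lmodType k).

Definition spanned (K : finType) (gen : K -> V) : set V :=
  [set v | exists c : K -> k, v = \sum_i c i *: gen i].

Lemma spanned0 (K : finType) (gen : K -> V) : spanned gen 0.
Proof. by exists (fun=> 0); rewrite big1 // => i _; rewrite scale0r. Qed.

Lemma spannedD (K : finType) (gen : K -> V) u v :
  spanned gen u -> spanned gen v -> spanned gen (u + v).
Proof.
move=> [c ->] [d ->]; exists (fun i => c i + d i).
by rewrite -big_split /=; apply: eq_bigr => i _; rewrite scalerDl.
Qed.

Lemma spannedZ (K : finType) (gen : K -> V) a u :
  spanned gen u -> spanned gen (a *: u).
Proof.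
move=> [c ->]; exists (fun i => a * c i).
by rewrite scaler_sumr; apply: eq_bigr => i _; rewrite scalerA.
Qed.

Lemma spanned_gen (K : finType) (gen : K -> V) i : spanned gen (gen i).
Proof.
exists (fun j => (j == i)%:R); rewrite (bigD1 i) //= eqxx scale1r big1 ?addr0 // => j.
by move=> /negPf ->; rewrite scale0r.
Qed.

Lemma spanned_sum (K : finType) (gen : K -> V) (T : Type) (r : seq T) (P : pred T) F :
  (forall i, P i -> spanned gen (F i)) -> spanned gen (\sum_(i <- r | P i) F i).
Proof.
move=> h; apply: (big_ind (fun v => spanned gen v)) => //; first exact: spanned0.
by move=> u v; apply: spannedD.
Qed.

(** The coefficients of [fam] in terms of [gen] form a matrix. With more rows than columns, a
    nonzero vector of its left kernel would be a linear relation. *)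
Lemma free_card_le (J K : finType) (fam : J -> V) (gen : K -> V) :
  (forall j, spanned gen (fam j)) ->
  (forall c : J -> k, \sum_j c j *: fam j = 0 -> forall j, c j = 0) ->
  (#|J| <= #|K|)%N.
Proof.
move=> /choice[M eM] free; rewrite leqNgt; apply/negP => lt.
pose A := \matrix_(i < #|J|, l < #|K|) M (enum_val i) (enum_val l).
have : kermx A != 0.
  rewrite kermx_eq0 /row_free; apply: contraTneq lt => <-.
  by rewrite -leqNgt; apply: rank_leq_col.
case/rowV0Pn => v /sub_kermxP vA /negP; apply.
pose c j := v 0 (enum_rank j).
apply/eqP/rowP => i; rewrite mxE -[i]enum_valK.
apply: (free c) => {i}; under eq_bigr do rewrite eM scaler_sumr.
rewrite exchange_big big1 // => l _ /=.
under eq_bigr do rewrite scalerA.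
rewrite -scaler_suml [X in X *: _](_ : _ = 0) ?scale0r //.
have := congr1 (fun B : 'rV_ _ => B 0 (enum_rank l)) vA.
rewrite !mxE (reindex_onto (@enum_rank J) enum_val) /=; last first.
  by move=> i _; rewrite enum_valK.
rewrite (eq_bigl xpredT) => [e|j]; last by rewrite enum_rankK eqxx.
rewrite -[RHS]e; apply: eq_bigr => j _.
by rewrite /c !mxE !enum_rankK.
Qed.

End Counting.

(** * Growth of free families modulo a prime *)

Section Growth.
Variables (k : fieldType) (N : nat).
Local Notation S := {mpoly k[N]}.
Implicit Types (f : S) (q : set S).

(** [h] attaches to a variable the index of its exponent, or [None] if the variable does not
    occur. *)
Definition monom_of (T : finType) (h : 'I_N -> option T) t (a : {ffun T -> 'I_t}) :
  'X_{1..N} := [multinom if h i is Some u then a u : nat else 0 | i < N].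

Lemma mdeg_monom_of (T : finType) (h : 'I_N -> option T) t (a : {ffun T -> 'I_t}) :
  (mdeg (monom_of h a) <= N * t)%N.
Proof.
rewrite mdegE -[X in (_ <= X * t)%N]card_ord -sum_nat_const; apply: leq_sum => i _.
by rewrite mnmE; case: (h i) => // u; apply: ltnW.
Qed.

Lemma spanned_monom t f : (msize f <= t.+1)%N ->
  spanned (fun a : {ffun 'I_N -> 'I_t.+1} => 'X_[monom_of some a] : S) f.
Proof.
move=> lef; rewrite [f]mpolyE big_seq; apply: spanned_sum => m mf.
have lem := leq_trans (msize_mdeg_lt mf) lef.
apply: spannedZ; have mi i : (m i <= t)%N.
  by apply: leq_trans (_ : mdeg m <= t)%N => //; rewrite mdegE (bigD1 i) //= leq_addr.
have -> : m = monom_of some [ffun i => inord (m i) : 'I_t.+1].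
  by apply/mnmP => i; rewrite mnmE ffunE inordK // ltnS.
exact: (spanned_gen (fun a : {ffun 'I_N -> 'I_t.+1} => 'X_[monom_of some a] : S)).
Qed.

Lemma monom_free (T : finType) (h : 'I_N -> option T) t :
  (forall u, exists i, h i = Some u) ->
  forall c : {ffun T -> 'I_t} -> k, \sum_a c a *: 'X_[monom_of h a] = 0 :> S ->
  forall a, c a = 0.
Proof.
move=> hsurj c e a.
have inj b : monom_of h b = monom_of h a -> b = a.
  move=> eb; apply/ffunP => u; have [i hi] := hsurj u; apply: val_inj.
  by have /(congr1 (fun m : 'X_{1..N} => m i)) := eb; rewrite !mnmE hi.
have := congr1 (mcoeff (monom_of h a)) e.
rewrite mcoeff0 raddf_sum /= (bigD1 a) //= mcoeffZ mcoeffX eqxx mulr1.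
rewrite big1 ?addr0 // => b ne; rewrite mcoeffZ mcoeffX.
have -> : (monom_of h b == monom_of h a) = false.
  by apply/negbTE; apply: contra ne => /eqP/inj ->.
by rewrite mulr0.
Qed.

(* A substitute for "the transcendence degree of S/q is at least m". *)
Definition growth q m := exists D : nat, forall s, exists (J : finType) (fam : J -> S),
  [/\ #|J| = (s ^ m)%N, forall j, (msize (fam j) <= (D * s).+1)%N
    & forall c : J -> k, q (\sum_j c j *: fam j) -> forall j, c j = 0].

Lemma growth_sub q q' m : q `<=` q' -> growth q' m -> growth q m.
Proof.
move=> qq' [D h]; exists D => s; have [J [fam [cJ sz free]]] := h s.
by exists J, fam; split=> // c /qq'; apply: free.
Qed.

(* If f lies in q' but not in q, the powers of f times a family free modulo q'
   form a family free modulo q. *)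
Lemma growth_prime q q' m : prime_ideal q -> prime_ideal q' -> q `<` q' ->
  growth q' m -> growth q m.+1.
Proof.
move=> pq pq' [qq' nq] [D h]; have iq' := prime_is_ideal pq'.
have [f qf' nqf] : exists2 f, q' f & ~ q f.
  by apply: contrapT => nex; apply: nq => f qf'; apply: contrapT => nqf; apply: nex; exists f.
exists (D + msize f)%N => s; have [J [fam [cJ sz free]]] := h s.
exists ('I_s * J)%type, (fun ij : 'I_s * J => f ^+ ij.1 * fam ij.2); split.
- by rewrite card_prod card_ord cJ expnS.
- move=> [i j] /=; have hf : (msize (f ^+ i) <= (i * msize f).+1)%N.
    exact: msize_exp_le.
  apply: leq_trans (msize_mul_le hf (sz j)) _; rewrite ltnS mulnDl addnC leq_add2l.
  by rewrite mulnC leq_mul2l ltnW ?orbT.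
move=> c qc; pose P (i : 'I_s) := \sum_j c (i, j) *: fam j.
have {}qc : q (\sum_(i < s) f ^+ i * P i).
  rewrite (eq_bigr (fun i : 'I_s => \sum_j f ^+ i * (c (i, j) *: fam j))).
    rewrite pair_bigA /= [X in q X](_ : _ = \sum_j c j *: (f ^+ j.1 * fam j.2)) //.
    by apply: eq_bigr => -[i j] _ /=; rewrite scalerAr.
  by move=> i _; rewrite mulr_sumr.
suff Pq i : q' (P i) by move=> [i j]; apply: (free (fun j => c (i, j))); exact: Pq.
have [n] := ubnP (i : nat); elim: n i => // n IH i ltn.
have P0 (l : 'I_s) : (l < i)%N -> P l = 0.
  move=> lti; have qP : q' (P l) by apply: IH; lia.
  by rewrite /P big1 // => j _; rewrite (free (fun j => c (l, j)) qP) scale0r.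
pose R := \sum_(l < s | (i < l)%N) f ^+ (l - i.+1) * P l.
have e : \sum_(l < s) f ^+ l * P l = f ^+ i * (P i + f * R).
  rewrite (bigID (fun l : 'I_s => (l < i)%N)) /= big1 ?add0r; last first.
    by move=> l /P0 ->; rewrite mulr0.
  rewrite (bigD1 i) ?ltnn //= mulrDr; congr (_ + _).
  rewrite /R !mulr_sumr; apply: eq_big => l.
    by rewrite -leqNgt -val_eqE /= ltn_neqAle eq_sym andbC.
  rewrite -leqNgt => /andP[le ne].
  have lt : (i < l)%N by rewrite ltn_neqAle le andbT eq_sym.
  by rewrite !mulrA -exprSr -exprD subnKC.
move: qc; rewrite e; case: (pq) => _ _ pM /pM[/(primeX pq) //|/qq'].
by rewrite addrC; apply: ideal_Dl => //; apply: ideal_Mr.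
Qed.

Lemma growth_le q m : is_ideal q -> growth q m -> (m <= N)%N.
Proof.
move=> iq [D h]; rewrite leqNgt; apply/negP => ltNm.
(* Chosen so that s^(N+1) exceeds ((D+1) s)^N, a bound for the number of monomials with exponents at
   most D s. *)
pose s := (D.+1 ^ N).+1; have [J [fam [cJ sz free]]] := h s.
have : (#|J| <= #|{ffun 'I_N -> 'I_(D * s).+1}|)%N.
  apply: (@free_card_le _ _ _ _ fam) => [j|c e]; first exact: spanned_monom (sz j).
  by apply: free; rewrite e; apply: ideal_0.
rewrite cJ card_ffun !card_ord; apply/negP; rewrite -ltnNge.
have le1 : ((D * s).+1 ^ N <= (D.+1 * s) ^ N)%N.
  case: (posnP N) => [->|N0]; first by rewrite !expn0.
  by rewrite leq_exp2r // mulSn addnC -addn1 leq_add2l.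
apply: leq_ltn_trans le1 _; rewrite expnMn.
apply: leq_trans (_ : s ^ N.+1 <= _)%N; last exact: leq_pexp2l.
by rewrite expnS ltn_mul2r expn_gt0 /= ltnS leqnn.
Qed.

Definition independent q (T : {set 'I_N}) := forall f, q f -> restr T f = f -> f = 0.

Lemma independent_growth q T : independent q T -> growth q #|T|.
Proof.
(* Monomials in the variables of [T] with exponents below s have degree at most N s. *)
move=> ind; exists N => s; pose h (i : 'I_N) : option {i | i \in T} := insub i.
exists {ffun {i | i \in T} -> 'I_s}, (fun a => 'X_[monom_of h a]); split.
- by rewrite card_ffun card_ord card_sig.
- by move=> a; rewrite msizeX ltnS mdeg_monom_of.
move=> c qc; apply: monom_free (ind _ qc _) => [u|].
  by exists (val u); rewrite /h valK.
rewrite rmorph_sum; apply: eq_bigr => a _; rewrite -mul_mpolyC rmorphM /= restrC.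
rewrite restrXm ifT //; apply/forallP => i; apply/implyP => iT.
by rewrite mnmE /h insubN.
Qed.

Lemma independent0 q : ~ q 1 -> is_ideal q -> independent q finset.set0.
Proof.
move=> q1 iq f qf e; apply/mpolyP => m; rewrite mcoeff0 -e mcoeff_restr.
case: ifP => // /forallP h.
have m0 : m = 0%MM by apply/mnmP => i; have := h i; rewrite finset.inE mnm0E => /eqP.
have ef : f = (f@_0%MM)%:MP.
  apply/mpolyP => m'; rewrite -{1}e mcoeff_restr mcoeffC.
  case: ifP => [/forallP h'|].
    have -> : m' = 0%MM.
      by apply/mnmP => i; have := h' i; rewrite finset.inE mnm0E => /eqP.
    by rewrite eqxx mulr1.
  case: eqP => [-> /forallP[]|]; last by rewrite mulr0.
  by move=> i; rewrite mnm0E eqxx implybT.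
rewrite m0; apply: contrapT => nz; apply: q1.
have -> : 1 = ((f@_0%MM)^-1)%:MP * f :> S.
  by rewrite [in X in _ * X]ef -mpolyCM mulVf ?mpolyC1 //; apply/eqP.
exact: ideal_Ml.
Qed.

(** [T] is a transcendence basis modulo [q] made of variables. The relation [f] of a further
    variable [u] will contribute one element to a regular sequence. *)
Lemma maximal_independent q : ~ q 1 -> is_ideal q -> exists T, independent q T /\
  forall u, u \notin T -> exists f, [/\ q f, restr (u |: T)%SET f = f & f <> 0].
Proof.
move=> q1 iq; have i0 : `[< independent q finset.set0 >].
  by apply/asboolP; apply: independent0.
pose T := [arg max_(T > finset.set0 | `[< independent q T >]) #|T|].
exists T; rewrite /T; case: arg_maxnP => //= T' /asboolP ind maxT; split=> // u uT.
apply: contrapT => nex.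
have /maxT : `[< independent q (u |: T')%SET >].
  apply/asboolP => f qf ef; apply: contrapT => nf; apply: nex.
  by exists f; split.
by rewrite finset.cardsU1 uT add1n ltnn.
Qed.

End Growth.

(** * Fewer forms than variables have a common zero *)

Section Irrelevant.
Variables (k : fieldType) (N : nat).
Local Notation S := {mpoly k[N]}.

(* If all the X_i are nilpotent modulo hs, then S is a finite module over
   k[hs], so that its Hilbert function has at most the growth s ^ size hs. *)
Lemma irrelevant_not_nilpotent (hs : seq S) :
  (forall i, (i < size hs)%N -> exists2 d, (0 < d)%N & hs`_i \is d.-homog) ->
  (size hs < N)%N -> exists i : 'I_N, forall r, ~ lincomb hs ('X_i ^+ r).
Proof.
move=> hhs ltN; apply: contrapT => nex.
have /choice[e he] : forall i : 'I_N, exists r, lincomb hs ('X_i ^+ r).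
  by move=> i; apply: contrapT => n; apply: nex; exists i => r hr; apply: n; exists r.
have ihs := lincomb_ideal hs.
(* A monomial of degree at least [M0] has some exponent at least [M], hence is divisible by a power
   of a variable lying in the ideal of [hs]. *)
pose M := (\max_i e i).+1; pose M0 := (N * M)%N; set r := size hs in ltN *.
have big_monom (m : 'X_{1..N}) : (M0 <= mdeg m)%N -> lincomb hs 'X_[m].
  move=> leM.
  have [i lei] : exists i, (M <= m i)%N.
    apply: contrapT => n; move: leM; apply/negP; rewrite -ltnNge mdegE /M0.
    have N0 : (0 < N)%N by apply: leq_ltn_trans ltN.
    apply: leq_ltn_trans (_ : \sum_(i < N) M.-1 < _)%N.
      apply: leq_sum => i _; rewrite -ltnS /M /=.
      by rewrite ltnNge; apply/negP => le; apply: n; exists i.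
    by rewrite sum_nat_const card_ord ltn_pmul2l.
  have le : (U_(i) *+ e i <= m)%MM.
    apply/mnm_lepP => j; rewrite mulmnE mnm1E; case: eqP => [<-|_] //.
    rewrite mul1n; apply: leq_trans lei; rewrite ltnW // ltnS.
    exact: (leq_bigmax i).
  by rewrite -(submK le) mpolyXD -mpolyXn; apply: ideal_Ml.
(* Monomials with exponents below [M0] generate S as a module over k[hs]; the exponents of the
   elements of [hs] are cut off at [t]. *)
pose gen t (ab : {ffun 'I_r -> 'I_t} * {ffun 'I_N -> 'I_M0}) : S :=
  (\prod_(i < r) hs`_i ^+ ab.1 i) * 'X_[monom_of some ab.2].
have genS t (i : 'I_r) f : spanned (@gen t) f -> spanned (@gen t.+1) (hs`_i * f).
  move=> [c ->]; rewrite mulr_sumr; apply: spanned_sum => -[a b] _.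
  rewrite -scalerAr; apply: spannedZ.
  pose a' : {ffun 'I_r -> 'I_t.+1} := [ffun j => inord (a j + (j == i))].
  have a'E j : a' j = (a j + (j == i))%N :> nat.
    by rewrite ffunE inordK // ltnS; case: (j == i); rewrite ?addn1 // addn0 ltnW.
  suff -> : hs`_i * gen t (a, b) = gen t.+1 (a', b) by apply: spanned_gen.
  rewrite /gen /= mulrA; congr (_ * _).
  rewrite (bigD1 i) //= [RHS](bigD1 i) //= a'E eqxx addn1 exprS mulrA; congr (_ * _).
  by apply: eq_bigr => j /negPf ne; rewrite a'E ne addn0.
have spanS t : forall f, (msize f <= t)%N -> spanned (@gen t) f.
  elim: t => [|t IH] f.
    by rewrite leqn0 msize_poly_eq0 => /eqP ->; apply: spanned0.
  move=> lef; rewrite [f]mpolyE big_seq; apply: spanned_sum => m mf; apply: spannedZ.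
  have lem : (mdeg m <= t)%N by rewrite -ltnS (leq_trans (msize_mdeg_lt mf)).
  have [ltM|/big_monom[c ec]] := ltnP (mdeg m) M0.
    have mi i : (m i < M0)%N.
      by apply: leq_ltn_trans ltM; rewrite mdegE (bigD1 i) //= leq_addr.
    have -> : 'X_[m] = gen t.+1 ([ffun=> ord0], [ffun i => Ordinal (mi i)]).
      rewrite /gen /= big1 ?mul1r; last by move=> i _; rewrite ffunE expr0.
      by congr 'X_[_]; apply/mnmP => i; rewrite mnmE ffunE.
    exact: spanned_gen.
  have hX : ('X_[m] : S) \is (mdeg m).-homog by apply/dhomogP => m' /mem_msuppXP <-.
  rewrite -(pihomog_dE hX) ec raddf_sum /=; apply: spanned_sum => i _.
  have [d d0 hi] := hhs i (ltn_ord i); rewrite mulrC (pihomogMl _ _ hi).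
  case: ifP => [le|_]; last exact: spanned0.
  apply: genS; apply: IH; apply: leq_trans (msize_dhomog (pihomogP _ _ _)) _.
  lia.
(* With this [t], t^(r+1) exceeds ((N+1) t)^r M0^N, although t^N independent monomials, N > r, would
   lie in a span of that many elements. *)
pose t := (N.+1 ^ r * M0 ^ N).+1.
have : (#|{ffun 'I_N -> 'I_t}| <=
    #|{: {ffun 'I_r -> 'I_(N.+1 * t)} * {ffun 'I_N -> 'I_M0}}|)%N.
  apply: (@free_card_le _ _ _ _ (fun a => 'X_[monom_of some a] : S) (@gen (N.+1 * t)%N)).
    move=> a; apply: spanS; rewrite msizeX mulSn addnC.
    apply: leq_ltn_trans (mdeg_monom_of _ _) _.
    by rewrite -[X in (X < _)%N]addn0 ltn_add2l.
  by apply: monom_free => u; exists u.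
rewrite card_prod !card_ffun !card_ord; apply/negP; rewrite -ltnNge.
rewrite expnMn mulnAC.
apply: leq_trans (_ : t ^ r.+1 <= _)%N; last exact: leq_pexp2l.
by rewrite expnS ltn_mul2r expn_gt0 /= ltnS leqnn.
Qed.

End Irrelevant.

(** * Pseudo-division in one variable and regular elements *)

Section PseudoDivision.
Variables (k : fieldType) (N : nat).
Local Notation S := {mpoly k[N]}.
Implicit Types (T : {set 'I_N}) (u : 'I_N) (f g : S).

(** The coefficients do not involve X_u but are kept in S, so that evaluation at X_u returns the
    polynomial without a change of ring. *)
Definition as_poly u : S -> {poly S} :=
  subst_vars (polyC \o @mpolyC N k) (fun i => if i == u then 'X else ('X_i)%:P).
HB.instance Definition _ u := GRing.RMorphism.copy (as_poly u)
  (subst_vars (polyC \o @mpolyC N k) (fun i => if i == u then 'X else ('X_i)%:P)).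

Lemma as_polyC u c : as_poly u c%:MP = (c%:MP)%:P.
Proof. exact: subst_varsC. Qed.

Lemma as_polyX u i : as_poly u 'X_i = if i == u then 'X else ('X_i)%:P.
Proof. exact: subst_varsX. Qed.

Lemma as_poly_horner u f : (as_poly u f).['X_u] = f.
Proof.
pose h := horner_eval ('X_u : S) \o as_poly u.
apply: (@mpoly_rmorph_ext _ _ _ h idfun) => [c|i].
  by rewrite /h /= /horner_eval as_polyC hornerC.
by rewrite /h /= /horner_eval as_polyX; case: eqP => [->|_]; rewrite ?hornerX ?hornerC.
Qed.

Lemma as_poly_const u f : restr (~: [set u])%SET f = f -> as_poly u f = f%:P.
Proof.
move=> ef; rewrite -ef.
apply: (@mpoly_rmorph_ext _ _ _ (as_poly u \o restr (~: [set u])%SET)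
  (polyC \o restr (~: [set u])%SET)) => [c|i] /=.
  by rewrite restrC as_polyC.
by rewrite restrX !finset.inE; case: eqP => [_|/eqP/negPf ne]; rewrite ?rmorph0 // as_polyX ne.
Qed.

Lemma as_poly_coef u T f i : u \notin T -> restr (u |: T)%SET f = f ->
  restr T (as_poly u f)`_i = (as_poly u f)`_i.
Proof.
move=> uT ef.
pose h1 : {rmorphism S -> {poly S}} :=
  map_poly (restr T) \o (as_poly u \o restr (u |: T)%SET).
pose h2 : {rmorphism S -> {poly S}} := as_poly u \o restr (u |: T)%SET.
suff /(_ f) : h1 =1 h2.
  by rewrite /h1 /h2 /= ef => e; rewrite -{2}e coef_map.
apply: mpoly_rmorph_ext => [c|j]; rewrite /h1 /h2 /=.
  by rewrite restrC as_polyC map_polyC /= restrC.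
rewrite restrX !finset.inE; have [->|ju] := eqVneq j u.
  by rewrite /= as_polyX eqxx map_polyX.
rewrite /=; case: ifPn => jT; last by rewrite !rmorph0.
by rewrite as_polyX (negPf ju) map_polyC /= restrX jT.
Qed.

(* Divide the coefficients of a relation g f = sum c_j gs_j by g in the
   variable u and compare degrees in u: the remainders must cancel. *)
Lemma pseudo_regular u gs g f : g != 0 ->
  (forall j, (j < size gs)%N -> restr (~: [set u])%SET gs`_j = gs`_j) ->
  lincomb gs (g * f) -> exists r, lincomb gs (lead_coef (as_poly u g) ^+ r * f).
Proof.
move=> g0 hgs [c ec]; pose G := as_poly u g.
have G0 : G != 0 by apply: contra_neq g0 => G0; rewrite -(as_poly_horner u g) -/G G0 horner0.
(* [scalp] is the power of the leading coefficient spent in a pseudo-division; its maximum [r]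
   serves all the [H j] at once. *)
pose H j := as_poly u (c j); pose r := (\max_(j < size gs) scalp (H j) G)%N.
pose l := lead_coef G; exists r.
have /choice[Q hQ] : forall j : 'I_(size gs), exists Q : {poly S},
    (size (l ^+ r *: H j - Q * G)%R < size G)%N.
  move=> j; exists (l ^+ (r - scalp (H j) G) *: (H j %/ G)).
  have ler : (scalp (H j) G <= r)%N by apply: (leq_bigmax j).
  rewrite -{1}(subnK ler) exprD -scalerA Pdiv.Idomain.divp_eq scalerDr -scalerAl.
  rewrite addrAC subrr add0r; apply: leq_ltn_trans (size_scale_leq _ _) _.
  by rewrite ltn_modp.
have e1 : G * (l ^+ r *: as_poly u f - \sum_(j < size gs) (gs`_j)%:P * Q j)
    = \sum_(j < size gs) (gs`_j)%:P * (l ^+ r *: H j - Q j * G).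
  under [RHS]eq_bigr do rewrite mulrBr.
  rewrite sumrB mulrBr; congr (_ - _); last first.
    by rewrite mulr_sumr; apply: eq_bigr => j _; ring.
  rewrite -scalerAr -rmorphM ec rmorph_sum scaler_sumr; apply: eq_bigr => j _ /=.
  by rewrite rmorphM /= (as_poly_const (hgs _ (ltn_ord j))) -/(H j) -scalerAr mulrC.
have lt : (size (\sum_(j < size gs) (gs`_j)%:P * (l ^+ r *: H j - Q j * G))%R < size G)%N.
  rewrite -(prednK (n := size G)) ?ltnS ?size_poly_gt0 //.
  apply: leq_trans (size_sum _ _ _) _; apply/bigmax_leqP => j _; rewrite mul_polyC;
    apply: leq_trans (size_scale_leq _ _) _.
  by rewrite -ltnS prednK ?size_poly_gt0.
have /eqP : l ^+ r *: as_poly u f - \sum_(j < size gs) (gs`_j)%:P * Q j = 0.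
  apply/eqP; rewrite -size_poly_eq0 -leqn0 leqNgt; apply/negP; rewrite size_poly_gt0 => nz.
  move: lt; rewrite -e1 size_mul //; move: nz; rewrite -size_poly_gt0.
  by case: (size _) => // m _; rewrite addnS /= ltnNge leq_addr.
rewrite subr_eq0 => /eqP/(congr1 (horner^~ 'X_u)).
rewrite hornerZ as_poly_horner => ->; rewrite horner_sum.
exists (fun j => if insub j is Some i then (Q i).['X_u] else 0).
apply: eq_bigr => j _.
by rewrite valK hornerM hornerC mulrC.
Qed.

(** The elements of [gs] are free of X_u, so [g] can be cancelled up to powers of its leading
    coefficient in X_u. This coefficient is a nonzero polynomial in k[T], hence outside [P]. *)
Lemma independent_regular P T u gs g f : independent P T -> u \notin T -> g != 0 ->
  restr (u |: T)%SET g = g ->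
  (forall j, (j < size gs)%N -> exists2 v, v != u & restr (v |: T)%SET gs`_j = gs`_j) ->
  lincomb gs (g * f) -> exists2 t, ~ P t & lincomb gs (t * f).
Proof.
move=> ind uT g0 eg hgs /(pseudo_regular (u := u) g0)[|r hr].
  move=> j /hgs[v vu]; apply: restr_fixed_sub; apply/fintype.subsetP => i.
  rewrite !finset.inE => /predU1P[->//|iT]; apply: contraNneq uT => <-; exact: iT.
exists (lead_coef (as_poly u g) ^+ r) => //.
have l0 : lead_coef (as_poly u g) != 0.
  rewrite lead_coef_eq0; apply: contra_neq g0 => G0.
  by rewrite -(as_poly_horner u g) G0 horner0.
move=> /ind; rewrite rmorphXn /= lead_coefE (as_poly_coef _ uT eg) => /(_ erefl)/eqP.
by rewrite expf_eq0 -lead_coefE (negPf l0) andbF.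
Qed.

End PseudoDivision.

(** * Local rings of closed subschemes *)

Section LocalRingTheory.
Variables (k : fieldType) (N : nat) (Y : closed_subscheme k N) (p : point_of Y).
Local Notation S := {mpoly k[N.+1]}.
Local Notation J := (ideal_of Y).
Local Notation P := (prime_of p).
Local Notation O := (local_ring p).
Implicit Types (f g h : S) (u v : O).

Let IJ : is_ideal J := ideal_of_ideal Y.
Let hP : prime_ideal P := prime_of_prime p.
Let JP : J `<=` P := @point_on _ _ _ p.

Let Q := {ideal_quot (@stalk_ideal _ _ _ p : idealr (ambient_local_ring p))}.

Definition to_local (a : ambient_local_ring p) : O := \pi_(Q)%qT a.

Let to_localD a b : to_local (a + b) = to_local a + to_local b.
Proof. exact: (rmorphD (\pi_(Q)%qT)). Qed.

Let to_localM a b : to_local (a * b) = to_local a * to_local b.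
Proof. exact: (rmorphM (\pi_(Q)%qT)). Qed.

Let to_local1 : to_local 1 = 1.
Proof. exact: (rmorph1 (\pi_(Q)%qT)). Qed.

Let to_local_eq0 a : to_local a = 0 <-> hfractions p J (val a).
Proof.
have -> : (to_local a = 0) = (\pi_(Q)%qT a = \pi_(Q)%qT 0).
  by rewrite (rmorph0 (\pi_(Q)%qT)).
split=> [/eqP|h]; last apply/eqP.
  by rewrite -Quotient.idealrBE subr0 => /asboolP.
by rewrite -Quotient.idealrBE subr0; apply/asboolP.
Qed.

Let to_local_surj u : exists a, u = to_local a.
Proof. by exists (repr (u : Q)); rewrite /to_local reprK. Qed.

Definition admissible f g := exists d, [/\ f \is d.-homog, g \is d.-homog & ~ P g].

(** [insubd] makes the class of f / g a total function, with value 0 where f / g is not in the local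
    ring of the ambient space. *)
Definition fr f g : O :=
  to_local (insubd (0 : ambient_local_ring p) (tofrac f / tofrac g)).

Let val_fr f g : admissible f g ->
  val (insubd (0 : ambient_local_ring p) (tofrac f / tofrac g)) = tofrac f / tofrac g.
Proof.
move=> [d [hf hg ng]]; rewrite insubdK //; apply/asboolP.
by exists d, f, g; split.
Qed.

Lemma admissibleM f g f' g' : admissible f g -> admissible f' g' ->
  admissible (f * f') (g * g').
Proof.
move=> [d [hf hg ng]] [e [hf' hg' ng']]; exists (d + e)%N.
by split; [apply: dhomogM | apply: dhomogM | apply: primeNM].
Qed.

Lemma admissibleD f g f' g' : admissible f g -> admissible f' g' ->
  admissible (g' * f + g * f') (g * g').
Proof.
move=> [d [hf hg ng]] [e [hf' hg' ng']]; exists (d + e)%N.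
split; [|by apply: dhomogM | by apply: primeNM].
by apply: dhomogD; [rewrite addnC|]; apply: dhomogM.
Qed.

Let neq0 g : ~ P g -> g != 0.
Proof. exact: notin_prime_neq0. Qed.

Lemma frM f g f' g' : admissible f g -> admissible f' g' ->
  fr f g * fr f' g' = fr (f * f') (g * g').
Proof.
move=> a a'; rewrite /fr -to_localM; congr to_local; apply: val_inj.
rewrite /= !val_fr //; [exact: hfracM | exact: admissibleM].
Qed.

Lemma frD f g f' g' : admissible f g -> admissible f' g' ->
  fr f g + fr f' g' = fr (g' * f + g * f') (g * g').
Proof.
move=> a a'; rewrite /fr -to_localD; congr to_local; apply: val_inj.
rewrite /= !val_fr //; last exact: admissibleD.
by case: a a' => [d [_ _ /neq0 ng]] [e [_ _ /neq0 ng']]; apply: hfracD.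
Qed.

Lemma fr_surj u : exists f g, admissible f g /\ u = fr f g.
Proof.
have [a ->] := to_local_surj u; have /asboolP[d [f [g [hf hg _ ng e]]]] := valP a.
have adm : admissible f g by exists d.
exists f, g; split=> //; rewrite /fr; congr to_local; apply: val_inj.
by rewrite val_fr.
Qed.

Lemma fr_eq0 f g : admissible f g ->
  fr f g = 0 <-> exists t, [/\ ~ P t, homogeneous_elts t & J (t * f)].
Proof.
move=> adm; rewrite to_local_eq0 val_fr //; have [d [hf hg ng]] := adm.
split=> [[e [f' [g' [hf' hg' Jf' ng' /eqP]]]]|[t [nt [e ht] Jtf]]]; last first.
  exists (e + d)%N, (t * f), (t * g); split; rewrite ?dhomogM //; first exact: primeNM.
  by rewrite !tofracM -mulf_div divff ?mul1r // tofrac_eq0 neq0.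
rewrite eqr_div ?tofrac_eq0 ?neq0 // -!tofracM tofrac_eq => /eqP e1.
by exists g'; split=> //; [exists e | rewrite mulrC e1; apply: ideal_Mr].
Qed.

Lemma fr_eq f g f' g' : admissible f g -> admissible f' g' ->
  f * g' = f' * g -> fr f g = fr f' g'.
Proof.
move=> a a' e; rewrite /fr; congr to_local; apply: val_inj; rewrite !val_fr //.
case: a a' => [d [_ _ /neq0 ng]] [d' [_ _ /neq0 ng']].
by apply/eqP; rewrite eqr_div ?tofrac_eq0 // -!tofracM e.
Qed.

Lemma fr1 g : admissible g g -> fr g g = 1.
Proof.
move=> a; rewrite /fr -to_local1; congr to_local; apply: val_inj; rewrite val_fr //=.
by case: a => d [_ _ /neq0 ng]; rewrite divff // tofrac_eq0.
Qed.

Lemma relevant_elt : exists i, ~ P 'X_i.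
Proof. exact: prime_of_relevant. Qed.

Definition relevant_index := projT1 (cid relevant_elt).
Local Notation z := ('X_relevant_index : S).

Lemma relevant_notin : ~ P z.
Proof. by rewrite /relevant_index; case: cid. Qed.

Lemma admissible_z f d : f \is d.-homog -> admissible f (z ^+ d).
Proof.
move=> hf; exists d; split=> //; last by apply: primeNX relevant_notin.
rewrite -[X in X.-homog]mul1n; apply: dhomogMn.
by apply/dhomogP => m /mem_msuppXP <-; apply: mdeg1.
Qed.

Let P1 : ~ P 1. Proof. by case: hP. Qed.

Let h1 : homogeneous_elts (1 : S).
Proof. exact: (proj1 (homogeneous_elts_mulclosed _ _)). Qed.

Let hM f g : homogeneous_elts f -> homogeneous_elts g -> homogeneous_elts (f * g).
Proof. exact: (proj2 (homogeneous_elts_mulclosed _ _)). Qed.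

Lemma admissible01 c : c = 0 \/ c = 1 -> admissible c 1.
Proof.
by case=> ->; exists 0%N; split=> //; rewrite ?dhomog0 ?dhomog1.
Qed.

(** Only some representative f / g is required to have its numerator in [K] up to a denominator;
    [extensionP] shows that the choice does not matter. *)
Definition extension (K : set S) : set O := [set u | exists f g t,
  [/\ admissible f g, u = fr f g, ~ P t, homogeneous_elts t & K (t * f)]].

Lemma extensionP K f g : is_ideal K -> J `<=` K -> admissible f g ->
  extension K (fr f g) <-> exists t, [/\ ~ P t, homogeneous_elts t & K (t * f)].
Proof.
move=> iK JK adm; split=> [[f' [g' [t [adm' e nt ht Kt]]]]|[t [nt ht Kt]]]; last first.
  by exists f, g, t.
have [d [hf hg ng]] := adm; have [d' [hf' hg' ng']] := adm'.
have ad1 : admissible (f * g') (g * g').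
  by apply: admissibleM => //; exists d'.
have ad2 : admissible (f' * g) (g' * g).
  by apply: admissibleM => //; exists d.
have ad3 : admissible (- (f' * g)) (g' * g).
  by case: ad2 => e0 [hn hd nd]; exists e0; split=> //; rewrite dhomogN.
have : fr (f * g') (g * g') + fr (- (f' * g)) (g' * g) = 0.
  have -> : fr (f * g') (g * g') = fr f g by apply: fr_eq => //; ring.
  rewrite e (_ : fr f' g' = fr (f' * g) (g' * g)); last by apply: fr_eq => //; ring.
  rewrite frD //; apply/fr_eq0; first exact: admissibleD.
  exists 1; split; [exact: P1|exact: h1|].
  by rewrite mulrN subrr mulr0; apply: ideal_0.
rewrite frD // fr_eq0; last exact: admissibleD.
move=> [s [ns hs Js]].
exists (t * (s * (g * g' * g'))); split.
- apply: (primeNM hP nt); apply: (primeNM hP ns).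
  by apply: (primeNM hP) => //; apply: (primeNM hP).
- apply: (hM ht); apply: (hM hs).
  by apply: hM; [apply: hM; [exists d|exists d']|exists d'].
have -> : t * (s * (g * g' * g')) * f =
  t * (s * (g' * g * (f * g') + g * g' * (- (f' * g)))) + s * g * g * g' * (t * f') by ring.
by apply: ideal_D => //; apply: ideal_Ml => //; apply: JK.
Qed.

Lemma extension_ideal K : is_ideal K -> J `<=` K -> is_ideal (extension K).
Proof.
move=> iK JK; split.
- have a01 : admissible 0 1 by apply: admissible01; left.
  exists 0, 1, 1; split; [exact: a01| |exact: P1|exact: h1|].
    apply/esym/(fr_eq0 a01); exists 1.
    by split; [exact: P1|exact: h1|rewrite mulr0; apply: ideal_0].
  by rewrite mulr0; apply: ideal_0.
- move=> _ _ [f [g [t [a -> nt ht Kt]]]] [f' [g' [t' [a' -> nt' ht' Kt']]]].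
  exists (g' * f + g * f'), (g * g'), (t * t'); split.
  + exact: admissibleD.
  + exact: frD.
  + exact: primeNM.
  + exact: hM.
  + have -> : t * t' * (g' * f + g * f') = t' * g' * (t * f) + t * g * (t' * f') by ring.
    by apply: ideal_D => //; apply: ideal_Ml.
- move=> c _ [f [g [t [a -> nt ht Kt]]]]; have [h [h' [a' ->]]] := fr_surj c.
  exists (h * f), (h' * g), t; split=> //; [exact: admissibleM | exact: frM |].
  by rewrite mulrCA; apply: ideal_Ml.
Qed.

Lemma fr_unit f g : admissible f g -> ~ P f -> exists v, fr f g * v = 1.
Proof.
move=> a nf; have [d [hf hg ng]] := a; exists (fr g f).
have a' : admissible g f by exists d.
rewrite frM //; have := admissibleM a a'; rewrite [g * f]mulrC => ?.
exact: fr1.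
Qed.

Lemma nonunits_fr f g : admissible f g -> @nonunits O (fr f g) <-> P f.
Proof.
move=> a; split=> [nu|Pf [v]].
  by apply: contrapT => /(fr_unit a).
have [f' [g' [a' ->]]] := fr_surj v.
have [d [hf hg ng]] := a; have [d' [hf' hg' ng']] := a'.
have nu : ~ extension P 1.
  have a1 : admissible 1 1 by apply: admissible01; right.
  rewrite -(fr1 a1) (extensionP (prime_is_ideal hP) JP a1) => -[t [nt _]].
  by rewrite mulr1.
rewrite frM // => e1; apply: nu; rewrite -e1.
apply/(extensionP (prime_is_ideal hP) JP (admissibleM a a')).
exists 1; split; [exact: P1|exact: h1|].
by rewrite mul1r; apply: ideal_Mr => //; apply: prime_is_ideal.
Qed.

Lemma extension_prime q : prime_ideal q -> J `<=` q -> q `<=` P ->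
  prime_ideal (extension q).
Proof.
move=> pq Jq qP; have iq := prime_is_ideal pq.
have E f g : admissible f g -> extension q (fr f g) <-> q f.
  move=> a; rewrite extensionP //; split=> [[t [nt _]]|qf].
    by case: pq => _ _ h /h[/qP //|].
  exists 1; split; [exact: P1|exact: h1|].
  by rewrite mul1r.
have a1 : admissible 1 1 by apply: admissible01; right.
split; first exact: extension_ideal.
- by rewrite -(fr1 a1) E //; case: pq.
move=> u v; have [f [g [a ->]]] := fr_surj u; have [f' [g' [a' ->]]] := fr_surj v.
rewrite frM // !E //; last exact: admissibleM.
by case: pq => _ _; apply.
Qed.

Lemma nonunitsE : @nonunits O = extension P.
Proof.
apply/seteqP; split=> u; have [f [g [a ->]]] := fr_surj u.
  move=> /(nonunits_fr a) Pf; exists f, g, 1.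
  by split; [exact: a| |exact: P1|exact: h1|rewrite mul1r].
rewrite (nonunits_fr a) (extensionP (prime_is_ideal hP) JP a) => -[t [nt _]].
by case: hP => _ _ h /h[].
Qed.

Lemma nonunits_prime : prime_ideal (@nonunits O).
Proof. by rewrite nonunitsE; apply: extension_prime. Qed.

Lemma extension_proper K K' d f : is_ideal K -> J `<=` K -> is_ideal K' -> J `<=` K' ->
  K `<=` K' -> f \is d.-homog -> K' f ->
  (forall t, ~ P t -> homogeneous_elts t -> ~ K (t * f)) ->
  extension K `<` extension K'.
Proof.
move=> iK JK iK' JK' KK' hf K'f nK; split.
  by move=> _ [f0 [g [t [a -> nt ht Kt]]]]; exists f0, g, t; split=> //; apply: KK'.
move=> /(_ (fr f (z ^+ d))); rewrite !extensionP //; try exact: admissible_z.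
case; first by exists 1; split; [exact: P1|exact: h1|rewrite mul1r].
by move=> t [nt ht]; apply: nK.
Qed.

(** A form of degree d becomes an element of the local ring after division by z^d. Contraction
    carries chains of primes of the local ring to homogeneous primes of S, whose growth can be
    compared. *)
Definition contraction (q : set O) : set S :=
  [set f | forall d, q (fr (pihomog mdeg d f) (z ^+ d))].

Let fr0z d : fr 0 (z ^+ d) = 0.
Proof.
apply/fr_eq0; first by apply: admissible_z; apply: dhomog0.
by exists 1; split; [exact: P1|exact: h1|rewrite mulr0; apply: ideal_0].
Qed.

Lemma frMz d e f g : f \is d.-homog -> g \is e.-homog ->
  fr (f * g) (z ^+ (d + e)) = fr f (z ^+ d) * fr g (z ^+ e).
Proof. by move=> hf hg; rewrite frM ?exprD //; apply: admissible_z. Qed.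

Lemma frDz d f g : f \is d.-homog -> g \is d.-homog ->
  fr (f + g) (z ^+ d) = fr f (z ^+ d) + fr g (z ^+ d).
Proof.
move=> hf hg; have [a b] := (admissible_z hf, admissible_z hg).
rewrite frD //; apply: fr_eq; last by ring.
  by apply: admissible_z; apply: dhomogD.
exact: admissibleD.
Qed.

Lemma contraction_graded q : is_ideal q -> is_ideal (contraction q) /\
  (forall d f, f \is d.-homog -> contraction q f <-> q (fr f (z ^+ d))).
Proof.
move=> iq; apply: (@graded_ideal _ _ (fun d f => q (fr f (z ^+ d)))) => [d|d f g|e d c f].
- by rewrite fr0z; apply: ideal_0.
- by move=> hf hg qf qg; rewrite frDz //; apply: ideal_D.
- by move=> hc hf qf; rewrite frMz //; apply: ideal_Ml.
Qed.

Lemma contraction_homog q d f : is_ideal q -> f \is d.-homog ->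
  contraction q f <-> q (fr f (z ^+ d)).
Proof. by move=> /contraction_graded[_]; apply. Qed.

Lemma contraction_homogeneous q : is_ideal q -> homogeneous (contraction q).
Proof.
move=> iq f qf d; apply/(contraction_homog iq (pihomogP _ _ _)); exact: qf.
Qed.

Lemma contraction_prime q : prime_ideal q -> prime_ideal (contraction q).
Proof.
move=> pq; have iq := prime_is_ideal pq; have [ic ch] := contraction_graded iq.
apply: (homogeneous_prime ic (contraction_homogeneous iq)).
  rewrite (ch 0%N 1 (dhomog1 _ _)) expr0 fr1; first by case: pq.
  by apply: admissible01; right.
move=> d e f g hf hg; rewrite (ch _ _ (dhomogM hf hg)) frMz //.
by rewrite (ch _ _ hf) (ch _ _ hg); case: pq => _ _; apply.
Qed.

Lemma contraction_sup q : is_ideal q -> J `<=` contraction q.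
Proof.
move=> iq f Jf d; have hf := ideal_of_homogeneous Jf d.
suff -> : fr (pihomog mdeg d f) (z ^+ d) = 0 by apply: ideal_0.
apply/fr_eq0; first by apply: admissible_z; apply: pihomogP.
by exists 1; split; [exact: P1|exact: h1|rewrite mul1r].
Qed.

Lemma contraction_sub q : prime_ideal q -> contraction q `<=` P.
Proof.
move=> pq f qf; apply: ideal_homogP; first exact: prime_is_ideal.
move=> d; apply: contrapT => nP; have qfd := qf d.
have [v e] := fr_unit (admissible_z (pihomogP mdeg d f)) nP.
by case: (pq) => iq + _; apply; rewrite -e; apply: ideal_Mr.
Qed.

(** A fraction f / g equals f / z^d up to the unit g / z^d, so strictness of an inclusion can be
    tested on the forms of the contractions. *)
Lemma contraction_proper q q' : prime_ideal q -> prime_ideal q' -> q `<` q' ->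
  contraction q `<` contraction q'.
Proof.
move=> pq pq' [qq' nq]; have [iq iq'] := (prime_is_ideal pq, prime_is_ideal pq').
split=> [f qf d|cc]; first by apply: qq'; apply: qf.
apply: nq => u qu; have [f [g [a eu]]] := fr_surj u; have [d [hf hg ng]] := a.
have fz : fr f (z ^+ d) = u * fr g (z ^+ d).
  rewrite eu frM //; last exact: admissible_z.
  apply: fr_eq; [exact: admissible_z | | by ring].
  by apply: admissibleM => //; apply: admissible_z.
have [v ev] := fr_unit (admissible_z hg) ng.
have -> : u = fr f (z ^+ d) * v by rewrite fz -mulrA ev mulr1.
apply: ideal_Mr => //; apply/(contraction_homog iq hf); apply: cc.
by apply/(contraction_homog iq' hf); rewrite fz; apply: ideal_Mr.
Qed.

Lemma extension_contraction (K : set S) q : is_ideal q -> K `<=` contraction q ->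
  extension K `<=` q.
Proof.
move=> iq Kq _ [f [g [t [a -> nt ht /Kq]]]].
have [[d [hf hg ng]] [e het]] := (a, ht); have htf := dhomogM het hf.
rewrite (contraction_homog iq htf) => qtf.
have az : admissible (z ^+ (e + d)) (t * g).
  exists (e + d)%N; split.
  - rewrite -[X in X.-homog]mul1n; apply: dhomogMn.
    by apply/dhomogP => m /mem_msuppXP <-; apply: mdeg1.
  - exact: dhomogM.
  - exact: primeNM.
suff -> : fr f g = fr (t * f) (z ^+ (e + d)) * fr (z ^+ (e + d)) (t * g).
  exact: ideal_Mr.
rewrite frM //; last exact: admissible_z.
apply: fr_eq => //; last by ring.
by apply: admissibleM => //; apply: admissible_z.
Qed.

End LocalRingTheory.

Arguments extension {k N Y} p K _.

(** * Bounds for chains of primes *)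

Section DimensionBound.
Variables (k : fieldType) (N : nat).

(** Removing the elements of [W] one at a time gives ever smaller primes generated by variables. The
    growth increases with each step and never exceeds [N]. *)
Lemma restr_ker_growth (W : {set 'I_N}) m :
  growth [set f : {mpoly k[N]} | restr (~: W)%SET f = 0] m -> (m + #|W| <= N)%N.
Proof.
have [s] := ubnP #|W|; elim: s W m => // s IH W m lts gm.
have [->|/finset.set0Pn[i iW]] := eqVneq W finset.set0.
  rewrite finset.cards0 addn0; apply: growth_le gm.
  exact: prime_is_ideal (restr_ker_prime k _).
rewrite (finset.cardsD1 i) iW addnA addn1.
apply: IH; first by move: lts; rewrite (finset.cardsD1 i) iW; lia.
have Wi : ((~: W) \subset (~: (W :\ i)))%SET.
  by rewrite finset.setCS finset.subD1set.
apply: growth_prime gm; [exact: restr_ker_prime | exact: restr_ker_prime |].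
split=> [f /= f0|/(_ 'X_i)].
  have := restr_restr (~: W)%SET (~: (W :\ i))%SET f.
  by rewrite f0 rmorph0 (finset.setIidPl Wi) => <-.
rewrite /= !restrX !finset.inE iW eqxx /= => /(_ erefl)/eqP.
by rewrite -msize_poly_eq0 msizeX.
Qed.

End DimensionBound.

Section ChainBound.
Variables (k : fieldType) (N : nat).

(** The top of the contracted chain has growth at least [#|T|], and each step down adds one. The
    bottom contains the variables of [W], which bounds its growth. *)
Lemma chain_independent_bound (Y : closed_subscheme k N) (p : point_of Y)
    (T W : {set 'I_N.+1}) (q : nat -> set (local_ring p)) l :
  independent (prime_of p) T ->
  (forall i, i \in W -> exists r, ideal_of Y ('X_i ^+ r)) ->
  (forall i, (i <= l)%N -> prime_ideal (q i)) ->
  (forall i, (i < l)%N -> q i `<` q i.+1) ->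
  (l + #|T| + #|W| <= N.+1)%N.
Proof.
move=> indT nilW pq cq.
have gP : growth (contraction (q l)) #|T|.
  apply: growth_sub (independent_growth indT).
  by apply: contraction_sub; apply: pq.
have gl j : (j <= l)%N -> growth (contraction (q (l - j)%N)) (j + #|T|).
  elim: j => [|j IH] lej; first by rewrite subn0.
  rewrite addSn; apply: growth_prime (IH (ltnW lej)).
  - by apply: contraction_prime; apply: pq; lia.
  - by apply: contraction_prime; apply: pq; lia.
  - have -> : (l - j = (l - j.+1).+1)%N by lia.
    by apply: contraction_proper; [apply: pq; lia | apply: pq; lia | apply: cq; lia].
have p0 : prime_ideal (contraction (q 0%N)) by apply: contraction_prime; apply: pq.
have := gl l (leqnn l); rewrite subnn => g0.
apply: restr_ker_growth; apply: growth_sub g0 => f /= f0.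
rewrite -[f]subr0 -f0; apply: sub_restr; first exact: prime_is_ideal.
move=> i; rewrite finset.inE negbK => /nilW[r Jr]; apply: (primeX p0 (r := r)).
by apply: contraction_sup Jr; apply: prime_is_ideal; apply: pq.
Qed.

End ChainBound.

Section Lincomb.
Variables (k : fieldType) (N : nat).
Local Notation S := {mpoly k[N.+1]}.

Lemma lincomb_homogeneous (s : seq S) :
  (forall i, (i < size s)%N -> exists d, s`_i \is d.-homog) ->
  homogeneous (lincomb s).
Proof.
move=> hs _ [c ->] d; rewrite raddf_sum /=.
have ils := lincomb_ideal s; apply: (big_ind (fun f => lincomb s f)) => [||i _].
- exact: ideal_0.
- by move=> f g; apply: ideal_D.
have [e he] := hs i (ltn_ord i); rewrite mulrC (pihomogMl _ _ he).
case: ifP => _; last exact: ideal_0 (lincomb_ideal s).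
apply: (ideal_Mr _ (lincomb_ideal s)); exact: lincomb_mem.
Qed.

Lemma homogeneous_add (I J : set S) : homogeneous I -> homogeneous J ->
  homogeneous (ideal_add I J).
Proof.
move=> hI hJ _ [f If [g Jg <-]] d; rewrite pihomogD.
by exists (pihomog mdeg d f); [apply: hI | exists (pihomog mdeg d g); [apply: hJ|]].
Qed.

(** Some component of [t] is outside [P], and it can replace [t] because [f] is a form and [K] is
    homogeneous. *)
Lemma homogeneous_denominator (K P : set S) d t f : homogeneous K ->
  is_ideal P -> f \is d.-homog -> ~ P t -> K (t * f) ->
  exists t', [/\ ~ P t', homogeneous_elts t' & K (t' * f)].
Proof.
move=> hK iP hf nt Kt; apply: contrapT => nex; apply: nt.
apply: ideal_homogP => // e; apply: contrapT => ne; apply: nex.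
exists (pihomog mdeg e t); split=> //; first by exists e; apply: pihomogP.
have := hK _ Kt (d + e)%N.
by rewrite mulrC (pihomogMl _ _ hf) leq_addr addKn mulrC.
Qed.

End Lincomb.

(** * Iterated extensions of the structure sheaf of X *)

Section Coordinates.
Variables (k : fieldType) (n : nat).
Local Notation S := {mpoly k[n.+3]}.
Local Notation x := (coord_x k n).
Local Notation y := (coord_y k n).
Local Notation z0 := (coord_z0 k n).
Local Notation I := (@IX k n).
Implicit Types (f g a b c : S).

Definition index_x : 'I_n.+3 := inord n.+1.
Definition index_y : 'I_n.+3 := inord n.+2.
(** [restr zvars], abbreviated [rho], is the projection of S onto R = k[z_0, ..., z_n] with kernel
    [IX]. *)
Definition zvars : {set 'I_n.+3} := (~: [set index_x; index_y])%SET.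
Local Notation rho := (restr zvars).

Lemma index_xy : (index_x == index_y) = false.
Proof. by rewrite -val_eqE /= !inordK // ltn_eqF. Qed.

Lemma rho_x : rho x = 0.
Proof. by rewrite restrX !finset.inE eqxx. Qed.

Lemma rho_y : rho y = 0.
Proof. by rewrite restrX !finset.inE eqxx orbT. Qed.

Lemma ord0_zvars : ord0 \in zvars.
Proof. by rewrite !finset.inE -!val_eqE /= !inordK. Qed.

Lemma rho_z0 : rho z0 = z0.
Proof. by rewrite restrX ord0_zvars. Qed.

Lemma card_zvars : (#|zvars| + 2 = n.+3)%N.
Proof.
have := finset.cardsC [set index_x; index_y]%SET; rewrite card_ord -/zvars.
by rewrite finset.cards2 index_xy /= addnC.
Qed.

Lemma IX_ideal : is_ideal I. Proof. exact: ideal_gen_is_ideal. Qed.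

Lemma IX_x : I x. Proof. by apply: ideal_gen_mem; left. Qed.

Lemma IX_y : I y. Proof. by apply: ideal_gen_mem; right. Qed.

Lemma IX_sub (K : set S) : is_ideal K -> K x -> K y -> I `<=` K.
Proof. by move=> iK Kx Ky; apply: ideal_gen_sub => // f [->|->]. Qed.

Lemma sub_rho (K : set S) f : is_ideal K -> K x -> K y -> K (f - rho f).
Proof.
move=> iK Kx Ky; apply: sub_restr => // i.
by rewrite !finset.inE negbK => /orP[/eqP->|/eqP->].
Qed.

Lemma IXE f : I f <-> rho f = 0.
Proof.
split=> [|f0]; last by rewrite -[f]subr0 -f0; exact: (sub_rho f IX_ideal IX_x IX_y).
apply: (@IX_sub [set g | rho g = 0]); first exact: prime_is_ideal (restr_ker_prime k _).
  exact: rho_x.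
exact: rho_y.
Qed.

Lemma IX_prime : prime_ideal I.
Proof.
have -> : I = [set f | rho f = 0] by apply/funext => f; apply/propext; apply: IXE.
exact: restr_ker_prime.
Qed.

Lemma IX_homogeneous : homogeneous (I : set S).
Proof. by move=> f /IXE f0 d; apply/IXE; rewrite restr_pihomog f0 pihomog0. Qed.

Lemma coord_homog i : ('X_i : S) \is 1.-homog.
Proof. by apply/dhomogP => m /mem_msuppXP <-; apply: mdeg1. Qed.

Lemma mpolyX_neq0 i : ('X_i : S) != 0.
Proof. by rewrite -msize_poly_eq0 msizeX. Qed.

Lemma IXN_z0 : ~ I z0.
Proof. by move/IXE; rewrite rho_z0 => /eqP; rewrite (negPf (mpolyX_neq0 _)). Qed.

Lemma IXN1 : ~ I 1. Proof. by case: IX_prime. Qed.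

(* Successive extensions by copies of S/IX: J <= H = J + e S with IX e in J and
   S/IX ~ H/J. *)
Inductive tower : nat -> set S -> Prop :=
| tower0 : tower 0 setT
| towerS r (H J : set S) e d : tower r H -> is_ideal J -> homogeneous J ->
    e \is d.-homog -> J `<=` H -> H e -> (forall f, H f -> exists c, J (f - c * e)) ->
    (forall a, I a <-> J (a * e)) -> tower r.+1 J.

(** For an ideal with radical [IX] this means that it is primary. *)
Definition IX_saturated (J : set S) := forall s f, ~ I s -> J (s * f) -> J f.

Lemma tower_ideal r J : tower r J -> is_ideal J.
Proof. by case. Qed.

Lemma tower_homogeneous r J : tower r J -> homogeneous J.
Proof. by case. Qed.

(** Elements outside [IX] act injectively on the domain S/IX, hence on every iterated extension of
    it by itself. *)
Lemma tower_saturated r J : tower r J -> IX_saturated J.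
Proof.
elim=> // {}r H {}J e d tH IH iJ hJ he JH He HJ eJ s f ns Jsf.
have [c Jc] : exists c, J (f - c * e) by apply: HJ; apply: (IH s) => //; apply: JH.
apply/(ideal_sub_mod iJ Jc)/eJ.
have : I (s * c).
  apply/eJ; rewrite -mulrA; apply: (ideal_Dl iJ (a := s * (f - c * e))).
    exact: ideal_Ml.
  by rewrite -mulrDr subrK.
by case: IX_prime => _ _ h /h[].
Qed.

Lemma tower_pow r J : tower r J -> ideal_pow I r `<=` J.
Proof.
elim=> // {}r H {}J e d tH IH iJ hJ he JH He HJ eJ; apply: ideal_powS_sub => // a b Ia /IH Hb.
have [c Jc] := HJ _ Hb; have -> : a * b = a * (b - c * e) + c * (a * e) by ring.
by apply: ideal_D => //; apply: ideal_Ml => //; apply/eJ.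
Qed.

Lemma tower_sub r J : tower r.+1 J -> J `<=` I.
Proof.
move E: r.+1 => r' tJ; case: tJ E => // {}r' H {}J e d tH iJ hJ he JH He HJ eJ _ f Jf.
by apply/eJ; apply: ideal_Mr.
Qed.

Lemma tower_radical r J : tower r.+1 J -> radical J = I.
Proof.
move=> tJ; apply/seteqP; split=> f.
  by move=> [m /(tower_sub tJ)]; apply: primeX; exact: IX_prime.
by move=> If; exists r.+1; apply: (tower_pow tJ); apply: ideal_powX.
Qed.

Lemma tower_scheme r J : tower r.+1 J ->
  exists Y : closed_subscheme k n.+2, ideal_of Y = J.
Proof.
move=> tJ; have sJ : saturated J.
  move=> f /(_ ord0)[m]; apply: (tower_saturated tJ).
  by move=> /(primeX IX_prime); apply: IXN_z0.
by exists (ClosedSubscheme (tower_ideal tJ) (tower_homogeneous tJ) sJ).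
Qed.

(* The elements fixed by rho are those of R = k[z_0, ..., z_n], so this says
   that S/J is free over R. *)
Definition free_mod (J : set S) (e : seq S) :=
  (forall f, exists2 c : nat -> S, (forall i, rho (c i) = c i)
     & J (f - \sum_(i < size e) c i * e`_i)) /\
  (forall c : nat -> S, (forall i, rho (c i) = c i) ->
     J (\sum_(i < size e) c i * e`_i) -> forall i, (i < size e)%N -> c i = 0).

(** A basis of S/H is completed by [e], which generates H/J freely over R; [rho] moves its
    coefficient into R. *)
Lemma tower_free r J : tower r J -> exists e, free_mod J e.
Proof.
elim=> [|{}r H {}J e d tH [s [gen free]] iJ hJ he JH He HJ eJ].
  by exists [::]; split=> // f; exists (fun=> 0) => // i; rewrite rmorph0.
have iH := tower_ideal tH.
have rec (c : nat -> S) : \sum_(i < size (rcons s e)) c i * (rcons s e)`_i =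
    \sum_(i < size s) c i * s`_i + c (size s) * e.
  rewrite size_rcons big_ord_recr /= nth_rcons ltnn eqxx; congr (_ + _).
  by apply: eq_bigr => i _; rewrite nth_rcons ltn_ord.
exists (rcons s e); split=> [f|c rc].
  have [c rc /HJ[b Jb]] := gen f.
  pose c' i := if (i < size s)%N then c i else rho b; exists c'.
    by move=> i; rewrite /c'; case: ifP => _; rewrite ?rc ?restr_idem.
  rewrite rec (eq_bigr (fun i : 'I_(size s) => c i * s`_i)); last first.
    by move=> i _; rewrite /c' ltn_ord.
  rewrite /c' ltnn opprD addrA.
  have -> t : t - rho b * e = (t - b * e) + (b - rho b) * e by ring.
  apply: ideal_D => //; apply/eJ; apply/IXE.
  by rewrite rmorphB /= restr_idem subrr.
rewrite rec => Jc.
have c0 i : (i < size s)%N -> c i = 0.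
  apply: free => //; have := JH _ Jc; rewrite addrC; apply: ideal_Dl => //.
  exact: ideal_Ml.
move: Jc; rewrite big1 ?add0r => [/eJ/IXE|i _]; last by rewrite c0 ?mul0r.
rewrite rc => cs i; rewrite size_rcons ltnS leq_eqVlt => /predU1P[->//|].
exact: c0.
Qed.

(** Regularity of [g] modulo [gs] passes to S/J coordinate by coordinate, since [g] and [gs] lie in
    R and S/J is free over R. The denominators of the finitely many coordinates are multiplied. *)
Lemma free_regular (J P : set S) (e gs : seq S) g : is_ideal J -> prime_ideal P ->
  free_mod J e -> (forall f, lincomb gs (g * f) -> exists2 t, ~ P t & lincomb gs (t * f)) ->
  (forall i, (i < size gs)%N -> rho gs`_i = gs`_i) -> rho g = g ->
  forall f, ideal_add (lincomb gs) J (g * f) ->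
  exists2 t, ~ P t & ideal_add (lincomb gs) J (t * f).
Proof.
move=> iJ pP [gen free] reg rgs rg f [_ [h ->] [j Jj ej]].
have [c rc Jc] := gen f.
have /choice[b hb] : forall l, exists b : nat -> S, (forall i, rho (b i) = b i) /\
    J (h l - \sum_(i < size e) b i * e`_i).
  by move=> l; have [b rb Jb] := gen (h l); exists b.
have key i : (i < size e)%N -> lincomb gs (g * c i).
  move=> lti; exists (fun l => b l i); apply/eqP; rewrite -subr_eq0; apply/eqP.
  (* The coordinates of [g * f] minus a combination of [gs]. This difference is congruent to an
     element of [J], so they vanish. *)
  pose w i := g * c i - \sum_(l < size gs) b l i * gs`_l.
  apply: (free w) lti => [i0|].
    rewrite /w rmorphB rmorphM rmorph_sum /= rg rc; congr (_ - _).
    by apply: eq_bigr => l _; rewrite rmorphM /= rgs // (proj1 (hb l)).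
  have -> : \sum_(i < size e) w i * e`_i =
      j + (\sum_(l < size gs) gs`_l * (h l - \sum_(i < size e) b l i * e`_i))
      - g * (f - \sum_(i < size e) c i * e`_i).
    rewrite mulrBr -ej opprB [in RHS]addrC; under [X in _ + (_ + X)]eq_bigr do rewrite mulrBr.
    rewrite sumrB.
    have -> : \sum_(l < size gs) gs`_l * h l = \sum_(l < size gs) h l * gs`_l.
      by apply: eq_bigr => l _; rewrite mulrC.
    have -> : \sum_(l < size gs) gs`_l * \sum_(i < size e) b l i * e`_i =
        \sum_(i < size e) (\sum_(l < size gs) b l i * gs`_l) * e`_i.
      under eq_bigr do rewrite mulr_sumr; rewrite exchange_big; apply: eq_bigr => i0 _ /=.
      by rewrite mulr_suml; apply: eq_bigr => l _; ring.
    have -> : \sum_(i < size e) w i * e`_i = g * (\sum_(i < size e) c i * e`_i) -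
        \sum_(i < size e) (\sum_(l < size gs) b l i * gs`_l) * e`_i.
      by rewrite mulr_sumr -sumrB; apply: eq_bigr => i0 _; rewrite /w mulrBl mulrA.
    by ring.
  apply: ideal_B => //; last exact: ideal_Ml.
  apply: ideal_D => //; apply: ideal_sum => // l _; apply: ideal_Ml => //.
  by case: (hb l).
have /choice[t ht] : forall i, exists t, ~ P t /\ ((i < size e)%N -> lincomb gs (t * c i)).
  move=> i; have [lti|_] := ltnP i (size e); last by exists 1; split=> //; case: pP.
  by have [t nt lt] := reg _ (key i lti); exists t.
exists (\prod_(i < size e) t i).
  apply: (big_ind (fun s => ~ P s)); [by case: pP | |by move=> i _; case: (ht i)].
  by move=> a a'; apply: primeNM.
set T := \prod_(i < _) t i.
exists (\sum_(i < size e) T * c i * e`_i).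
  apply: (big_ind (fun f => lincomb gs f)); [exact: ideal_0 (lincomb_ideal gs) | |].
    by move=> a a'; apply: ideal_D; apply: lincomb_ideal.
  move=> i _; apply: (ideal_Mr _ (lincomb_ideal gs)).
  rewrite /T (bigD1 i) //= mulrAC; apply: (ideal_Mr _ (lincomb_ideal gs)).
  by case: (ht i) => _; apply.
exists (T * (f - \sum_(i < size e) c i * e`_i)); first exact: ideal_Ml.
rewrite mulrBr mulr_sumr; under eq_bigr do rewrite -mulrA.
by rewrite addrC subrK.
Qed.

End Coordinates.

(** * Towers define Cohen-Macaulay schemes *)

Section TowerSchemes.
Variables (k : fieldType) (n : nat).
Local Notation S := {mpoly k[n.+3]}.
Local Notation I := (@IX k n).
Local Notation Z := (zvars n).
Local Notation rho := (restr Z).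
Implicit Types (f g a : S).

Lemma independent_zvars (P : set S) T : is_ideal P -> I `<=` P -> independent P T ->
  (T \subset Z)%SET.
Proof.
move=> iP IP ind; apply/fintype.subsetP => i iT; apply: contraT.
rewrite finset.inE negbK => iW.
have : P 'X_i.
  by apply: IP; move: iW; rewrite !finset.inE => /orP[/eqP->|/eqP->]; [apply: IX_x | apply: IX_y].
by move=> /ind; rewrite restrX iT => /(_ erefl)/eqP; rewrite (negPf (mpolyX_neq0 _ _)).
Qed.

Lemma maximal_independent_homogeneous (P : set S) : prime_ideal P -> homogeneous P ->
  exists T, independent P T /\
  forall u, u \notin T -> exists fd : S * nat,
    [/\ P fd.1, restr (u |: T)%SET fd.1 = fd.1, fd.1 != 0 & fd.1 \is fd.2.-homog].
Proof.
move=> pP hP; have iP := prime_is_ideal pP.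
have [|T [ind max]] := maximal_independent _ iP; first by case: pP.
exists T; split=> // u /max[f [Pf rf f0]]; apply: contrapT => nex; apply: f0.
rewrite (pihomog_partitionE (leqnn (msize f))) big1 // => d _.
apply/eqP; apply: contrapT => /negP fd0; apply: nex.
exists (pihomog mdeg d f, nat_of_ord d); split=> //=; [exact: hP| |exact: pihomogP].
by rewrite restr_pihomog rf.
Qed.

(** The regular sequence consists of one form for each z-variable outside a transcendence basis [T]
    modulo [P], algebraic over k[T] in that variable alone. It is regular on S, hence on the free
    R-module S/J, and its length meets the bound for chains of primes. *)
Lemma tower_cohen_macaulay r (Y : closed_subscheme k n.+2) :
  tower r.+1 (ideal_of Y) -> cohen_macaulay Y.
Proof.
move=> tJ p; set J := ideal_of Y in tJ; set P := prime_of p.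
have pP : prime_ideal P by exact: prime_of_prime.
have hP : homogeneous P by exact: prime_of_homogeneous.
have iP := prime_is_ideal pP; have iJ : is_ideal J := ideal_of_ideal Y.
have hJ : homogeneous J by exact: ideal_of_homogeneous.
have JP : J `<=` P by exact: point_on.
have IP : I `<=` P by apply: prime_pow pP _; apply: subset_trans JP; exact: tower_pow tJ.
have [T [ind max]] := maximal_independent_homogeneous pP hP.
have TZ := independent_zvars iP IP ind.
have [e freeJ] := tower_free tJ.
have /choice[gd hgd] : forall u, exists fd : S * nat, u \notin T ->
    [/\ P fd.1, restr (u |: T)%SET fd.1 = fd.1, fd.1 != 0 & fd.1 \is fd.2.-homog].
  move=> u; have [uT|/max[fd hfd]] := boolP (u \in T); last by exists fd.
  by exists (0, 0%N).
pose us := enum (Z :\: T)%SET; pose u0 : 'I_n.+3 := ord0.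
have us_mem i : (i < size us)%N -> nth u0 us i \in (Z :\: T)%SET.
  by move=> lti; rewrite -mem_enum mem_nth.
pose gs := [seq (gd u).1 | u <- us].
pose z := ('X_(relevant_index p) : S).
pose s : seq (local_ring p) := [seq fr p (gd u).1 (z ^+ (gd u).2) | u <- us].
have szg : size gs = size us by rewrite size_map.
have szs : size s = size us by rewrite size_map.
have gs_nth i : (i < size us)%N -> gs`_i = (gd (nth u0 us i)).1.
  by move=> lti; rewrite (nth_map u0).
have s_nth i : (i < size us)%N ->
    s`_i = fr p (gd (nth u0 us i)).1 (z ^+ (gd (nth u0 us i)).2).
  by move=> lti; rewrite (nth_map u0).
have props i : (i < size us)%N -> let u := nth u0 us i in
    [/\ P (gd u).1, restr (u |: T)%SET (gd u).1 = (gd u).1, (gd u).1 != 0,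
        (gd u).1 \is (gd u).2.-homog & u \notin T].
  move=> lti u; have := us_mem i lti; rewrite finset.inE => /andP[uT _].
  by have [] := hgd u uT.
have rho_gs i : (i < size us)%N -> rho gs`_i = gs`_i.
  move=> lti; rewrite gs_nth //; have [_ rg _ _ _] := props i lti.
  apply: restr_fixed_sub rg; rewrite finset.subUset TZ andbT finset.sub1set.
  by have := us_mem i lti; rewrite finset.inE => /andP[].
apply: (@cohen_macaulay_of_regular _ s); first exact: nonunits_prime.
  move=> i; rewrite szs => lti; have [Pg rg g0 hg uT] := props i lti.
  have adg := admissible_z p hg.
  rewrite s_nth //; split; first exact/nonunits_fr.
  move=> /= a; have [f [h [adf ->]]] := fr_surj a; rewrite frM //.
  set g := (gd _).1 in Pg rg g0 hg adg *; set d := (gd _).2 in hg adg *.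
  pose K := ideal_add (lincomb (take i gs)) J.
  have iK : is_ideal K by apply: ideal_add_ideal => //; apply: lincomb_ideal.
  have JK : J `<=` K by apply: ideal_addr; apply: lincomb_ideal.
  have hK : homogeneous K.
    apply: homogeneous_add => //; apply: lincomb_homogeneous => j.
    rewrite size_take_min leq_min szg => /andP[ji js].
    rewrite nth_take // gs_nth //; have [_ _ _ hgj _] := props j js.
    by exists (gd (nth u0 us j)).2.
  have gen_sub : ideal_gen [set` take i s] `<=` extension p K.
    apply: ideal_gen_take_sub; first exact: extension_ideal.
    move=> j ji; rewrite szs => js; have [_ _ _ hgj _] := props j js.
    rewrite s_nth //; apply/extensionP => //; first exact: admissible_z.
    exists 1; split; [by case: pP|exact: (proj1 (homogeneous_elts_mulclosed _ _))|].
    rewrite mul1r; apply: ideal_addl => //; rewrite -gs_nth // -(nth_take 0 ji).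
    by apply: lincomb_mem; rewrite size_take_min leq_min ji szg.
  move=> /gen_sub/extensionP-/(_ iK JK (admissibleM adg adf))[t [nt _]].
  rewrite mulrCA => Kgf.
  have [|||t' nt' Kt] := @free_regular _ _ J P e (take i gs) g iJ pP freeJ _ _ _ (t * f) Kgf.
  - move=> f'; apply: (independent_regular ind uT g0 rg) => j.
    rewrite size_take_min leq_min szg => /andP[ji js].
    exists (nth u0 us j); first by rewrite nth_uniq ?enum_uniq // ltn_eqF.
    by rewrite nth_take // gs_nth //; have [] := props j js.
  - move=> j; rewrite size_take_min leq_min szg => /andP[ji js].
    by rewrite nth_take // rho_gs.
  - by rewrite /g -gs_nth // rho_gs.
  have [df [hf hh nh]] := adf.
  rewrite mulrA in Kt.
  have [t2 [nt2 ht2 Kt2]] := homogeneous_denominator hK iP hf (primeNM pP nt' nt) Kt.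
  have iG : is_ideal (ideal_gen [set` take i s]) by apply: ideal_gen_is_ideal.
  apply: (extension_contraction iG (K := K)); last by exists f, h, t2.
  apply: ideal_add_sub; first exact: (proj1 (contraction_graded iG)).
    apply: lincomb_sub; first exact: (proj1 (contraction_graded iG)).
    move=> j; rewrite size_take_min leq_min szg => /andP[ji js].
    have [_ _ _ hgj _] := props j js.
    rewrite nth_take // gs_nth //; apply/(contraction_homog iG hgj).
    by rewrite -/z -s_nth //; apply: ideal_gen_take_nth => //; rewrite szs.
  exact: contraction_sup.
move=> q l pq cq; rewrite szs -cardE.
(* x and y are nilpotent, so a chain of primes has at most n + 3 - 2 - #|T| steps, the number of
   z-variables outside [T]. *)
have nilW i : i \in (~: Z)%SET -> exists m, J ('X_i ^+ m).
  rewrite finset.setCK !finset.inE => iW; exists r.+1; apply: (tower_pow tJ).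
  by apply: ideal_powX; case/orP: iW => /eqP ->; [apply: IX_x | apply: IX_y].
have := chain_independent_bound ind nilW pq cq.
have := card_zvars n; have := subset_leq_card TZ.
rewrite finset.setCK finset.cards2 index_xy /= finset.cardsD (finset.setIidPr TZ).
move: #|_| #|_| => zs ts; lia.
Qed.

End TowerSchemes.

(** * Multiplicities of towers *)

Section TowerMultiplicity.
Variables (k : fieldType) (n : nat).
Local Notation S := {mpoly k[n.+3]}.
Local Notation I := (@IX k n).
Implicit Types (f g a c : S).

Lemma generic_relevant : exists i, ~ I ('X_i : S).
Proof. by exists ord0; apply: IXN_z0. Qed.

Definition generic_proj_point : proj_point k n.+2 :=
  ProjPoint (@IX_prime k n) (@IX_homogeneous k n) generic_relevant.

Lemma homogeneous_quotient (J : set S) f e c d d' : is_ideal J -> homogeneous J ->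
  f \is d.-homog -> e \is d'.-homog -> J (f - c * e) ->
  exists2 c', J (f - c' * e) & (d' <= d)%N /\ c' \is (d - d').-homog \/ c' = 0.
Proof.
move=> iJ hJ hf he Jc; have := hJ _ Jc d.
rewrite pihomogB (pihomog_dE hf) mulrC (pihomogMl _ _ he).
case: ifP => [le|_]; last by rewrite subr0 => Jf; exists 0; [rewrite mul0r subr0 | right].
by move=> Jf; exists (pihomog mdeg (d - d') c); [rewrite mulrC | left; split=> //; apply: pihomogP].
Qed.

Lemma tower_chain r (J : set S) : tower r J -> exists M : nat -> set S,
  [/\ M 0%N = setT, M r = J, forall i, is_ideal (M i), forall i, J `<=` M i
    & forall i, (i < r)%N -> exists H e d, [/\ M i = H, tower i H & e \is d.-homog] /\
      [/\ tower i.+1 (M i.+1), M i.+1 `<=` H, forall f, H f -> exists c, M i.+1 (f - c * e)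
        & forall a, I a <-> M i.+1 (a * e)]].
Proof.
elim=> [|{}r H {}J e d tH [M [M0 Mr iM JM stepM]] iJ hJ he JH He HJ eJ].
  by exists (fun=> setT); split.
pose M' i := if (i <= r)%N then M i else J; exists M'.
have M'lt i : (i <= r)%N -> M' i = M i by rewrite /M' => ->.
have M'r : M' r.+1 = J by rewrite /M' ltnn.
split=> //.
- by move=> i; rewrite /M'; case: ifP.
- by move=> i f Jf; rewrite /M'; case: ifP => // _; apply: JM; apply: JH.
move=> i; rewrite ltnS leq_eqVlt => /predU1P[->|lti].
  rewrite M'lt // M'r; exists H, e, d; split; split=> //.
  exact: towerS tH iJ hJ he JH He HJ eJ.
by rewrite !M'lt ?(ltnW lti) //; apply: stepM.
Qed.

(** At the generic point of X each quotient S/IX of the tower becomes the residue field, so the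
    tower localizes to a filtration with simple quotients. *)
Lemma tower_multiplicity r (Y : closed_subscheme k n.+2) :
  tower r.+1 (ideal_of Y) -> exists2 mu, multiplicity Y mu & (mu <= r.+1)%N.
Proof.
move=> tJ; set J := ideal_of Y in tJ.
have JI : J `<=` prime_of generic_proj_point by exact: tower_sub tJ.
pose p := @PointOf k n.+2 Y generic_proj_point JI.
have iJ : is_ideal J := ideal_of_ideal Y.
suff [mu len le] : exists2 mu, ring_length (local_ring p) mu & (mu <= r.+1)%N.
  by exists mu => //; exists p.
have [M [M0 Mr iM JM stepM]] := tower_chain tJ.
have hM1 : homogeneous_elts (1 : S) := proj1 (homogeneous_elts_mulclosed k n.+2).
apply: (@ring_length_le _ _ (fun i => extension p (M i))) => [||i lti u v].
- apply/seteqP; split=> // u _; have [f [g [a ->]]] := fr_surj u.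
  by exists f, g, 1; split=> //; [apply: IXN1 | rewrite M0].
- rewrite Mr => _ [f [g [t [a -> nt ht Jtf]]]]; apply/fr_eq0 => //.
  by exists t.
have [H [e [d [[<- tH he] [tJ' J'H HJ' eJ']]]]] := stepM i lti.
set J' := M i.+1 in tJ' J'H HJ' eJ' *; have iJ' := tower_ideal tJ'.
have hJ' := tower_homogeneous tJ'.
have sJ' := tower_saturated tJ'; have sH := tower_saturated tH.
move=> [f [g [t [adf -> nt ht Htf]]]] nJ' [f' [g' [t' [adf' -> nt' ht' Htf']]]].
have Hf := sH _ _ nt Htf; have Hf' := sH _ _ nt' Htf'.
have [[df [hf hg ng]] [df' [hf' hg' ng']]] := (adf, adf').
have ext h h' : admissible p h h' -> J' h -> extension p J' (fr p h h').
  by move=> ad Jh; exists h, h', 1; split=> //; [apply: IXN1 | rewrite mul1r].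
have [c0 Jc0] := HJ' _ Hf; have [c1 Jc1] := HJ' _ Hf'.
have [c Jc [[le hc]|c00]] := homogeneous_quotient iJ' hJ' hf he Jc0; last first.
  by case: nJ'; apply: ext => //; move: Jc; rewrite c00 mul0r subr0.
have nIc : ~ I c.
  move=> /eJ' Jce; apply: nJ'; apply: ext => //.
  by rewrite -(subrK (c * e) f); apply: ideal_D.
have [c' Jc' [[le' hc']|c00]] := homogeneous_quotient iJ' hJ' hf' he Jc1; last first.
  exists 0; rewrite mul0r subr0; apply: ext => //.
  by move: Jc'; rewrite c00 mul0r subr0.
(* Modulo the smaller ideal f = c e and f' = c' e, so f' / g' is the multiple (c' g) / (c g') of f /
   g. The sign turns the difference into a sum of fractions. *)
have adv : admissible p (- (c' * g)) (c * g').
  exists (df' - d + df)%N; split.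
  - by rewrite dhomogN; apply: dhomogM.
  - by rewrite (_ : df' - d + df = (df - d) + df')%N; [apply: dhomogM | lia].
  - by apply: primeNM => //; apply: IX_prime.
exists (- fr p (- (c' * g)) (c * g')); rewrite mulNr opprK frM // frD //; last first.
  exact: admissibleM.
apply: ext; first by apply: admissibleD => //; apply: admissibleM.
have -> : c * g' * g * f' + g' * (- (c' * g) * f) =
  g * g' * (c * (f' - c' * e) - c' * (f - c * e)) by ring.
by apply: ideal_Ml => //; apply: ideal_B => //; apply: ideal_Ml.
Qed.

End TowerMultiplicity.

(** * The normal forms *)

Section LincombSmall.
Variable A : comNzRingType.
Implicit Types (a b c d f : A).

Lemma lincomb2P a b f : lincomb [:: a; b] f <-> exists u v, f = u * a + v * b.
Proof.
split=> [[c ->]|[u [v ->]]].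
  by exists (c 0%N), (c 1%N); rewrite !big_ord_recl big_ord0 addr0.
by exists (nth 0 [:: u; v]); rewrite !big_ord_recl big_ord0 addr0.
Qed.

Lemma lincomb3P a b c f : lincomb [:: a; b; c] f <->
  exists u v w, f = u * a + v * b + w * c.
Proof.
split=> [[e ->]|[u [v [w ->]]]].
  by exists (e 0%N), (e 1%N), (e 2%N); rewrite !big_ord_recl big_ord0 addr0 addrA.
by exists (nth 0 [:: u; v; w]); rewrite !big_ord_recl big_ord0 addr0 addrA.
Qed.

Lemma lincomb4P a b c d f : lincomb [:: a; b; c; d] f <->
  exists u v w t, f = u * a + v * b + w * c + t * d.
Proof.
split=> [[e ->]|[u [v [w [t ->]]]]].
  exists (e 0%N), (e 1%N), (e 2%N), (e 3%N).
  by rewrite !big_ord_recl big_ord0 addr0 !addrA.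
by exists (nth 0 [:: u; v; w; t]); rewrite !big_ord_recl big_ord0 addr0 !addrA.
Qed.

Lemma lincomb_subP (s : seq A) I : is_ideal I -> (forall a, a \in s -> I a) ->
  lincomb s `<=` I.
Proof. by move=> iI sI; apply: lincomb_sub => // i lti; apply: sI; rewrite mem_nth. Qed.

Lemma lincomb_in (s : seq A) a : a \in s -> lincomb s a.
Proof. by case/(nthP 0) => i lti <-; apply: lincomb_mem. Qed.

End LincombSmall.

Section NormalForms.
Variables (k : fieldType) (n : nat).
Local Notation S := {mpoly k[n.+3]}.
Local Notation x := (coord_x k n).
Local Notation y := (coord_y k n).
Local Notation z0 := (coord_z0 k n).
Local Notation I := (@IX k n).
Local Notation rho := (restr (zvars n)).
Implicit Types (f g a b c : S) (J K : set S).

(** [D], [J3], [I2] and [J5] are the second to the fifth normal form; [I2] is the square of [IX]. *)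
Let D : set S := lincomb [:: x ^+ 2; y].
Let J3 : set S := lincomb [:: x ^+ 3; y].
Let I2 : set S := lincomb [:: x ^+ 2; x * y; y ^+ 2].
Let J5 : set S := lincomb [:: x ^+ 2 + z0 * y; x * y; y ^+ 2].

Let x0 : x != 0. Proof. exact: mpolyX_neq0. Qed.
Let y0 : y != 0. Proof. exact: mpolyX_neq0. Qed.
Let hx : x \is 1.-homog. Proof. exact: coord_homog. Qed.
Let hy : y \is 1.-homog. Proof. exact: coord_homog. Qed.
Let hz0 : z0 \is 1.-homog. Proof. exact: coord_homog. Qed.

Lemma IX_lincomb : I = lincomb [:: x; y].
Proof.
apply/seteqP; split.
  by apply: IX_sub; [exact: lincomb_ideal | |]; apply: lincomb_in; rewrite !inE eqxx ?orbT.
apply: lincomb_subP; first exact: IX_ideal.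
by move=> a; rewrite !inE => /orP[]/eqP->; [apply: IX_x | apply: IX_y].
Qed.

Lemma IXP f : I f <-> exists u v, f = u * x + v * y.
Proof. by rewrite IX_lincomb lincomb2P. Qed.

Local Notation sy := (restr (~: [set index_y n])%SET).

Let sy_x : sy x = x.
Proof. by rewrite restrX !finset.inE index_xy. Qed.

Let sy_y : sy y = 0.
Proof. by rewrite restrX !finset.inE eqxx. Qed.

Let rho_sy f : rho (sy f) = rho f.
Proof.
rewrite restr_restr (finset.setIidPl _) // finset.setCS finset.sub1set.
by rewrite !finset.inE eqxx orbT.
Qed.

Let cancel_x a u r : a * x ^+ r = u * x ^+ r.+1 -> rho a = 0.
Proof.
move=> e; have -> : a = u * x.
  by apply: (mulIf (expf_neq0 r x0)); rewrite -mulrA -exprS.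
by rewrite rmorphM /= rho_x mulr0.
Qed.

Let homog2 (a b : S) : (exists d, a \is d.-homog) -> (exists d, b \is d.-homog) ->
  homogeneous (lincomb [:: a; b]).
Proof. by move=> ha hb; apply: lincomb_homogeneous => -[|[|i]]. Qed.

Let homog3 (a b c : S) : (exists d, a \is d.-homog) -> (exists d, b \is d.-homog) ->
  (exists d, c \is d.-homog) -> homogeneous (lincomb [:: a; b; c]).
Proof. by move=> ha hb hc; apply: lincomb_homogeneous => -[|[|[|i]]]. Qed.

Let hxr r : exists d, x ^+ r \is d.-homog.
Proof. by exists (1 * r)%N; apply: dhomogMn. Qed.

Let hyr r : exists d, y ^+ r \is d.-homog.
Proof. by exists (1 * r)%N; apply: dhomogMn. Qed.

Let hxy : exists d, x * y \is d.-homog.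
Proof. by exists (1 + 1)%N; apply: dhomogM. Qed.

Lemma tower_IX : tower 1 I.
Proof.
apply: (@towerS _ _ _ setT _ 1 0%N) => //.
- exact: tower0.
- exact: IX_ideal.
- exact: IX_homogeneous.
- exact: dhomog1.
- by move=> f _; exists f; rewrite mulr1 subrr; apply: ideal_0 (IX_ideal _ _).
- by move=> a; rewrite mulr1.
Qed.

Let D_colon a : D (a * x) -> I a.
Proof.
move=> /lincomb2P[u [v e]].
apply/IXE; rewrite -rho_sy; apply: (@cancel_x _ (sy u) 1%N); rewrite expr1.
rewrite -{1}sy_x -restrM e restrD (restrM _ u) (restrM _ v) sy_y mulr0 addr0 restr_exp sy_x.
reflexivity.
Qed.

Let J3_colon a : J3 (a * x ^+ 2) -> I a.
Proof.
move=> /lincomb2P[u [v e]].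
apply/IXE; rewrite -rho_sy; apply: (@cancel_x _ (sy u) 2%N).
rewrite -{1}sy_x -restr_exp -restrM e restrD (restrM _ u) (restrM _ v) sy_y mulr0 addr0 restr_exp sy_x.
reflexivity.
Qed.

(** Setting y = 0 leaves u x^2 = 0, so y divides [u]. In the computation of the colon ideals by y,
    the relation can then be divided by y. *)
Let cancel_sy u v : sy (u * x ^+ 2 + v * y) = 0 -> exists g, u = g * y.
Proof.
rewrite restrD [sy (u * _)]restrM [sy (v * _)]restrM restr_exp sy_x sy_y mulr0 addr0 => /eqP.
rewrite mulf_eq0 expf_eq0 (negPf x0) andbF orbF => /eqP su.
by have [g eg] := restr_decomp (index_y n) u; exists g; rewrite {1}eg su add0r.
Qed.

Let I2_colon a : I2 (a * y) -> I a.
Proof.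
move=> /lincomb3P[u [v [w e]]].
have [|g eg] := @cancel_sy u (v * x + w * y).
  have -> : u * x ^+ 2 + (v * x + w * y) * y = a * y by rewrite e; ring.
  by rewrite restrM sy_y mulr0.
have -> : a = g * x ^+ 2 + v * x + w * y by apply: (mulIf y0); rewrite e eg; ring.
by apply/IXP; exists (g * x + v), w; ring.
Qed.

Let J5_colon a : J5 (a * y) -> I a.
Proof.
move=> /lincomb3P[u [v [w e]]].
have [|g eg] := @cancel_sy u (u * z0 + v * x + w * y).
  have -> : u * x ^+ 2 + (u * z0 + v * x + w * y) * y = a * y by rewrite e; ring.
  by rewrite restrM sy_y mulr0.
have -> : a = g * (x ^+ 2 + z0 * y) + v * x + w * y.
  by apply: (mulIf y0); rewrite e eg; ring.
by apply/IXP; exists (g * x + v), (w + g * z0); ring.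
Qed.

(** The new generator of the tower is x here; from [D] downwards it is x^2 for [J3], and y for both
    [I2] and [J5]. *)
Lemma tower_D : tower 2 D.
Proof.
apply: (@towerS _ _ _ I _ x 1%N); last 3 first.
- exact: IX_x.
- by move=> f /IXP[u [v ->]]; exists u; apply/lincomb2P; exists 0, v; ring.
- move=> a; split=> [/IXP[u [v ->]]|]; last exact: D_colon.
  by apply/lincomb2P; exists u, (v * x); ring.
- exact: tower_IX.
- exact: lincomb_ideal.
- by apply: homog2; [apply: hxr | exists 1%N].
- exact: hx.
- by move=> f /lincomb2P[u [v ->]]; apply/IXP; exists (u * x), v; ring.
Qed.

Lemma tower_J3 : tower 3 J3.
Proof.
apply: (@towerS _ _ _ D _ (x ^+ 2) (1 * 2)%N); last 3 first.
- by apply/lincomb2P; exists 1, 0; ring.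
- by move=> f /lincomb2P[u [v ->]]; exists u; apply/lincomb2P; exists 0, v; ring.
- move=> a; split=> [/IXP[u [v ->]]|]; last exact: J3_colon.
  by apply/lincomb2P; exists u, (v * x ^+ 2); ring.
- exact: tower_D.
- exact: lincomb_ideal.
- by apply: homog2 => //; exists 1%N.
- exact: dhomogMn.
- by move=> f /lincomb2P[u [v ->]]; apply/lincomb2P; exists (u * x), v; ring.
Qed.

Lemma tower_I2 : tower 3 I2.
Proof.
apply: (@towerS _ _ _ D _ y 1%N); last 3 first.
- by apply/lincomb2P; exists 0, 1; ring.
- by move=> f /lincomb2P[u [v ->]]; exists v; apply/lincomb3P; exists u, 0, 0; ring.
- move=> a; split=> [/IXP[u [v ->]]|]; last exact: I2_colon.
  by apply/lincomb3P; exists 0, u, v; ring.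
- exact: tower_D.
- exact: lincomb_ideal.
- exact: homog3.
- exact: hy.
- by move=> f /lincomb3P[u [v [w ->]]]; apply/lincomb2P; exists u, (v * x + w * y); ring.
Qed.

Lemma tower_J5 : tower 3 J5.
Proof.
apply: (@towerS _ _ _ D _ y 1%N); last 3 first.
- by apply/lincomb2P; exists 0, 1; ring.
- move=> f /lincomb2P[u [v ->]]; exists (v - u * z0).
  by apply/lincomb3P; exists u, 0, 0; ring.
- move=> a; split=> [/IXP[u [v ->]]|]; last exact: J5_colon.
  by apply/lincomb3P; exists 0, u, v; ring.
- exact: tower_D.
- exact: lincomb_ideal.
- apply: homog3 => //; exists 2%N; apply: dhomogD.
    exact: (@dhomogMn _ _ _ 1%N).
  exact: (@dhomogM _ _ _ 1%N _ 1%N).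
- exact: hy.
- move=> f /lincomb3P[u [v [w ->]]]; apply/lincomb2P.
  by exists u, (u * z0 + v * x + w * y); ring.
Qed.

Lemma IX_pow2_sub : ideal_pow I 2 `<=` I2.
Proof.
apply: ideal_powS_sub; first exact: lincomb_ideal.
move=> a b /IXP[u [v ->]] /(tower_pow tower_IX)/IXP[u' [v' ->]].
by apply/lincomb3P; exists (u * u'), (u * v' + v * u'), (v * v'); ring.
Qed.

Lemma IX_pow2_linear a b : I2 (a * x + b * y) -> I a /\ I b.
Proof.
have iI2 : is_ideal I2 by exact: lincomb_ideal.
move=> h; have Ia : I a.
  apply: D_colon; have -> : a * x = (a * x + b * y) - b * y by ring.
  apply: (ideal_B (lincomb_ideal _)); last by apply/lincomb2P; exists 0, b; ring.
  move: h => /lincomb3P[u [v [w ->]]]; apply/lincomb2P.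
  by exists u, (v * x + w * y); ring.
split=> //; apply: I2_colon; have -> : b * y = (a * x + b * y) - a * x by ring.
apply: (ideal_B iI2) => //; have /IXP[u [v ->]] := Ia.
by apply/lincomb3P; exists u, v, 0; ring.
Qed.

Lemma tower_primary r J : tower r.+1 J -> primary_ideal J.
Proof.
move=> tJ; split; first exact: tower_ideal tJ.
  by move=> /(tower_sub tJ); apply: IXN1.
move=> a b Jab; rewrite (tower_radical tJ).
have [Ib|nIb] := pselect (I b); [by right | left].
by apply: (tower_saturated tJ nIb); rewrite mulrC.
Qed.

Lemma tower_component r J K : tower r.+1 J -> K = J -> primary_component I K J.
Proof.
move=> tJ ->; exists 1%N, (fun=> J); split; last by exists ord0 => //; apply: tower_radical tJ.
split=> //; first by move=> _; apply: tower_primary tJ.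
- by apply/seteqP; split=> [f Jf _|f /(_ ord0)].
- by move=> i j _; rewrite !ord1.
- move=> i /(_ 1) J1; apply: (@IXN1 k n); apply: (tower_sub tJ); apply: J1.
  by move=> j; rewrite !ord1.
Qed.

Let ideal_add_eq J K K' : is_ideal J -> is_ideal K -> J `<=` K' -> K `<=` K' ->
  is_ideal K' -> K' `<=` ideal_add J K -> ideal_add J K = K'.
Proof. by move=> iJ iK JK KK iK' sub; apply/seteqP; split=> //; apply: ideal_add_sub. Qed.

Let add_pow1 r J : tower r.+1 J -> ideal_add J (ideal_pow I 1) = I.
Proof.
move=> tJ; apply: ideal_add_eq; [exact: tower_ideal tJ | exact: ideal_pow_ideal | | | |].
- exact: tower_sub tJ.
- exact: tower_pow tower_IX.
- exact: IX_ideal.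
- by move=> f If; apply: (ideal_addr (tower_ideal tJ)); rewrite -(expr1 f); apply: ideal_powX.
Qed.

Let add_pow_sub r J m : tower r.+1 J -> ideal_pow I m `<=` J ->
  ideal_add J (ideal_pow I m) = J.
Proof.
move=> tJ IJ; have iJ := tower_ideal tJ.
apply: ideal_add_eq => //; first exact: ideal_pow_ideal.
by apply: ideal_addl; apply: ideal_pow_ideal.
Qed.

Let component_pow1 r J : tower r.+1 J -> primary_component I (ideal_add J (ideal_pow I 1)) I.
Proof. by move=> tJ; apply: (tower_component tower_IX); apply: add_pow1 tJ. Qed.

Let component_full r J m : tower r.+1 J -> ideal_pow I m `<=` J ->
  primary_component I (ideal_add J (ideal_pow I m)) J.
Proof. by move=> tJ IJ; apply: (tower_component tJ); apply: add_pow_sub tJ IJ. Qed.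

Let x_pow r : ideal_pow I r (x ^+ r).
Proof. by apply: ideal_powX; apply: IX_x. Qed.

Let D_component_J3 : primary_component I (ideal_add J3 (ideal_pow I 2)) D.
Proof.
apply: (tower_component tower_D); apply: ideal_add_eq.
- exact: lincomb_ideal.
- exact: ideal_pow_ideal.
- by move=> f /lincomb2P[u [v ->]]; apply/lincomb2P; exists (u * x), v; ring.
- exact: tower_pow tower_D.
- exact: lincomb_ideal.
- move=> _ /lincomb2P[u [v ->]]; exists (v * y); first by apply/lincomb2P; exists 0, v; ring.
  by exists (u * x ^+ 2); [apply: (ideal_Ml _ (ideal_pow_ideal _ _)) | rewrite addrC].
Qed.

(* J5 + I^2 = (x^2, y) cap (x^2, xy, y^2, z_0), with an embedded component. *)
Let Q : set S := lincomb [:: x ^+ 2; x * y; y ^+ 2; z0].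
Local Notation sz := (restr (~: [set ord0])%SET).

Let sz_x : sz x = x.
Proof. by rewrite restrX !finset.inE -val_eqE /= inordK. Qed.
Let sz_y : sz y = y.
Proof. by rewrite restrX !finset.inE -val_eqE /= inordK. Qed.
Let sz_z0 : sz z0 = 0.
Proof. by rewrite restrX !finset.inE eqxx. Qed.
(** Setting z_0 = 0 reduces questions about [Q] to the square of [IX], for which saturation and
    colon ideals are known. *)
Let QP f : Q f <-> I2 (sz f).
Proof.
split=> [/lincomb4P[u [v [w [t ->]]]]|/lincomb3P[u [v [w e]]]].
  apply/lincomb3P; exists (sz u), (sz v), (sz w).
  have -> : sz (u * x ^+ 2 + v * (x * y) + w * y ^+ 2 + t * z0) =
      sz u * sz x ^+ 2 + sz v * (sz x * sz y) + sz w * sz y ^+ 2 + sz t * sz z0.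
    rewrite (restrD _ _ (t * z0)) (restrD _ _ (w * y ^+ 2)) (restrD _ (u * x ^+ 2)).
    by rewrite (restrM _ u) (restrM _ v) (restrM _ x) (restrM _ w) (restrM _ t);
      rewrite (restr_exp _ x) (restr_exp _ y).
  by rewrite sz_x sz_y sz_z0; ring.
by have [g ->] := restr_decomp ord0 f; apply/lincomb4P; exists u, v, w, g; rewrite e.
Qed.

Let radicalQ : radical Q = [set f | I (sz f)].
Proof.
apply/seteqP; split=> f.
  by move=> [m /QP]; rewrite restr_exp => /(tower_sub tower_I2)/primeX; apply; apply: IX_prime.
by move=> If; exists 2%N; apply/QP; rewrite restr_exp; apply: IX_pow2_sub; apply: ideal_powX.
Qed.

Let Q_primary : primary_ideal Q.
Proof.
split; first exact: lincomb_ideal.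
  by move=> /QP; rewrite rmorph1 => /(tower_sub tower_I2); apply: IXN1.
move=> a b /QP; rewrite restrM radicalQ => I2ab.
have [Ib|nIb] := pselect (I (sz b)); [by right | left].
by apply/QP; apply: (tower_saturated tower_I2 nIb); rewrite mulrC.
Qed.

Let add_J5 : ideal_add J5 (ideal_pow I 2) = [set f | D f /\ Q f].
Proof.
have I2Q : I2 `<=` Q.
  by move=> f /lincomb3P[u [v [w ->]]]; apply/lincomb4P; exists u, v, w, 0; ring.
have x2 := x_pow 2; have ip := ideal_pow_ideal I 2.
have pM a b : I a -> I b -> ideal_pow I 2 (a * b).
  by move=> Ia Ib; apply: ideal_powSM => //; rewrite -(expr1 b); apply: ideal_powX.
apply/seteqP; split=> [_ [f Jf [g Ig <-]]|f [/lincomb2P[u [v e]] Qf]].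
  have Dg := tower_pow tower_D Ig; have Qg : Q g by apply: I2Q; apply: IX_pow2_sub.
  have Df : D f.
    move: Jf => /lincomb3P[u [v [w ->]]]; apply/lincomb2P.
    by exists u, (u * z0 + v * x + w * y); ring.
  have Qf : Q f.
    by move: Jf => /lincomb3P[u [v [w ->]]]; apply/lincomb4P; exists u, v, w, (u * y); ring.
  by split; [exact: (ideal_D (lincomb_ideal _) Df Dg) | exact: (ideal_D (lincomb_ideal _) Qf Qg)].
have : I2 (sz v * y).
  rewrite -{1}sz_y -restrM; apply/QP.
  have -> : v * y = f - u * x ^+ 2 by rewrite e; ring.
  apply: ideal_B; [exact: lincomb_ideal | exact: Qf |].
  by apply/lincomb4P; exists u, 0, 0, 0; ring.
have [g eg] : exists g, v = sz v + g * z0 := restr_decomp ord0 v; move=> /I2_colon Iv.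
(* Write v = v_0 + g z_0 with v_0 free of z_0. The generator x^2 + z_0 y absorbs g z_0 y, and v_0 y
   lies in the square of [IX] because v_0 is in [IX]. *)
exists (g * (x ^+ 2 + z0 * y)); first by apply/lincomb3P; exists g, 0, 0; ring.
exists ((u - g) * x ^+ 2 + sz v * y); last by rewrite e {2}eg; ring.
apply: (ideal_D ip); first exact: (ideal_Ml _ ip x2).
by apply: (pM _ _ Iv); apply: IX_y.
Qed.

Let D_component_J5 : primary_component I (ideal_add J5 (ideal_pow I 2)) D.
Proof.
pose q (i : 'I_2) := if i == ord0 then D else Q.
have radD := tower_radical tower_D.
have ne : radical D <> radical Q.
  rewrite radD radicalQ => e; have : [set f | I (sz f)] z0.
    by rewrite /= sz_z0; apply: ideal_0 (IX_ideal _ _).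
  by rewrite -e; apply: IXN_z0.
have y2 : Q z0 by apply/lincomb4P; exists 0, 0, 0, 1; ring.
exists 2%N, q; split; last by exists ord0.
split.
- by move=> i; rewrite /q; case: ifP => _; [apply: tower_primary tower_D | apply: Q_primary].
- rewrite add_J5; apply/seteqP; split=> f /=.
    by move=> [Df Qf] i; rewrite /q; case: ifP.
  by move=> qf; split; [apply: (qf ord0) | apply: (qf ord_max)].
- move=> i j; rewrite /q; case: (eqVneq i ord0) => [->|i0]; case: (eqVneq j ord0) => [->|j0] //.
  + by move=> /esym.
  + by move=> _; apply: val_inj; case: i i0 => [[|[]]] //; case: j j0 => [[|[]]].
(* The decomposition is irredundant: z_0 lies in [Q] but not in [D], and y in [D] but not in [Q]. *)
- move=> i; rewrite /q; case: (eqVneq i ord0) => [->|i0] sub.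
    apply: (@IXN_z0 k n); apply: (tower_sub tower_D); apply: sub => j /negPf -> //.
  have /QP : Q y.
    apply: sub => j ne_ji; rewrite ifT; first by apply/lincomb2P; exists 0, 1; ring.
    by apply/eqP; apply: val_inj; case: i j i0 ne_ji => [[|[|]]] // ? [[|[|]]].
  by rewrite sz_y -[y]mul1r => /I2_colon; apply: IXN1.
Qed.

Lemma scheme_type_I r (Y : closed_subscheme k n.+2) m Yj :
  tower r.+1 (ideal_of Y) -> S1_filtration Y m Yj ->
  (forall j, (j <= m)%N -> exists s, tower s.+1 (ideal_of (Yj j))) -> type_I Y.
Proof.
move=> tY S1 tYj; split; first exact: tower_radical tY.
  exact: tower_cohen_macaulay tY.
exists m, Yj; split=> // j /tYj[s]; exact: tower_cohen_macaulay.
Qed.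

(** The lists given to [nth] are the filtrations: X at level 0, the structure itself at level m, and
    for (x^3, y) and the last form the double structure (x^2, y) in between. *)
Lemma normal_form_scheme G : G \in normal_forms k n -> exists Z : closed_subscheme k n.+2,
  [/\ ideal_of Z = ideal_gen [set` G], type_I Z
    & exists2 mu, multiplicity Z mu & (mu <= 3)%N].
Proof.
have [YI eI] := tower_scheme tower_IX.
have [YD eD] := tower_scheme tower_D.
have [Y3 e3] := tower_scheme tower_J3.
have [Y2 e2] := tower_scheme tower_I2.
have [Y5 e5] := tower_scheme tower_J5.
have mult r (Y : closed_subscheme k n.+2) : (r <= 2)%N -> tower r.+1 (ideal_of Y) ->
    exists2 mu, multiplicity Y mu & (mu <= 3)%N.
  by move=> ler /tower_multiplicity[mu ? le]; exists mu => //; lia.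
have tI : tower 1 (ideal_of YI) by rewrite eI; apply: tower_IX.
have tD : tower 2 (ideal_of YD) by rewrite eD; apply: tower_D.
have t3 : tower 3 (ideal_of Y3) by rewrite e3; apply: tower_J3.
have t2 : tower 3 (ideal_of Y2) by rewrite e2; apply: tower_I2.
have t5 : tower 3 (ideal_of Y5) by rewrite e5; apply: tower_J5.
rewrite !inE => /or4P[/eqP->|/eqP->|/eqP->|/orP[]/eqP->]; rewrite ideal_gen_seq.
- exists YI; split; [rewrite eI; exact: IX_lincomb | | exact: mult tI].
  apply: (@scheme_type_I _ YI 0%N (fun=> YI) tI); last by move=> j _; exists 0%N.
  split; first by rewrite eI; apply: tower_pow tower_IX.
    by rewrite eI => /(_ 1 Logic.I); apply: IXN1.
  by case=> // _; rewrite eI; apply: component_pow1 tower_IX.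
- exists YD; split; [exact: eD | | exact: mult tD].
  apply: (@scheme_type_I _ YD 1%N (nth YI [:: YI; YD]) tD); last first.
    by case=> [|[|j]] // _; [exists 0%N | exists 1%N].
  split; first by rewrite eD; apply: tower_pow tower_D.
    rewrite eD => /(_ _ (x_pow 1)); rewrite expr1 -[x]mul1r => /D_colon.
    exact: IXN1.
  case=> [|[|j]] // _; rewrite eD ?eI; first exact: component_pow1 tower_D.
  exact: component_full tower_D (tower_pow tower_D).
- exists Y3; split; [exact: e3 | | exact: mult t3].
  apply: (@scheme_type_I _ Y3 2%N (nth YI [:: YI; YD; Y3]) t3); last first.
    by case=> [|[|[|j]]] // _; [exists 0%N | exists 1%N | exists 2%N].
  split; first by rewrite e3; apply: tower_pow tower_J3.
    by rewrite e3 => /(_ _ (x_pow 2)); rewrite -[x ^+ 2]mul1r => /J3_colon; apply: IXN1.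
  case=> [|[|[|j]]] // _; rewrite e3 ?eD ?eI; first exact: component_pow1 tower_J3.
    exact: D_component_J3.
  exact: component_full tower_J3 (tower_pow tower_J3).
- exists Y2; split; [exact: e2 | | exact: mult t2].
  apply: (@scheme_type_I _ Y2 1%N (nth YI [:: YI; Y2]) t2); last first.
    by case=> [|[|j]] // _; [exists 0%N | exists 2%N].
  split; first by rewrite e2; apply: IX_pow2_sub.
    rewrite e2 => /(_ (y ^+ 1)); rewrite expr1 -[y in I2 y]mul1r => yI2.
    apply: (@IXN1 k n); apply: I2_colon; apply: yI2; rewrite -(expr1 y).
    by apply: ideal_powX; apply: IX_y.
  case=> [|[|j]] // _; rewrite e2 ?eI; first exact: component_pow1 tower_I2.
  exact: component_full tower_I2 IX_pow2_sub.
- exists Y5; split; [exact: e5 | | exact: mult t5].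
  apply: (@scheme_type_I _ Y5 2%N (nth YI [:: YI; YD; Y5]) t5); last first.
    by case=> [|[|[|j]]] // _; [exists 0%N | exists 1%N | exists 2%N].
  split; first by rewrite e5; apply: tower_pow tower_J5.
    (* If x^2 were in the ideal, so would be z_0 y, and z_0 would be in [IX]; hence m = 2 although
       x^2 is congruent to a multiple of y. *)
    rewrite e5 => /(_ _ (x_pow 2)) J5x; apply: (@IXN_z0 k n); apply: J5_colon.
    have -> : z0 * y = (x ^+ 2 + z0 * y) - x ^+ 2 by ring.
    apply: ideal_B => //; first exact: lincomb_ideal.
    by apply: lincomb_in; rewrite inE eqxx.
  case=> [|[|[|j]]] // _; rewrite e5 ?eD ?eI; first exact: component_pow1 tower_J5.
    exact: D_component_J5.
  exact: component_full tower_J5 (tower_pow tower_J5).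
Qed.

End NormalForms.

(** * Consequences of the Cohen-Macaulay condition *)

Section LocalMembership.
Variables (k : fieldType) (N : nat).
Local Notation S := {mpoly k[N.+1]}.
Implicit Types (f g s t : S) (K P : set S).

(* Membership in the localization of K at the homogeneous prime P. *)
Definition loc P K : set S := [set f | exists t, [/\ ~ P t, homogeneous_elts t & K (t * f)]].

Lemma loc_ideal P K : prime_ideal P -> is_ideal K -> is_ideal (loc P K).
Proof.
move=> pP iK; have [h1 hM] := homogeneous_elts_mulclosed k N; split.
- by exists 1; split; [case: pP | exact: h1 | rewrite mulr0; apply: ideal_0].
- move=> f g [t [nt ht Kt]] [t' [nt' ht' Kt']]; exists (t * t').
  split; [exact: primeNM | exact: hM |].
  have -> : t * t' * (f + g) = t' * (t * f) + t * (t' * g) by ring.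
  by apply: ideal_D => //; apply: ideal_Ml.
- move=> c f [t [nt ht Kt]]; exists t; split=> //.
  by rewrite mulrCA; apply: ideal_Ml.
Qed.

Lemma loc_sub P K : prime_ideal P -> K `<=` loc P K.
Proof.
move=> pP f Kf; exists 1; split; [by case: pP | | by rewrite mul1r].
exact: (proj1 (homogeneous_elts_mulclosed _ _)).
Qed.

Lemma loc_mono P K K' : K `<=` K' -> loc P K `<=` loc P K'.
Proof. by move=> KK' f [t [nt ht /KK' Kt]]; exists t. Qed.

Lemma loc_loc P K f t : prime_ideal P -> ~ P t -> homogeneous_elts t ->
  loc P K (t * f) -> loc P K f.
Proof.
move=> pP nt ht [t' [nt' ht' Kt]]; exists (t' * t); split; last by rewrite -mulrA.
  exact: primeNM.
exact: (proj2 (homogeneous_elts_mulclosed _ _)).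
Qed.

(** The chain of primes makes the dimension at least [r], and the Cohen-Macaulay property turns it
    into a regular sequence. Its numerators are forms that are regular on S/J after localization at
    the prime of [p]. *)
Lemma regular_sequence_lift (Y : closed_subscheme k N) (p : point_of Y) r :
  cohen_macaulay Y -> forall q : nat -> set S,
  (forall i, (i <= r)%N -> [/\ prime_ideal (q i), ideal_of Y `<=` q i & q i `<=` prime_of p]) ->
  (forall i, (i < r)%N -> q i `<=` q i.+1 /\
     exists f, [/\ homogeneous_elts f, q i.+1 f & ~ q i f]) ->
  exists us : seq S, (r <= size us)%N /\ forall i, (i < size us)%N ->
    [/\ prime_of p us`_i, homogeneous_elts us`_i &
     let K := ideal_add (ideal_of Y) (lincomb (take i us)) in
     forall f, loc (prime_of p) K (us`_i * f) -> loc (prime_of p) K f].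
Proof.
move=> CM q hq sq; set J := ideal_of Y in hq sq *; set P := prime_of p in hq sq *.
have pP : prime_ideal P by exact: prime_of_prime.
have iJ : is_ideal J := ideal_of_ideal Y.
have hJ : homogeneous J by exact: ideal_of_homogeneous.
have [d [_ dimd] [[s ss reg] _]] := CM p.
have led : (r <= d)%N.
  apply: dimd; exists (fun i => extension p (q i)); split=> i lei.
    by have [pq Jq qP] := hq i lei; apply: extension_prime.
  have [pq Jq qP] := hq i (ltnW lei); have [pq' Jq' qP'] := hq i.+1 lei.
  have [qq' [f [[df hf] q'f nqf]]] := sq i lei.
  apply: (@extension_proper _ _ _ p _ _ df f) => //; try exact: prime_is_ideal.
  move=> t nt ht; apply: (primeNM pq) => // qt; apply: nt; exact: qP.
have /choice[ug hug] : forall i, exists ug : S * S, (i < size s)%N ->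
    admissible p ug.1 ug.2 /\ s`_i = fr p ug.1 ug.2.
  by move=> i; have [u [g [a e]]] := fr_surj (s`_i); exists (u, g).
pose us := mkseq (fun i => (ug i).1) (size s).
have us_nth i : (i < size s)%N -> us`_i = (ug i).1 by move=> lti; rewrite nth_mkseq.
exists us; rewrite size_mkseq ss; split=> // i; rewrite -ss => lti.
have [adm es] := hug i lti; have [nu regi] := reg i lti.
rewrite us_nth //; move: nu regi; rewrite es (nonunits_fr adm) => Pu regi.
have [du [hu hg ng]] := adm; split=> //; first by exists du.
set u := (ug i).1 in adm es Pu regi hu *; set g := (ug i).2 in adm es regi hg ng.
move=> K.
have iK : is_ideal K by apply: ideal_add_ideal => //; apply: lincomb_ideal.
have JK : J `<=` K by apply: ideal_addl; apply: lincomb_ideal.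
have hK : homogeneous K.
  apply: homogeneous_add => //; apply: lincomb_homogeneous => j.
  rewrite size_take_min leq_min size_mkseq => /andP[ji js].
  by rewrite nth_take // us_nth //; have [[dj [hj _ _]] _] := hug j js; exists dj.
pose G := ideal_gen [set` take i s].
have iG : is_ideal G by exact: ideal_gen_is_ideal.
have KG : K `<=` contraction G.
  have iC := proj1 (contraction_graded iG).
  apply: (ideal_add_sub iC); first exact: contraction_sup.
  apply: (lincomb_sub iC) => j; rewrite size_take_min leq_min size_mkseq => /andP[ji js].
  have [adj esj] := hug j js; have [dj [hj hgj ngj]] := adj.
  rewrite nth_take // us_nth //; apply/(contraction_homog iG hj).
  have -> : fr p (ug j).1 ('X_(relevant_index p) ^+ dj) =
      fr p (ug j).1 (ug j).2 * fr p (ug j).2 ('X_(relevant_index p) ^+ dj).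
    rewrite frM //; last exact: admissible_z.
    apply: fr_eq; [exact: admissible_z | | by ring].
    by apply: admissibleM => //; apply: admissible_z.
  by rewrite -esj; apply: (ideal_Mr _ iG); apply: ideal_gen_take_nth.
have GK : G `<=` extension p K.
  apply: ideal_gen_take_sub; first exact: extension_ideal.
  move=> j ji js; have [adj ->] := hug j js; apply/extensionP => //.
  apply: (loc_sub pP); apply: ideal_addr => //.
  rewrite -us_nth // -(nth_take 0 ji); apply: lincomb_mem.
  by rewrite size_take_min leq_min size_mkseq ji js.
(* The local ring only sees forms; an arbitrary [f] is treated component by component. *)
have homog_case f e : f \is e.-homog -> loc P K (u * f) -> loc P K f.
  move=> hf Kuf; have adf := admissible_z p hf.
  apply/(extensionP iK JK adf); apply: GK; apply: regi; rewrite frM //.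
  apply: (extension_contraction iG KG).
  by apply/(extensionP iK JK) => //; apply: admissibleM.
move=> f [t [nt [dt ht] Kt]]; apply: ideal_homogP; first exact: loc_ideal.
move=> e; apply: (homog_case _ _ (pihomogP _ _ _)); exists t; split; [exact: nt | by exists dt |].
have := hK _ Kt (dt + du + e)%N; rewrite mulrA (pihomogMl _ _ (dhomogM ht hu)).
by rewrite leq_addr addKn mulrA.
Qed.

End LocalMembership.

(** * Cohen-Macaulay structures have no embedded components *)

Section Saturation.
Variables (k : fieldType) (n : nat).
Local Notation S := {mpoly k[n.+3]}.
Local Notation I := (@IX k n).
Local Notation rho := (restr (zvars n)).
Implicit Types (f a b c s t : S) (J K : set S).

Definition powers s : set S := [set f | exists r, f = s ^+ r].

Lemma powers_mulclosed s : mulclosed (powers s).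
Proof.
split; first by exists 0%N; rewrite expr0.
by move=> _ _ [r ->] [r' ->]; exists (r + r')%N; rewrite exprD.
Qed.

Lemma powers_coord_homogeneous i : powers ('X_i) `<=` @homogeneous_elts k n.+2.
Proof. by move=> _ [r ->]; exists (1 * r)%N; apply: dhomogMn; apply: coord_homog. Qed.

(* The last clause says that p is minimal over K. *)
Lemma minimal_point (Y : closed_subscheme k n.+2) K i : is_ideal K -> homogeneous K ->
  ideal_of Y `<=` K -> (forall r, ~ K ('X_i ^+ r)) ->
  exists p : point_of Y, K `<=` prime_of p /\
    forall f, homogeneous_elts f -> prime_of p f -> exists r, loc (prime_of p) K (f ^+ r).
Proof.
move=> iK hK JK nK.
have [|P [pP hP KP MP minP]] := minimal_homogeneous_prime iK (powers_mulclosed ('X_i))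
    (@powers_coord_homogeneous i) _ hK.
  by move=> _ [r ->]; apply: nK.
have relP : exists i, ~ P 'X_i by exists i; apply: MP; exists 1%N; rewrite expr1.
pose pp := ProjPoint pP hP relP.
have JP : ideal_of Y `<=` prime_of pp by apply: subset_trans KP.
exists (PointOf JP); split=> //= f [d hf] /(minP d f hf)[t [nt ht [r Kt]]].
by exists r, t.
Qed.

Lemma multiple_sub (Y : closed_subscheme k n.+2) : multiple_structure Y -> ideal_of Y `<=` I.
Proof. by move=> <- f Jf; exists 1%N; rewrite expr1. Qed.

Lemma multiple_nil (Y : closed_subscheme k n.+2) f : multiple_structure Y -> I f ->
  exists r, ideal_of Y (f ^+ r).
Proof. by move=> <-. Qed.

Lemma prime_sup_IX (Y : closed_subscheme k n.+2) (P : set S) : multiple_structure Y ->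
  prime_ideal P -> ideal_of Y `<=` P -> I `<=` P.
Proof. by move=> mY pP JP f /(multiple_nil mY)[r /JP]; apply: primeX. Qed.

Lemma homogeneous_witness J K s : is_ideal J -> homogeneous K -> K s -> ~ J s ->
  exists f, [/\ homogeneous_elts f, K f & ~ J f].
Proof.
move=> iJ hK Ks nJ; apply: contrapT => nex; apply: nJ; apply: ideal_homogP => // d.
apply: contrapT => nd; apply: nex; exists (pihomog mdeg d s); split=> //; last exact: hK.
by exists d; apply: pihomogP.
Qed.

(** The top component of [s] may lie in [IX] even if [s] does not. So [s] is replaced by a power of
    [rho s]: the nonzero components of an element of R are outside [IX], and top components can be
    compared. *)
Lemma IX_saturated_of_homogeneous J : is_ideal J -> homogeneous J ->
  (forall f, I f -> exists r, J (f ^+ r)) ->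
  (forall s f d, f \is d.-homog -> ~ I s -> J (s * f) -> J f) -> IX_saturated J.
Proof.
move=> iJ hJ nilJ hom s f nIs Jsf.
have [r Jr] := nilJ _ (sub_rho s (IX_ideal k n) (@IX_x k n) (@IX_y k n)).
pose s' := rho s ^+ r.
have rs' : rho s' = s' by rewrite rmorphXn /= restr_idem.
have s'0 : s' != 0 by apply: expf_neq0; apply/eqP => s0; apply: nIs; apply/IXE.
have {Jr} Jsf' : J (s' * f).
  (* The first summand is a multiple of [s], and the second lies in [J]. *)
  have -> : s' = (rho s ^+ r - (rho s - s) ^+ r) + (-1) ^+ r * (s - rho s) ^+ r.
    by rewrite -exprMn mulN1r opprB subrK.
  rewrite mulrDl; apply: ideal_D => //; last first.
    by rewrite mulrAC; apply: (ideal_Ml _ iJ Jr).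
  rewrite subrXX (_ : rho s - (rho s - s) = s); last by ring.
  by rewrite mulrAC; apply: ideal_Mr.
move: {nIs Jsf} s' rs' s'0 Jsf' => {}s rs s0 Jsf.
have [i si maxi] : exists2 i, pihomog mdeg i s != 0 &
    forall j, (i < j)%N -> pihomog mdeg j s = 0.
  have ex : exists i, pihomog mdeg i s != 0.
    apply: contrapT => nex; case/eqP: s0.
    rewrite (pihomog_partitionE (leqnn (msize s))) big1 // => i _.
    by apply/eqP; apply: contrapT => /negP h; apply: nex; exists i.
  have bnd i : pihomog mdeg i s != 0 -> (i <= msize s)%N.
    by rewrite leqNgt; apply: contra => lt; rewrite pihomog_gt // ltnW.
  exists (ex_maxn ex bnd); case: ex_maxnP => i hi maxi // j ltj.
  by apply/eqP; apply: contraTT ltj => /maxi; rewrite -leqNgt.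
apply: contrapT => nJf.
have ex : exists d, `[< ~ J (pihomog mdeg d f) >].
  apply: contrapT => nex; apply: nJf; apply: ideal_homogP => // d.
  by apply: contrapT => nd; apply: nex; exists d; apply/asboolP.
have bnd d : `[< ~ J (pihomog mdeg d f) >] -> (d <= msize f)%N.
  move=> /asboolP nPi; rewrite leqNgt; apply/negP => lt; apply: nPi.
  by rewrite pihomog_gt; [apply: ideal_0 | apply: ltnW].
case: (ex_maxnP ex bnd) => d /asboolP nJd maxd; apply: nJd.
have nIs : ~ I (pihomog mdeg i s).
  by move=> /IXE; rewrite restr_pihomog rs => e; rewrite e eqxx in si.
apply: (hom _ _ _ (pihomogP _ _ _) nIs).
have := hJ _ Jsf (i + d)%N.
rewrite {1}(pihomog_partitionE (leq_maxl (msize s) i.+1)) mulr_suml raddf_sum /=.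
rewrite (bigD1 (Ordinal (leq_maxr (msize s) i.+1))) //=.
rewrite (pihomogMl _ _ (pihomogP _ _ _)) leq_addr addKn addrC.
apply: ideal_Dl => //; apply: ideal_sum => // j; rewrite -val_eqE /= => ne.
rewrite (pihomogMl _ _ (pihomogP _ _ _)); case: ifP => le; last exact: ideal_0.
have [lt|gt|eq] := ltngtP j i; last by rewrite eq eqxx in ne.
  apply: ideal_Ml => //; apply: contrapT => /asboolP/maxd; lia.
by rewrite maxi // mul0r; apply: ideal_0.
Qed.

(* A minimal prime over the annihilator of f is associated to S/J, so the local
   ring there has depth 0. *)
Lemma cohen_macaulay_saturated (Y : closed_subscheme k n.+2) :
  multiple_structure Y -> cohen_macaulay Y -> IX_saturated (ideal_of Y).
Proof.
move=> mY CM; set J := ideal_of Y; have iJ : is_ideal J := ideal_of_ideal Y.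
have hJ : homogeneous J by exact: ideal_of_homogeneous.
apply: IX_saturated_of_homogeneous => //; first by move=> f; apply: multiple_nil.
move=> s f d hf nIs Jsf; apply: contrapT => nJf.
pose K := [set c | J (c * f)].
have iK : is_ideal K.
  split=> [|a b Ka Kb|c a Ka] /=; first by rewrite /K /= mul0r; apply: ideal_0.
  - by rewrite /K /= mulrDl; apply: ideal_D.
  - by rewrite /K /= -mulrA; apply: ideal_Ml.
have hK : homogeneous K.
  move=> c Kc e; have := hJ _ Kc (d + e)%N.
  by rewrite mulrC (pihomogMl _ _ hf) leq_addr addKn mulrC.
have JK : J `<=` K by move=> c Jc; apply: ideal_Mr.
(* Otherwise powers of all coordinates would send [f] into the saturated ideal [J]. *)
have [i nKi] : exists i, forall r, ~ K ('X_i ^+ r).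
  apply: contrapT => nex; apply: nJf; apply: (@ideal_of_saturated _ _ Y) => i.
  by apply: contrapT => ni; apply: nex; exists i => r Kr; apply: ni; exists r.
have [p [KP minP]] := minimal_point iK hK JK nKi.
have pP : prime_ideal (prime_of p) by exact: prime_of_prime.
have hP : homogeneous (prime_of p) by exact: prime_of_homogeneous.
have JP : J `<=` prime_of p by exact: point_on.
have IP : I `<=` prime_of p by apply: prime_sup_IX mY pP JP.
(* [s] lies in the prime of [p] but not in [IX], so the local ring has dimension at least one and
   contains a regular element. *)
pose q i := if i == 0%N then I else prime_of p.
have [|i0 lti|us [le1 hus]] := @regular_sequence_lift _ _ Y p 1 CM q.
- case=> [|[|i0]] // _; rewrite /q /=; split=> //; first exact: IX_prime.
  exact: multiple_sub.
- have -> : i0 = 0%N by lia.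
  split=> //; rewrite /q /=; apply: (@homogeneous_witness _ _ s) => //.
    exact: IX_ideal.
  by apply: KP.
have [Pu hu] := hus 0%N le1; rewrite take0 => /= reg.
set u := us`_0 in Pu hu reg.
have K0 : ideal_add J (lincomb [::]) `<=` J.
  apply: ideal_add_sub => // _ [c ->]; rewrite big_ord0; exact: ideal_0.
(* By minimality over the annihilator [K], a power of the regular element [u] kills [f] in the local
   ring. Cancelling it leaves an annihilator of [f] outside the prime. *)
have [r [t [nt ht Kt]]] := minP u hu Pu.
have : loc (prime_of p) (ideal_add J (lincomb [::])) (u ^+ r * f).
  by exists t; split=> //; rewrite mulrA; apply: ideal_addl => //; apply: lincomb_ideal.
elim: r {Kt} => [|r IH].
  rewrite expr0 mul1r => -[t' [nt' ht' /K0 Jt']]; apply: nt'; exact: KP.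
by rewrite exprS -mulrA => /reg.
Qed.

End Saturation.

Section RingIdentities.
Variable A : comNzRingType.
Implicit Types a b p q t u v w h : A.

(** If (p, q) and (p', q') express t u w and t v w in the ideal (a, b), then v times the first pair
    minus u times the second is a syzygy of (a, b). *)
Lemma proportional_coefs a b p q p' q' t u v w :
  t * (u * w) = p * a + q * b -> t * (v * w) = p' * a + q' * b ->
  a * (v * p - u * p') = - (v * q - u * q') * b.
Proof.
move=> eu ev; apply/eqP; rewrite -subr_eq0; apply/eqP.
have -> : a * (v * p - u * p') - - (v * q - u * q') * b =
  v * (p * a + q * b) - u * (p' * a + q' * b) by ring.
by rewrite -eu -ev; ring.
Qed.

Lemma descend_coefs a b p q t t' u w g1 g2 h :
  t * (u * w) = p * a + q * b -> - (t' * q) - u * g1 = h * a ->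
  t' * p - u * g2 = h * b -> u * (t' * (t * w)) = u * (g2 * a - g1 * b).
Proof.
move=> eu e1 e2; have -> : u * (t' * (t * w)) = t' * (t * (u * w)) by ring.
apply/eqP; rewrite eu -subr_eq0; apply/eqP.
have -> : t' * (p * a + q * b) - u * (g2 * a - g1 * b) =
  (t' * p - u * g2) * a - (- (t' * q) - u * g1) * b by ring.
by rewrite e1 e2; ring.
Qed.

Lemma lift_coefs e1 e2 t t' u u' p q g1 g2 g1' g2' c j :
  j + c * u = t' * (p * e2 - q * e1) ->
  (- (t * q) - u' * g1') * e1 + (t * p - u' * g2') * e2 =
      j - (p * (t' * e2 - t * e2) - q * (t' * e1 - t * e1))
      + (u * (c - (g1 * e1 + g2 * e2)))
      + (g1 * (u * e1 - u' * e1) + u' * (g1 * e1 - g1' * e1))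
      + (g2 * (u * e2 - u' * e2) + u' * (g2 * e2 - g2' * e2)).
Proof. by move=> ej; have -> : j = t' * (p * e2 - q * e1) - c * u by [rewrite -ej; ring]; ring. Qed.

Lemma split_coefs e1 e2 p q p' q' u u' v v' :
  v * (p * e2 - q * e1) - u * (p' * e2 - q' * e1) =
    (- (v' * q - u' * q') * e1 + (v' * p - u' * p') * e2)
    + (p * (v * e2 - v' * e2) - q * (v * e1 - v' * e1)
       - (p' * (u * e2 - u' * e2) - q' * (u * e1 - u' * e1))).
Proof. by ring. Qed.

Lemma drop_zero_coefs a b p q v w : p * a + q * b + v * 0 + w * 0 = p * a + q * b.
Proof. by rewrite !mulr0 !addr0. Qed.

End RingIdentities.

(** * Quotients of rank one and their relations *)

Section RankOne.
Variables (k : fieldType) (n : nat).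
Hypothesis hn : (2 <= n)%N.
Local Notation S := {mpoly k[n.+3]}.
Local Notation x := (coord_x k n).
Local Notation y := (coord_y k n).
Local Notation I := (@IX k n).
Local Notation rho := (restr (zvars n)).
Implicit Types (f a b c h s t u v w : S).

Variable Y : closed_subscheme k n.+2.
Local Notation J := (ideal_of Y).
Hypothesis mY : multiple_structure Y.
Hypothesis CM : cohen_macaulay Y.
Variables (e1 e2 : S) (d1 d2 : nat).
Hypothesis he1 : e1 \is d1.-homog.
Hypothesis he2 : e2 \is d2.-homog.
Hypothesis Ie1 : forall c, I c -> J (c * e1).
Hypothesis Ie2 : forall c, I c -> J (c * e2).
Hypothesis nJe : ~ (J e1 /\ J e2).
Local Notation E := [set f | exists a b, J (f - (a * e1 + b * e2))].
Hypothesis satE : IX_saturated E.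

(* The pairs (a, b) in R^2 with a e1 + b e2 in J; their quotient E/J is a
   torsion-free R-module of rank one. *)
Let rel a b := [/\ rho a = a, rho b = b & J (a * e1 + b * e2)].

Hypothesis rel_nontrivial : exists a b, rel a b /\ (a != 0 \/ b != 0).

Let iJ : is_ideal J. Proof. exact: ideal_of_ideal. Qed.
Let hJ : homogeneous (J : set S). Proof. exact: ideal_of_homogeneous. Qed.
Let satJ : IX_saturated J. Proof. exact: cohen_macaulay_saturated. Qed.

Let nI a : rho a = a -> a != 0 -> ~ I a.
Proof. by move=> ra a0 /IXE; rewrite ra => /eqP; rewrite (negPf a0). Qed.

(** By Cramer's rule the determinant of two relations kills [e1] and [e2] modulo [J]; were it
    nonzero, saturation would put both into [J]. *)
Let rel_det a b a' b' : rel a b -> rel a' b' -> a * b' = a' * b.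
Proof.
move=> [ra rb Jab] [ra' rb' Jab']; apply/eqP; rewrite -subr_eq0; apply/negPn/negP => D0.
have nID : ~ I (a * b' - a' * b).
  by apply: nI D0; rewrite rmorphB !rmorphM /= ra rb ra' rb'.
apply: nJe; split; apply: (satJ nID).
  have -> : (a * b' - a' * b) * e1 = b' * (a * e1 + b * e2) - b * (a' * e1 + b' * e2).
    by ring.
  by apply: ideal_B => //; apply: ideal_Ml.
have -> : (a * b' - a' * b) * e2 = a * (a' * e1 + b' * e2) - a' * (a * e1 + b * e2).
  by ring.
by apply: ideal_B => //; apply: ideal_Ml.
Qed.

(** After multiplication by [a] or [b], a pair proportional to (a, b) becomes a multiple of it;
    saturation of [J] removes the factor. *)
Let rel_of_det a b a' b' : rel a b -> a != 0 \/ b != 0 -> rho a' = a' -> rho b' = b' ->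
  a * b' = a' * b -> rel a' b'.
Proof.
move=> [ra rb Jab] nz ra' rb' e; split=> //; case: nz => nz.
  apply: (satJ (nI ra nz)).
  have -> : a * (a' * e1 + b' * e2) = a' * (a * e1) + (a * b') * e2 by ring.
  rewrite e (_ : _ + _ = a' * (a * e1 + b * e2)); last by ring.
  exact: ideal_Ml.
apply: (satJ (nI rb nz)).
have -> : b * (a' * e1 + b' * e2) = (a' * b) * e1 + b * b' * e2 by ring.
rewrite -e (_ : _ + _ = b' * (a * e1 + b * e2)); last by ring.
exact: ideal_Ml.
Qed.

(** The component of a coefficient that contributes to degree [d] when it is multiplied by a form of
    degree [e]. *)
Let gr d e f := if (e <= d)%N then pihomog mdeg (d - e) f else 0 : S.

Let gr_rel d a b : rel a b -> rel (gr d d1 a) (gr d d2 b).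
Proof.
move=> [ra rb Jab]; split; rewrite /gr.
- by case: ifP; rewrite ?rmorph0 // restr_pihomog ra.
- by case: ifP; rewrite ?rmorph0 // restr_pihomog rb.
have := hJ Jab d; rewrite pihomogD [a * e1]mulrC (pihomogMl _ _ he1).
rewrite [b * e2]mulrC (pihomogMl _ _ he2).
by case: ifP => _; case: ifP => _; rewrite ?mul0r ?(mulrC e1) ?(mulrC e2).
Qed.

Let msize_pihomog_le d f : (msize (pihomog mdeg d f) <= msize f)%N.
Proof.
rewrite [X in (X <= _)%N]msizeE; apply/bigmax_leqP_seq => m mf _.
apply: msize_mdeg_lt; move: mf; rewrite !mcoeff_msupp mcoeff_pihomog.
by case: ifP => // _; rewrite eqxx.
Qed.

Let msize_gr d e f : (msize (gr d e f) <= msize f)%N.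
Proof. by rewrite /gr; case: ifP => _; rewrite ?msize0 ?msize_pihomog_le. Qed.

Let gr_neq0 e f : f != 0 -> exists d, gr d e f != 0.
Proof.
move=> f0; apply: contrapT => nex; case/eqP: f0.
rewrite (pihomog_partitionE (leqnn (msize f))) big1 // => d _.
apply/eqP; apply: contrapT => /negP h; apply: nex; exists (d + e)%N.
by rewrite /gr leq_addl addnK.
Qed.

Lemma rel_minimal : exists d a b, [/\ rel a b, a != 0 \/ b != 0, gr d d1 a = a, gr d d2 b = b
  & forall a' b', rel a' b' -> a' != 0 \/ b' != 0 -> (msize a + msize b <= msize a' + msize b')%N].
Proof.
have ex : exists m, `[< exists a b, [/\ rel a b, a != 0 \/ b != 0 & (msize a + msize b)%N = m] >].
  have [a [b [r nz]]] := rel_nontrivial.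
  by exists (msize a + msize b)%N; apply/asboolP; exists a, b.
case: (ex_minnP ex) => m /asboolP[a [b [r nz em]]] minm.
have [d nzd] : exists d, gr d d1 a != 0 \/ gr d d2 b != 0.
  case: nz => /gr_neq0 h; first by have [d hd] := h d1; exists d; left.
  by have [d hd] := h d2; exists d; right.
have gr_id e f : gr d e (gr d e f) = gr d e f.
  by rewrite /gr; case: (e <= d)%N => //; rewrite pihomog_id.
exists d, (gr d d1 a), (gr d d2 b); split=> //; first exact: gr_rel.
move=> a' b' r' nz'; apply: leq_trans (_ : m <= _)%N.
  by rewrite -em; apply: leq_add; apply: msize_gr.
by apply: minm; apply/asboolP; exists a', b'.
Qed.

(* By unique factorization the module of relations is generated by a pair of
   minimal degree. *)
Lemma rel_generator : exists d a b, [/\ rel a b, a != 0 \/ b != 0, gr d d1 a = a, gr d d2 b = b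
  & forall a' b', rel a' b' -> exists h, a' = h * a /\ b' = h * b].
Proof.
have [d [a [b [r nz ga gb minab]]]] := rel_minimal.
exists d, a, b; split=> // a' b' r'; have [ra rb Jab] := r; have [ra' rb' _] := r'.
have det := rel_det r r'.
have [h [h' [a0 [b0 [ea eb ea' eb']]]]] : exists h h' a0 b0,
    [/\ a = h * a0, b = h * b0, a' = h' * a0 & b' = h' * b0].
  have fS := @factorial_mpoly k n.+3; case: nz => nz.
    exact: (factorial_proportional fS nz det).
  have det' : b * a' = b' * a by rewrite [RHS]mulrC det mulrC.
  have [h [h' [b0 [a0 [eb ea eb' ea']]]]] := factorial_proportional fS nz det'.
  by exists h, h', a0, b0.
(* All four coefficients lie in R, so [rho] moves their factors into R as well. *)
have [H [H' [A0 [B0 [rA rB {}ea {}eb]]]]] : exists H H' A0 B0,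
    [/\ rho A0 = A0, rho B0 = B0, a = H * A0 /\ b = H * B0 & a' = H' * A0 /\ b' = H' * B0].
  exists (rho h), (rho h'), (rho a0), (rho b0).
  split; [exact: restr_idem | exact: restr_idem | |].
    by rewrite -!restrM -ea -eb.
  by rewrite -!restrM -ea' -eb'.
move=> {h h' a0 b0 ea' eb'}.
have [{}ea {}eb ea' eb'] : [/\ a = H * A0, b = H * B0, a' = H' * A0 & b' = H' * B0].
  by case: ea; case: eb.
have H0 : H != 0.
  by apply/eqP => H0; case: nz => /eqP; apply; rewrite ?ea ?eb H0 mul0r.
have nz0 : A0 != 0 \/ B0 != 0.
  case: nz => nz; [left|right]; apply: contra_neq nz => e.
    by rewrite ea e mulr0.
  by rewrite eb e mulr0.
have r0 : rel A0 B0.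
  apply: (rel_of_det r nz) => [||]; [exact: rA | exact: rB |].
  by rewrite ea eb mulrCA mulrA.
(* (A0, B0) is itself a relation, so by minimality of (a, b) the common factor [H] is constant. *)
have sH : (msize H <= 1)%N.
  have := minab _ _ r0 nz0; rewrite leqNgt => /negP lt; rewrite leqNgt; apply/negP => sH; apply: lt.
  have szM c : (msize c <= msize (H * c)%R)%N /\ (c != 0%R -> msize c < msize (H * c)%R)%N.
    have [->|c0] := eqVneq c 0; first by rewrite mulr0.
    rewrite msizeM //; move: sH; have := mpolySpred mdeg c0.
    by move: (msize H) (msize c) => p q e lt; clear -e lt; split; lia.
  rewrite ea eb; case: nz0 => [/(proj2 (szM A0))|/(proj2 (szM B0))] lt.
    by rewrite -addSn; apply: leq_add => //; apply: (proj1 (szM B0)).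
  by rewrite -addnS; apply: leq_add => //; apply: (proj1 (szM A0)).
have eH : H = (H@_0%MM)%:MP by apply: msize1_polyC.
have uH : H \is a GRing.unit.
  rewrite eH; apply: rmorph_unit; rewrite unitfE; apply: contra_neq H0 => e.
  by rewrite eH e mpolyC0.
exists (H' * H^-1); rewrite ea' eb' ea eb.
by split; rewrite -mulrA mulKr.
Qed.

Section Generator.
Variables (d : nat) (a b : S).
Hypothesis r : rel a b.
Hypothesis ga : gr d d1 a = a.
Hypothesis gb : gr d d2 b = b.
Hypothesis gen : forall a' b', rel a' b' -> exists h, a' = h * a /\ b' = h * b.
Hypothesis a0 : a != 0.

Let ra : rho a = a. Proof. by case: r. Qed.
Let rb : rho b = b. Proof. by case: r. Qed.

Let rel_det_gen c s : rho c = c -> rho s = s -> a * s = c * b -> rel c s.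
Proof. by move=> rc rs e; apply: (rel_of_det r) => //; left. Qed.

(** Since (a, b) generates the relations, [a] and [b] are coprime in R. *)
Lemma rel_cancel c s : rho c = c -> rho s = s -> c * b = s * a -> exists h, c = h * a.
Proof.
move=> rc rs e; have [|h [-> _]] := @gen c s; last by exists h.
by apply: rel_det_gen => //; rewrite mulrC -e.
Qed.

Let K := lincomb [:: a; b; x; y].
Let iK : is_ideal K. Proof. exact: lincomb_ideal. Qed.
Let Ka : K a. Proof. by apply: lincomb_in; rewrite !inE eqxx. Qed.
Let Kb : K b. Proof. by apply: lincomb_in; rewrite !inE eqxx orbT. Qed.
Let Kx : K x. Proof. by apply: lincomb_in; rewrite !inE eqxx !orbT. Qed.
Let Ky : K y. Proof. by apply: lincomb_in; rewrite !inE eqxx !orbT. Qed.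
Let KI : I `<=` K. Proof. exact: IX_sub iK Kx Ky. Qed.

Let K_rho f : K f <-> exists p q, [/\ rho p = p, rho q = q & rho f = p * a + q * b].
Proof.
split=> [/lincomb4P[p [q [v [w ->]]]]|[p [q [_ _ e]]]].
  exists (rho p), (rho q); split; rewrite ?restr_idem //.
  by rewrite !restrD !restrM rho_x rho_y ra rb drop_zero_coefs.
apply/(ideal_sub_mod iK (sub_rho f iK Kx Ky)); rewrite e.
by apply: ideal_D => //; apply: ideal_Ml.
Qed.

Variable P : set S.
Hypothesis pP : prime_ideal P.
Hypothesis KP : K `<=` P.
Hypothesis minP : forall f, homogeneous_elts f -> P f -> exists m, loc P K (f ^+ m).
Variables u v : S.
Hypothesis hu : homogeneous_elts u.
Hypothesis hv : homogeneous_elts v.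
Hypothesis Pu : P u.
Hypothesis Pv : P v.
Hypothesis regu : forall f, loc P J (u * f) -> loc P J f.
Hypothesis regv : forall f, loc P (ideal_add J (lincomb [:: u])) (v * f) ->
  loc P (ideal_add J (lincomb [:: u])) f.

(** Elements of [IX] are nilpotent modulo [J]; a regular one among them would make 1 vanish in the
    local ring. *)
Let nIu : ~ I u.
Proof.
move=> /(multiple_nil mY)[m Jm].
have JP : J `<=` P by move=> f /(multiple_sub mY)/KI/KP.
have : loc P J (u ^+ m * 1) by rewrite mulr1; apply: loc_sub.
elim: m {Jm} => [|m IH]; last by rewrite exprS -mulrA => /regu.
rewrite expr0 mulr1 => -[t [nt _ /JP]]; rewrite mulr1; exact: nt.
Qed.

Let rho_mod t e : (forall c, I c -> J (c * e)) -> J (t * e - rho t * e).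
Proof.
by move=> Ie; rewrite -mulrBl; apply: Ie; exact: (sub_rho t (IX_ideal k n) (@IX_x k n) (@IX_y k n)).
Qed.

(* E/J is isomorphic to the ideal (a, b) of R through (p, q) |-> p a + q b for
   p e2 - q e1, so (u, v) is regular on (a, b). *)
Let quotient_depth w : loc P K (u * w) -> loc P K (v * w) -> loc P K w.
Proof.
move=> [t1 [nt1 ht1 K1]] [t2 [nt2 ht2 K2]].
have hM := proj2 (homogeneous_elts_mulclosed k n.+2).
pose t := t1 * t2; have nt : ~ P t by exact: primeNM.
have ht : homogeneous_elts t by exact: hM.
have {K1}/K_rho[p [q [rp rq eu]]] : K (t * (u * w)).
  have -> : t * (u * w) = t2 * (t1 * (u * w)) by rewrite /t; ring.
  exact: ideal_Ml.
have {K2}/K_rho[p' [q' [rp' rq' ev]]] : K (t * (v * w)).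
  have -> : t * (v * w) = t1 * (t2 * (v * w)) by rewrite /t; ring.
  exact: ideal_Ml.
rewrite !restrM in eu ev.
pose f := p * e2 - q * e1; pose f' := p' * e2 - q' * e1.
(* [f] and [f'] correspond to t u w and t v w in (a, b). The coefficients of v f - u f' come from a
   syzygy of (a, b), hence form a relation. *)
have Jvf : J (v * f - u * f').
  pose A := rho v * p - rho u * p'; pose B := rho v * q - rho u * q'.
  have [_ _ JAB] : rel (- B) A.
    apply: rel_det_gen.
    - by rewrite /B restrN restrB !restrM !restr_idem rq rq'.
    - by rewrite /A restrB !restrM !restr_idem rp rp'.
    exact: proportional_coefs eu ev.
  rewrite /f /f' (split_coefs e1 e2 p q p' q' u (rho u) v (rho v)).
  apply: ideal_D => //.
  by apply: ideal_B => //; apply: ideal_B => //; apply: ideal_Ml => //; apply: rho_mod.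
(* As [v] is regular modulo [u], [f] is divisible by [u] in the local ring. By saturation the
   quotient [c] again lies in the span of [e1] and [e2] modulo [J]. *)
have [|t' [nt' ht' [j Jj [_ [c ->] ec]]]] := @regv f.
  apply: loc_sub => //; exists (v * f - u * f') => //; exists (u * f'); last by ring.
  by apply: (ideal_Mr _ (lincomb_ideal _)); apply: lincomb_in; rewrite inE eqxx.
rewrite big_ord1 /= in ec; move: (c 0%N) ec => {}c ec.
have [g1 [g2 Jg]] : E c.
  apply: (satE nIu); exists (- (t' * q)), (t' * p).
  have -> : u * c - (- (t' * q) * e1 + t' * p * e2) = - j.
    have -> : - (t' * q) * e1 + t' * p * e2 = t' * f by rewrite /f; ring.
    by rewrite -ec; ring.
  exact: ideal_N.
(* t' f - u c lies in [J], so its coefficients are a multiple of (a, b). Dividing by [u] expresses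
   t' t w through [a] and [b] with the coefficients of [c]. *)
have [h [eh1 eh2]] : exists h, - (rho t' * q) - rho u * rho g1 = h * a /\
    rho t' * p - rho u * rho g2 = h * b.
  apply: gen; split.
  - by rewrite restrB restrN !restrM !restr_idem rq.
  - by rewrite restrB !restrM !restr_idem rp.
  rewrite (@lift_coefs _ e1 e2 (rho t') t' u (rho u) p q g1 g2 _ _ c j ec).
  have Jr s e c' : (forall c, I c -> J (c * e)) -> J (c' * (s * e - rho s * e)).
    by move=> Ie; apply: ideal_Ml => //; apply: rho_mod.
  apply: ideal_D => //; last by apply: ideal_D => //; apply: Jr.
  apply: ideal_D => //; last by apply: ideal_D => //; apply: Jr.
  apply: ideal_D => //; last exact: ideal_Ml.
  apply: ideal_B => //; apply: ideal_B => //; exact: Jr.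
have key : rho (t' * (t * w)) = rho g2 * a - rho g1 * b.
  apply: (mulfI (_ : rho u != 0)); first by apply/eqP => /IXE.
  by rewrite !restrM; exact: descend_coefs eu eh1 eh2.
exists (t' * t); split; [exact: primeNM | exact: hM |].
rewrite -mulrA; apply/K_rho; exists (rho g2), (- rho g1).
by rewrite restrN !restr_idem mulNr; split.
Qed.

(** As [P] is minimal over [K], powers of [u] and [v] lie in [K] locally. [quotient_depth] lowers
    both exponents until 1 lies in [K]. *)
Lemma generator_no_depth : False.
Proof.
have iL : is_ideal (loc P K) by exact: loc_ideal.
have L1 : ~ loc P K 1 by move=> [t [nt _]]; rewrite mulr1 => /KP.
have vstep (s : nat) w : loc P K (u * w) -> loc P K (v ^+ s * w) -> loc P K w.
  move=> Lu; elim: s => [|s IH]; first by rewrite expr0 mul1r.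
  rewrite exprS -mulrA => Lv; apply: IH; apply: quotient_depth => //.
  by rewrite mulrCA; apply: ideal_Ml.
have ustep (m s : nat) w : loc P K (u ^+ m * w) -> loc P K (v ^+ s * w) -> loc P K w.
  move=> + Lv; elim: m => [|m IH]; first by rewrite expr0 mul1r.
  rewrite exprS -mulrA => Lu; apply: IH; apply: (vstep s) => //.
  by rewrite mulrCA; apply: ideal_Ml.
have [[m Lu] [s Lv]] := (minP hu Pu, minP hv Pv).
by apply: L1; apply: (ustep m s); rewrite mulr1.
Qed.

End Generator.

Let const_of_unit h a : 1 = h * a -> exists2 c, c != 0 & a = c%:MP.
Proof.
move=> e; have h0 : h != 0.
  by apply/eqP => h0; move/eqP: e; rewrite h0 mul0r oner_eq0.
have a0 : a != 0 by apply/eqP => a0; move/eqP: e; rewrite a0 mulr0 oner_eq0.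
have s1 : (msize h + msize a).-1 = 1%N by rewrite -msizeM // -e msize1.
have [] : (0 < msize h)%N /\ (0 < msize a)%N by rewrite !lt0n !msize_poly_eq0.
move=> ph pa; have : msize a == 1%N by move: (msize h) (msize a) s1 ph pa => i j; clear; lia.
by case/msize_poly1P => c c0 ->; exists c.
Qed.

Let gr_homog d e f : f != 0 -> gr d e f = f -> (e <= d)%N /\ f \is (d - e).-homog.
Proof.
move=> f0; rewrite /gr; case: ifP => [le <-|_ ef]; first by split=> //; apply: pihomogP.
by rewrite -ef eqxx in f0.
Qed.

Let homog_const_or_pos d e f : f != 0 -> gr d e f = f ->
  (exists2 c, c != 0 & f = c%:MP) \/ exists2 m, (0 < m)%N & f \is m.-homog.
Proof.
move=> f0 /(gr_homog f0)[_ hf]; have [e0|pos] := posnP (d - e)%N; last by right; exists (d - e)%N.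
rewrite e0 in hf; left; exists f@_0%MM; last exact: dhomog_const.
by apply: contra_neq f0 => f00; rewrite (dhomog_const hf) f00 mpolyC0.
Qed.

Lemma rank_one_generator : exists d a b, [/\ rel a b, gr d d1 a = a, gr d d2 b = b,
  (forall a' b', rel a' b' -> exists h, a' = h * a /\ b' = h * b)
  & (exists2 c, c != 0 & a = c%:MP) \/ (exists2 c, c != 0 & b = c%:MP)].
Proof.
have [d [a [b [r nz ga gb gen]]]] := rel_generator; exists d, a, b; split=> //.
have [ra rb Jab] := r.
(* Then saturation puts [e2] into [J], so (0, 1) is a relation and the generator [b] divides 1. The
   case b = 0 is symmetric. *)
have [a0|a0] := eqVneq a 0.
  have b0 : b != 0 by case: nz => //; rewrite a0 eqxx.
  have r1 : rel 0 1.
    split; [by rewrite rmorph0 | by rewrite rmorph1 |].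
    rewrite mul0r add0r mul1r; apply: (satJ (nI rb b0)).
    by move: Jab; rewrite a0 mul0r add0r.
  by have [h [_ /const_of_unit]] := gen _ _ r1; right.
have [b0|b0] := eqVneq b 0.
  have r1 : rel 1 0.
    split; [by rewrite rmorph1 | by rewrite rmorph0 |].
    rewrite mul0r addr0 mul1r; apply: (satJ (nI ra a0)).
    by move: Jab; rewrite b0 mul0r addr0.
  by have [h [/const_of_unit + _]] := gen _ _ r1; left.
have [?|[da da0 ha]] := homog_const_or_pos a0 ga; first by left.
have [?|[db db0 hb]] := homog_const_or_pos b0 gb; first by right.
exfalso.
have [hx hy] := (coord_homog k (index_x n), coord_homog k (index_y n)).
pose K := lincomb [:: a; b; x; y]; pose K1 := lincomb [:: a; x; y].
have iK : is_ideal K by exact: lincomb_ideal.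
have iK1 : is_ideal K1 by exact: lincomb_ideal.
have hK : homogeneous K.
  by apply: lincomb_homogeneous => -[|[|[|[|]]]] // _;
    [exists da | exists db | exists 1%N | exists 1%N].
have hK1 : homogeneous K1.
  by apply: lincomb_homogeneous => -[|[|[|]]] // _; [exists da | exists 1%N | exists 1%N].
have IK : I `<=` K by apply: IX_sub => //; apply: lincomb_in; rewrite !inE eqxx !orbT.
have IK1 : I `<=` K1 by apply: IX_sub => //; apply: lincomb_in; rewrite !inE eqxx !orbT.
have JI : J `<=` I by exact: multiple_sub.
have JK : J `<=` K by exact: subset_trans JI IK.
have K1K : K1 `<=` K.
  by apply: lincomb_subP => // c cin; apply: lincomb_in; move: cin; rewrite !inE;
    move=> /or3P[]->; rewrite ?orbT.
have [i nKi] : exists i : 'I_n.+3, forall r, ~ K ('X_i ^+ r).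
  apply: irrelevant_not_nilpotent => [|]; last by rewrite /= !ltnS.
  by case=> [|[|[|[|]]]] // _; [exists da | exists db | exists 1%N | exists 1%N].
have [p [KP minP]] := minimal_point iK hK JK nKi.
set P := prime_of p in KP minP.
have pP : prime_ideal P by exact: prime_of_prime.
have hP : homogeneous P by exact: prime_of_homogeneous.
have [hM1 hMM] := homogeneous_elts_mulclosed k n.+2.
(* Avoiding the forms outside [P] keeps the prime [q], minimal over (a, x, y), inside [P]. The chain
   [IX], [q], [P] then makes the dimension at least two. *)
pose M0 := [set f | homogeneous_elts f /\ ~ P f].
have hM0 : mulclosed M0.
  split; first by split=> //; case: pP.
  by move=> f g [hf nf] [hg ng]; split; [apply: hMM | apply: primeNM].
have [||q [pq hq K1q Mq minq]] := minimal_homogeneous_prime iK1 hM0 _ _ hK1.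
- by move=> f [].
- by move=> f [_ nf] /K1K/KP.
have qP : q `<=` P.
  move=> f qf; apply: ideal_homogP; first exact: prime_is_ideal.
  move=> e; apply: contrapT => nPf; apply: (Mq (pihomog mdeg e f)); last exact: hq.
  by split=> //; exists e; apply: pihomogP.
(* If [b] were in [q], some t b^m with t outside [q] would be a multiple of [a] in R. By coprimality
   [a] divides [rho t], so t lies in [q]. *)
have nqb : ~ q b.
  move=> /(minq _ _ hb)[t [nt ht [m K1t]]]; apply: nt.
  have [w ew] : exists w, rho t * b ^+ m = w * a /\ rho w = w.
    have /lincomb3P[w [w1 [w2 e]]] := K1t; exists (rho w); split; last exact: restr_idem.
    have := congr1 rho e; rewrite restrM rmorphXn /= rb => ->.
    by rewrite !restrD !restrM rho_x rho_y ra !mulr0 !addr0.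
  have [h eh] : exists h, rho t = h * a.
    elim: m w ew {K1t} => [|m IH] w [ew rw]; first by exists w; rewrite -ew expr0 mulr1.
    have [|||h eh] := @rel_cancel a b r gen a0 (rho t * b ^+ m) w.
    - by rewrite restrM rmorphXn /= restr_idem rb.
    - exact: rw.
    - by rewrite -mulrA -exprSr.
    have eh' : rho t * b ^+ m = rho h * a.
      by rewrite -[in RHS]ra -restrM -eh restrM rmorphXn /= restr_idem rb.
    by apply: (IH (rho h)); rewrite restr_idem.
  have iq := prime_is_ideal pq.
  apply/(ideal_sub_mod iq (sub_rho t iq _ _)).
  - by apply: K1q; apply: IK1; exact: IX_x.
  - by apply: K1q; apply: IK1; exact: IX_y.
  rewrite eh; apply: ideal_Ml => //; apply: K1q.
  by apply: lincomb_in; rewrite inE eqxx.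
pose Q i := nth I [:: I; q; P] i.
have IP : I `<=` P by exact: subset_trans IK KP.
have Iq : I `<=` q by exact: subset_trans IK1 K1q.
have [i0|i0 lti|us [le2 hus]] := @regular_sequence_lift _ _ Y p 2 CM Q.
- case: i0 => [|[|[|]]] // _; rewrite /Q /=; split=> //; try exact: subset_trans JI _.
  exact: IX_prime.
- case: i0 lti => [|[|]] // _; rewrite /Q /=; split=> //.
    exists a; split; [by exists da | | exact: nI].
    by apply: K1q; apply: lincomb_in; rewrite inE eqxx.
  exists b; split; [by exists db | | exact: nqb].
  by apply: KP; apply: lincomb_in; rewrite !inE eqxx orbT.
case: us le2 hus => [|u [|v us]] // _ hus.
have [Pu hu regu] := hus 0%N isT; have [Pv hv regv] := hus 1%N isT.
rewrite /= ?take0 in regu regv.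
apply: (@generator_no_depth a b r gen a0 P pP KP minP u v) => // f.
have JE : ideal_add J (lincomb [::]) = J.
  apply/seteqP; split; last by apply: ideal_addl; apply: lincomb_ideal.
  apply: ideal_add_sub => // _ [c ->]; rewrite big_ord0; exact: ideal_0.
by move: (regu f); rewrite JE.
Qed.

End RankOne.

(** * Powers of the ideal of X, primary components and lengths *)

Section Filtration.
Variables (k : fieldType) (n : nat).
Local Notation S := {mpoly k[n.+3]}.
Local Notation I := (@IX k n).
Implicit Types (f g a b c s t : S) (J K Q : set S).

Lemma IX_pow_homogeneous j : homogeneous (ideal_pow I j).
Proof.
elim: j => [|j IH] // f If.
have ip := ideal_pow_ideal I j.+1.
have [iL _] := @graded_ideal k n.+2 (fun=> ideal_pow I j.+1) (fun=> ideal_0 ip)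
  (fun _ _ _ _ _ => @ideal_D _ _ _ _ ip) (fun _ _ _ _ _ _ => @ideal_Ml _ _ _ _ ip).
apply: (@ideal_powS_sub _ I _ j iL _ f If) => a b Ia Ib d.
rewrite (pihomog_partitionE (leqnn (msize a))) mulr_suml raddf_sum /=.
apply: ideal_sum => // l _; rewrite (pihomogMl _ _ (pihomogP _ _ _)).
case: ifP => _; last exact: ideal_0.
by apply: ideal_powSM; [apply: IX_homogeneous | apply: IH].
Qed.

Lemma ideal_pow_leq i j : (i <= j)%N -> ideal_pow I j `<=` ideal_pow I i.
Proof.
move=> /subnK <-; elim: (j - i)%N => [|l IH] //.
apply: ideal_powS_sub; first exact: ideal_pow_ideal.
by move=> a b _ /IH; apply: ideal_Ml; apply: ideal_pow_ideal.
Qed.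

Lemma ideal_pow1 : ideal_pow I 1 = I.
Proof.
apply/seteqP; split; first exact: tower_pow (tower_IX k n).
by move=> f If; rewrite -(expr1 f); apply: ideal_powX.
Qed.

(** The other components have radicals strictly larger than [IX]. A product of elements outside
    [IX], one from each of them, carries [Q] into [K]. *)
Lemma primary_component_props K Q j : is_ideal K -> ideal_pow I j `<=` K ->
  primary_component I K Q ->
  [/\ IX_saturated Q, K `<=` Q & forall f, Q f -> exists2 s, ~ I s & K (s * f)].
Proof.
move=> iK IK [r [q [[pq eK dq _] [i ri eQ]]]]; rewrite -{Q}eQ.
have Kq l : K `<=` q l by rewrite eK => f; apply.
split.
- move=> s f nIs; case: (pq i) => _ _ prim; rewrite mulrC => /prim[//|].
  by rewrite ri.
- exact: Kq.
have /choice[s hs] : forall l, exists s, l != i -> q l s /\ ~ I s.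
  move=> l; have [_|li] := eqVneq l i; first by exists 0.
  apply: contrapT => nex; case/eqP: li; apply: dq; rewrite ri.
  apply/seteqP; split=> f.
    move=> [m qf]; apply: (primeX (@IX_prime k n) (r := m)); apply: contrapT => nI.
    by apply: nex; exists (f ^+ m).
  by move=> If; exists j; apply: Kq; apply: IK; apply: ideal_powX.
move=> f qf; exists (\prod_(l | l != i) s l).
  apply: (big_ind (fun t => ~ I t)); [exact: IXN1 | |by move=> l /hs[]].
  by move=> a b; apply: primeNM; apply: IX_prime.
rewrite eK => l; have [iql _ _] := pq l.
have [->|li] := eqVneq l i; first by case: (pq i) => iqi _ _; apply: ideal_Ml.
by rewrite (bigD1 l) //=; do 2!apply: ideal_Mr => //; case: (hs l li).
Qed.

Lemma saturated_loc J : IX_saturated J -> loc I J `<=` J.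
Proof. by move=> sJ f [t [nt _]]; apply: sJ. Qed.

Lemma loc_of_saturation K Q : is_ideal K -> homogeneous K -> homogeneous Q ->
  (forall f, Q f -> exists2 s, ~ I s & K (s * f)) -> Q `<=` loc I K.
Proof.
move=> iK hK hQ QK f Qf; have pI := @IX_prime k n.
apply: ideal_homogP; first exact: loc_ideal.
move=> d; have [s nIs Ks] := QK _ (hQ _ Qf d).
exact: homogeneous_denominator hK (IX_ideal _ _) (pihomogP _ _ _) nIs Ks.
Qed.

(* Nakayama's lemma at the generic point of X. *)
Lemma IX_pow_strict J m i : is_ideal J -> IX_saturated J -> ideal_pow I m.+1 `<=` J ->
  ~ (ideal_pow I m `<=` J) -> (i <= m)%N ->
  ~ (ideal_pow I i `<=` loc I (ideal_add J (ideal_pow I i.+1))).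
Proof.
move=> iJ sJ Im nIm lei sub; apply: nIm; have pI := @IX_prime k n.
pose L j := loc I (ideal_add J (ideal_pow I j)).
have iA j : is_ideal (ideal_add J (ideal_pow I j)).
  by apply: ideal_add_ideal => //; apply: ideal_pow_ideal.
have step j : ideal_pow I j `<=` L j.+1 -> ideal_pow I j.+1 `<=` L j.+2.
  move=> IL; apply: ideal_powS_sub; first exact: loc_ideal.
  move=> a b Ia /IL[t [nt ht [c Jc [d Id e]]]]; exists t; split=> //.
  rewrite mulrCA -e; exists (a * c); first exact: ideal_Ml.
  by exists (a * d); [apply: ideal_powSM | rewrite mulrDr].
have Lstep j : ideal_pow I j `<=` L j.+1 -> L j `<=` L j.+1.
  move=> IL f [t [nt ht]] /(@ideal_add_sub _ _ _ (L j.+1))-/(_ _ _ IL) h.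
  apply: (loc_loc pI nt ht); apply: h; first exact: loc_ideal.
  by move=> g Jg; apply: loc_sub => //; apply: ideal_addl => //; apply: ideal_pow_ideal.
have all j : ideal_pow I (i + j)%N `<=` L (i + j).+1.
  by elim: j => [|j IH]; rewrite ?addn0 // addnS; apply: step.
have Lm j : (i + j <= m)%N -> ideal_pow I i `<=` L (i + j).+1.
  elim: j => [|j IH] lt; first by rewrite addn0.
  rewrite addnS; apply: subset_trans (IH _) _; first by lia.
  by apply: Lstep; rewrite -addnS.
have Ii : ideal_pow I i `<=` J.
  move=> f /(Lm (m - i)%N); rewrite subnKC // => /(_ (leqnn _)) Lf.
  apply: (saturated_loc sJ); move: Lf; apply: loc_mono.
  exact: ideal_add_sub.
exact: subset_trans (ideal_pow_leq lei) Ii.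
Qed.

Lemma multiplicity_ge (Y : closed_subscheme k n.+2) mu l (A : nat -> set S) :
  multiplicity Y mu -> (forall i, (i <= l)%N -> is_ideal (A i) /\ ideal_of Y `<=` A i) ->
  (forall i, (i < l)%N -> A i `<=` A i.+1 /\
     exists f, [/\ homogeneous_elts f, A i.+1 f & ~ loc I (A i) f]) -> (l <= mu)%N.
Proof.
move=> [p Pp [_ max]] hA sA; apply: max; exists (fun i => extension p (A i)).
split=> [i lei|i lti]; first by have [iA JA] := hA i lei; apply: extension_ideal.
have [[iA JA] [iA' JA']] := (hA i (ltnW lti), hA i.+1 lti).
have [AA [f [[d hf] Af nAf]]] := sA i lti.
apply: (@extension_proper _ _ _ p _ _ d f) => //.
by rewrite Pp => t nt ht At; apply: nAf; exists t.
Qed.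

(** The ideals J + I^(m+1-i), for i from 0 to m + 1, climb from J to S, and each step is strict at
    the generic point by Nakayama's lemma. *)
Lemma filtration_length (Y : closed_subscheme k n.+2) m mu :
  IX_saturated (ideal_of Y) -> ideal_pow I m.+1 `<=` ideal_of Y ->
  ~ (ideal_pow I m `<=` ideal_of Y) -> multiplicity Y mu -> (m < mu)%N.
Proof.
move=> sJ Im nIm mult; set J := ideal_of Y in sJ Im nIm *.
have iJ : is_ideal J := ideal_of_ideal Y.
have pI := @IX_prime k n.
have iA i : is_ideal (ideal_add J (ideal_pow I i)).
  by apply: ideal_add_ideal => //; apply: ideal_pow_ideal.
apply: (multiplicity_ge (A := fun i => ideal_add J (ideal_pow I (m.+1 - i)))) mult _ _.
  by move=> i _; split; [apply: iA | apply: ideal_addl; apply: ideal_pow_ideal].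
move=> i lti; have e : (m.+1 - i = (m.+1 - i.+1).+1)%N by lia.
split.
  apply: ideal_add_sub; [exact: iA | apply: ideal_addl; exact: ideal_pow_ideal |].
  by apply: subset_trans (ideal_addr iJ); apply: ideal_pow_leq; lia.
have [s Is nLs] : exists2 s, ideal_pow I (m.+1 - i.+1) s &
    ~ loc I (ideal_add J (ideal_pow I (m.+1 - i))) s.
  apply: contrapT => nex; have lem : (m.+1 - i.+1 <= m)%N by lia.
  apply: (IX_pow_strict iJ sJ Im nIm lem); rewrite -e => s Is.
  by apply: contrapT => nL; apply: nex; exists s.
have iL := loc_ideal pI (iA (m.+1 - i)%N).
have [f [hf If nLf]] := homogeneous_witness iL (@IX_pow_homogeneous _) Is nLs.
by exists f; split=> //; apply: ideal_addr.
Qed.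

End Filtration.

(** * Classification *)

Section Classification.
Variables (k : fieldType) (n : nat).
Hypothesis hn : (2 <= n)%N.
Local Notation S := {mpoly k[n.+3]}.
Local Notation x := (coord_x k n).
Local Notation y := (coord_y k n).
Local Notation I := (@IX k n).
Local Notation rho := (restr (zvars n)).
Implicit Types (f g a b c s t : S).

Lemma rho_const (c : k) : rho c%:MP = c%:MP. Proof. exact: restrC. Qed.

Lemma rho_sub_IX f : I (f - rho f).
Proof. exact: (sub_rho f (IX_ideal k n) (@IX_x k n) (@IX_y k n)). Qed.

Section LinearForms.
Variables (alpha beta gamma delta : k).
Hypothesis det0 : gamma * beta - delta * alpha != 0.
(** [form1] and [form2] are l' and l; [det0] makes them a basis of the linear forms in x and y. *)
Definition form1 : S := gamma%:MP * x + delta%:MP * y.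
Definition form2 : S := alpha%:MP * x + beta%:MP * y.
Local Notation l' := form1.
Local Notation l := form2.

Lemma IX_forms f : I f <-> exists u v, f = u * l' + v * l.
Proof.
split=> [/IXP[u [v ->]]|[u [v ->]]]; last first.
  apply/IXP; exists (u * gamma%:MP + v * alpha%:MP), (u * delta%:MP + v * beta%:MP).
  by rewrite /form1 /form2; ring.
pose D := gamma * beta - delta * alpha; pose d : S := (D^-1)%:MP.
have eD : d * (gamma%:MP * beta%:MP - delta%:MP * alpha%:MP) = 1.
  by rewrite /d -!mpolyCM -mpolyCB -mpolyCM mulVf // mpolyC1.
exists (d * (u * beta%:MP - v * alpha%:MP)), (d * (v * gamma%:MP - u * delta%:MP)).
rewrite -[LHS]mul1r -eD /form1 /form2; ring.
Qed.

Lemma form1_homog : l' \is 1.-homog.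
Proof.
by apply: dhomogD; rewrite mul_mpolyC; apply: dhomogZ; apply: coord_homog.
Qed.

Lemma form2_homog : l \is 1.-homog.
Proof.
by apply: dhomogD; rewrite mul_mpolyC; apply: dhomogZ; apply: coord_homog.
Qed.

Lemma IX_form1 : I l'. Proof. by apply/IX_forms; exists 1, 0; ring. Qed.
Lemma IX_form2 : I l. Proof. by apply/IX_forms; exists 0, 1; ring. Qed.

Lemma IX_pow2_forms f : ideal_pow I 2 f -> exists u v w,
  f = u * l' ^+ 2 + v * (l' * l) + w * l ^+ 2.
Proof.
move=> If; apply/lincomb3P; move: f If; apply: ideal_powS_sub; first exact: lincomb_ideal.
rewrite ideal_pow1 => a b /IX_forms[u [v ->]] /IX_forms[u' [v' ->]].
by apply/lincomb3P; exists (u * u'), (u * v' + v * u'), (v * v'); ring.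
Qed.

End LinearForms.

Lemma IX_powM i a b : I a -> ideal_pow I i b -> ideal_pow I i.+1 (a * b).
Proof. exact: ideal_powSM. Qed.

Lemma IX_pow2M a b : I a -> I b -> ideal_pow I 2 (a * b).
Proof. by move=> Ia Ib; apply: IX_powM => //; rewrite ideal_pow1. Qed.

Lemma IX_pow3M a b c : I a -> I b -> I c -> ideal_pow I 3 (a * (b * c)).
Proof. by move=> Ia Ib Ic; apply: IX_powM => //; apply: IX_pow2M. Qed.

Lemma pihomog0_const f : exists c : k, pihomog mdeg 0 f = c%:MP.
Proof. by exists (pihomog mdeg 0 f)@_0%MM; apply: dhomog_const; apply: pihomogP. Qed.

Lemma const_homog_pos (c : k) d : c != 0 -> c%:MP \is [in k[n.+3], d.-homog] -> d = 0%N.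
Proof.
move=> c0 h; apply/esym; apply: (dhomog_uniq (p := c%:MP_[n.+3])) h.
  by rewrite mpolyC_eq0.
by rewrite -[c%:MP]mulr1 mul_mpolyC; apply: dhomogZ; apply: dhomog1.
Qed.

(* Ferrand's doubling. *)
Lemma double_structure (Y : closed_subscheme k n.+2) :
  multiple_structure Y -> cohen_macaulay Y -> ideal_pow I 2 `<=` ideal_of Y ->
  ~ (I `<=` ideal_of Y) ->
  ideal_of Y `<=` ideal_pow I 2 \/ exists alpha beta : k,
    [/\ (alpha != 0) || (beta != 0), ideal_of Y (form2 alpha beta)
      & forall f, ideal_of Y f -> exists h g, ideal_pow I 2 g /\ f = h * form2 alpha beta + g].
Proof.
move=> mY CM I2J nIJ; set J := ideal_of Y in I2J nIJ *.
have iJ : is_ideal J := ideal_of_ideal Y.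
have JI : J `<=` I by exact: multiple_sub.
have i2 := ideal_pow_ideal I 2.
have split_f f : I f -> exists a b g, [/\ rho a = a, rho b = b, ideal_pow I 2 g
    & f = a * x + b * y + g].
  move=> /IXP[p [q ->]]; exists (rho p), (rho q), ((p - rho p) * x + (q - rho q) * y).
  split; [exact: restr_idem | exact: restr_idem | | by ring].
  by apply: (ideal_D i2); apply: IX_pow2M (rho_sub_IX _) _; [exact: IX_x | exact: IX_y].
have drop_g a b g : ideal_pow I 2 g -> J (a * x + b * y + g) -> J (a * x + b * y).
  by move=> Ig Jf; rewrite -(addrK g (a * x + b * y)); apply: (ideal_B iJ Jf); apply: I2J.
have [triv|nontriv] := pselect (forall a b, rho a = a -> rho b = b -> J (a * x + b * y) ->
    a = 0 /\ b = 0).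
  left=> f Jf; have [a [b [g [ra rb Ig ef]]]] := split_f f (JI _ Jf).
  have [|a0 b0] := triv a b ra rb; first by apply: drop_g Ig _; rewrite -ef.
  by rewrite ef a0 b0 !mul0r !add0r.
right.
have Ixe c : I c -> J (c * x) by move=> Ic; apply: I2J; apply: IX_pow2M => //; exact: IX_x.
have Iye c : I c -> J (c * y) by move=> Ic; apply: I2J; apply: IX_pow2M => //; exact: IX_y.
have nJxy : ~ (J x /\ J y) by move=> [Jx Jy]; apply: nIJ; apply: IX_sub.
have satE : IX_saturated [set f | exists a b, J (f - (a * x + b * y))].
  have E f : (exists a b, J (f - (a * x + b * y))) <-> I f.
    split=> [[a [b Jf]]|/IXP[a [b ->]]]; last first.
      by exists a, b; rewrite subrr; apply: ideal_0.
    apply/(ideal_sub_mod (IX_ideal k n) (JI _ Jf)).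
    by apply/IXP; exists a, b.
  move=> s f nIs /= /E Isf; apply/E.
  by case: (@IX_prime k n) => _ _ /(_ _ _ Isf)[].
have [|d [a [b [[ra rb Jab] ga gb gen cst]]]] := @rank_one_generator k n hn Y mY CM x y 1 1
    (coord_homog k _) (coord_homog k _) Ixe Iye nJxy satE.
  apply: contrapT => nex; apply: nontriv => a b ra rb Jab.
  apply: contrapT => n0; apply: nex; exists a, b; split=> //.
  have [a0|a0] := eqVneq a 0; last by left.
  by right; apply/eqP => b0; apply: n0.
(* One coefficient is a nonzero constant and x, y have degree 1, so d = 1 and the other coefficient
   is constant too. *)
have [alpha [beta [nz ea eb]]] : exists alpha beta : k,
    [/\ (alpha != 0) || (beta != 0), a = alpha%:MP & b = beta%:MP].
  have deg (c : k) f : c != 0 -> (if (1 <= d)%N then pihomog mdeg (d - 1) f else 0) = f ->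
      f = c%:MP -> d = 1%N.
    move=> c0; case: ifP => [le1 <- e|_ <- /eqP]; last by rewrite eq_sym mpolyC_eq0 (negPf c0).
    by have := const_homog_pos c0 (d := (d - 1)%N); rewrite -e => /(_ (pihomogP _ _ _)); lia.
  have d1 : d = 1%N.
    by case: cst => -[c c0 e]; [apply: deg c0 ga e | apply: deg c0 gb e].
  move: ga gb; rewrite d1 /= => ga gb.
  have [[c1 e1] [c2 e2]] := (pihomog0_const a, pihomog0_const b).
  rewrite subnn in ga gb; rewrite ga in e1; rewrite gb in e2.
  exists c1, c2; split=> //.
  case: cst => -[c c0]; rewrite ?e1 ?e2 => /eqP; rewrite mpolyC_eq => /eqP ->; rewrite c0 //.
  by rewrite orbT.
exists alpha, beta; split=> //; first by rewrite /form2 -ea -eb.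
move=> f Jf; have [p [q [g [rp rq Ig ef]]]] := split_f f (JI _ Jf).
have [|h [ep eq]] := gen p q.
  by split=> //; apply: drop_g Ig _; rewrite -ef.
by exists h, g; split=> //; rewrite ef ep eq ea eb /form2; ring.
Qed.

Section Triple.
Variable Y : closed_subscheme k n.+2.
Local Notation J := (ideal_of Y).
Hypothesis mY : multiple_structure Y.
Hypothesis CM : cohen_macaulay Y.
Hypothesis I3J : ideal_pow I 3 `<=` J.
Variables (alpha beta gamma delta : k) (J1 : set S).
Hypothesis det0 : gamma * beta - delta * alpha != 0.
Local Notation l' := (form1 gamma delta).
Local Notation l := (form2 alpha beta).
Hypothesis iJ1 : is_ideal J1.
Hypothesis satJ1 : IX_saturated J1.
Hypothesis JJ1 : J `<=` J1.
Hypothesis J1E : forall f, J1 f <-> exists u v, f = u * l' ^+ 2 + v * l.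
Hypothesis J1l : exists s, ~ I s /\ ideal_add J (ideal_pow I 2) (s * l).
Hypothesis nI2J : ~ (ideal_pow I 2 `<=` J).

Let iJ : is_ideal J. Proof. exact: ideal_of_ideal. Qed.
Let satJ : IX_saturated J. Proof. exact: cohen_macaulay_saturated. Qed.
Let Il' : I l'. Proof. exact: IX_form1 det0. Qed.
Let Il : I l. Proof. exact: IX_form2 det0. Qed.

(** Up to a factor outside [IX], l lies in J + I^2; hence c l lies in J + I^3, which is J. *)
Let Jl c : I c -> J (c * l).
Proof.
move=> Ic; have [s [nIs [j Jj [i I2i e]]]] := J1l; apply: (satJ nIs).
rewrite mulrCA -e mulrDr; apply: (ideal_D iJ); first exact: ideal_Ml.
by apply: I3J; apply: IX_powM.
Qed.

Let Jl'2 c : I c -> J (c * l' ^+ 2).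
Proof. by move=> Ic; apply: I3J; rewrite expr2; apply: IX_pow3M. Qed.

Let nJl'2 : ~ J (l' ^+ 2).
Proof.
move=> Jl2; apply: nI2J => f /(IX_pow2_forms det0)[u [v [w ->]]].
apply: (ideal_D iJ); last by apply: (ideal_Ml _ iJ); rewrite expr2; apply: Jl.
by apply: (ideal_D iJ); apply: (ideal_Ml _ iJ) => //; apply: Jl.
Qed.

Lemma triple_structure :
  (forall f, J f <-> exists u v, f = u * l' ^+ 3 + v * l) \/
  exists a, [/\ a \is 1.-homog, rho a = a, a != 0
    & forall f, J f <-> exists u v w, f = u * (l' ^+ 2 + a * l) + v * (l' * l) + w * l ^+ 2].
Proof.
have nJe : ~ (J l /\ J (l' ^+ 2)) by case.
have E f : (exists a b, J (f - (a * l + b * l' ^+ 2))) <-> J1 f.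
  split=> [[a [b Jf]]|/J1E[u [v ->]]]; last first.
    by exists v, u; rewrite [v * _ + _]addrC subrr; apply: ideal_0.
  by apply/(ideal_sub_mod iJ1 (JJ1 Jf))/J1E; exists b, a; rewrite addrC.
have satE : IX_saturated [set f | exists a b, J (f - (a * l + b * l' ^+ 2))].
  by move=> s f nIs /= /E /(satJ1 nIs)/E.
have mod_rho u v : J (u * l + v * l' ^+ 2) <-> J (rho u * l + rho v * l' ^+ 2).
  apply: (ideal_sub_mod iJ).
  have -> : u * l + v * l' ^+ 2 - (rho u * l + rho v * l' ^+ 2) =
      (u - rho u) * l + (v - rho v) * l' ^+ 2 by ring.
  by apply: (ideal_D iJ); [apply: Jl | apply: Jl'2]; apply: rho_sub_IX.
have [|d [a [b [[ra rb Jab] ga gb gen cst]]]] := @rank_one_generator k n hn Y mY CM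
    l (l' ^+ 2) 1 (1 * 2) (form2_homog _ _) (dhomogMn 2 (form1_homog _ _)) Jl Jl'2 nJe satE.
  (* A nonzero relation: s l lies in J + I^2, and modulo J only the term u l'^2 of its second
     summand survives. *)
  have [s [nIs [j Jj [i I2i e]]]] := J1l.
  have [u [v [w ei]]] := IX_pow2_forms det0 I2i.
  exists (rho s), (- rho u); split; last by left; apply/eqP => /IXE.
  split; [exact: restr_idem | by rewrite restrN restr_idem |].
  have := (mod_rho s (- u)); rewrite restrN => <-.
  have -> : s * l + - u * l' ^+ 2 = j + ((v * l') * l + (w * l) * l).
    by rewrite -e ei; ring.
  by apply: (ideal_D iJ) => //; apply: (ideal_D iJ); apply: Jl; apply: (ideal_Ml _ (IX_ideal k n)).
have coefs f : J f -> exists u v h, [/\ f = u * l' ^+ 2 + v * l, rho v = h * a & rho u = h * b].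
  move=> Jf; have /J1E[u [v ef]] := JJ1 Jf; exists u, v.
  have [|h [ev eu]] := gen (rho v) (rho u); last by exists h.
  split; [exact: restr_idem | exact: restr_idem |].
  apply: (proj1 (mod_rho v u)); have -> : v * l + u * l' ^+ 2 = f by rewrite ef [RHS]addrC.
  exact: Jf.
case: cst => -[c c0 ec].
  (* The coefficient of l is constant, so d = 1; that of l'^2 would have negative degree and
     vanishes. Hence l is in J. *)
  left; have d1 : d = 1%N.
    move: ga; case: ifP => [le1|_ a0]; last first.
      by move/eqP: ec; rewrite -a0 eq_sym mpolyC_eq0 (negPf c0).
    by have := pihomogP mdeg (d - 1) a; move=> + e; rewrite e ec => /(const_homog_pos c0); lia.
  have b0 : b = 0 by rewrite -gb d1.
  move=> f; split=> [|[u [v ->]]]; last first.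
    apply: (ideal_D iJ); first by rewrite exprS; apply: (ideal_Ml _ iJ); apply: Jl'2.
    apply: (ideal_Ml _ iJ); have -> : l = (c^-1)%:MP * (a * l + b * l' ^+ 2).
      by rewrite ec b0 mul0r addr0 mulrA -mpolyCM mulVf // mpolyC1 mul1r.
    exact: ideal_Ml.
  move=> /coefs[u [v [h [-> _]]]]; rewrite b0 mulr0 => /IXE/(IX_forms det0)[p [q ->]].
  by exists p, (q * l' ^+ 2 + v); ring.
(* The coefficient of l'^2 is constant, so d = 2 and that of l is a linear form in R. It is nonzero
   because l'^2 is not in J. *)
right; have d2 : d = 2%N.
  move: gb; case: ifP => [le1|_ b0]; last first.
    by move/eqP: ec; rewrite -b0 eq_sym mpolyC_eq0 (negPf c0).
  by have := pihomogP mdeg (d - 1 * 2) b; move=> + e; rewrite e ec => /(const_homog_pos c0); lia.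
pose a' := (c^-1)%:MP * a.
have ea : a = c%:MP * a' by rewrite /a' mulrA -mpolyCM mulfV // mpolyC1 mul1r.
have ha : a \is 1.-homog by move: ga; rewrite d2 /= => <-; apply: pihomogP.
have eC : (c^-1)%:MP * c%:MP = 1 :> S by rewrite -mpolyCM mulVf // mpolyC1.
have Ja' : J (l' ^+ 2 + a' * l).
  have -> : l' ^+ 2 + a' * l = (c^-1)%:MP * (a * l + b * l' ^+ 2).
    by rewrite ec -[LHS]addrC -{1}[l' ^+ 2]mul1r -eC /a'; ring.
  exact: ideal_Ml.
exists a'; split=> //.
- by rewrite /a' mul_mpolyC; apply: dhomogZ.
- by rewrite /a' restrM rho_const ra.
- by apply/eqP => a0; apply: nJl'2; move: Ja'; rewrite a0 mul0r addr0.
move=> f; split=> [|[u [v [w ->]]]]; last first.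
  apply: (ideal_D iJ); last by apply: (ideal_Ml _ iJ); rewrite expr2; apply: Jl.
  by apply: (ideal_D iJ); apply: (ideal_Ml _ iJ) => //; apply: Jl.
(* Modulo [IX] the coefficients of l'^2 and l are h c and h c a'. The parts in [IX], written in l'
   and l, only contribute to the listed generators. *)
move=> /coefs[u [v [h [-> ev eu]]]].
have /(IX_forms det0)[p [q ep]] := rho_sub_IX u.
have /(IX_forms det0)[p' [q' ep']] := rho_sub_IX v.
have {}ep : u = h * c%:MP + (p * l' + q * l) by rewrite -ep eu ec; ring.
have {}ep' : v = h * c%:MP * a' + (p' * l' + q' * l) by rewrite -ep' ev ea; ring.
exists (h * c%:MP + p * l'), (q * l' - p * a' + p'), q'.
by rewrite ep ep'; ring.
Qed.

End Triple.

End Classification.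

(** * Linear changes of coordinates *)

Section LinearChange.
Variables (k : fieldType) (N : nat).
Local Notation S := {mpoly k[N.+1]}.
Implicit Types (f a : S) (g h : 'M[k]_N.+1).

Lemma comp_linear_formsX g i : ('X_i : S) \mPo linear_forms g = \sum_j g i j *: 'X_j.
Proof. by rewrite comp_mpolyXU -tnth_nth tnth_mktuple. Qed.

Lemma linear_forms_mul g h f :
  (f \mPo linear_forms g) \mPo linear_forms h = f \mPo linear_forms (g *m h).
Proof.
apply: (@mpoly_rmorph_ext _ _ _ (comp_mpoly (linear_forms h) \o comp_mpoly (linear_forms g))
  (comp_mpoly (linear_forms (g *m h)))) => [c|i] /=; first by rewrite !comp_mpolyC.
rewrite !comp_linear_formsX raddf_sum /=.
under eq_bigr => j _ do rewrite comp_mpolyZ comp_linear_formsX scaler_sumr.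
rewrite exchange_big /=; apply: eq_bigr => l _; rewrite mxE scaler_suml.
by apply: eq_bigr => j _; rewrite scalerA.
Qed.

Lemma linear_forms1 f : f \mPo linear_forms 1%:M = f.
Proof.
apply: (@mpoly_rmorph_ext _ _ _ (comp_mpoly (linear_forms 1%:M)) idfun) => [c|i] /=.
  exact: comp_mpolyC.
rewrite comp_linear_formsX (bigD1 i) //= big1 ?addr0 => [|j ji]; rewrite mxE.
  by rewrite eqxx scale1r.
by rewrite eq_sym (negPf ji) scale0r.
Qed.

Lemma linearly_equivalentP (Y Z : closed_subscheme k N) g (G : seq S) :
  g \in unitmx -> ideal_of Z = lincomb G ->
  ideal_of Y = lincomb [seq f \mPo linear_forms g | f <- G] -> linearly_equivalent Y Z.
Proof.
move=> ug eZ eY; exists g => // f; rewrite eZ eY.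
have comp h s f' : lincomb s f' ->
    lincomb [seq a \mPo linear_forms h | a <- s] (f' \mPo linear_forms h).
  move=> [c ->]; exists (fun i => c i \mPo linear_forms h); rewrite size_map raddf_sum /=.
  by apply: eq_bigr => i _; rewrite (nth_map 0) // rmorphM.
split=> [|/(comp (invmx g))]; first exact: comp.
rewrite -map_comp linear_forms_mul mulmxV // linear_forms1 map_id_in // => a _ /=.
by rewrite linear_forms_mul mulmxV // linear_forms1.
Qed.

Lemma linear_form_coefs a : a \is 1.-homog -> a = \sum_j a@_U_(j) *: 'X_j.
Proof.
move=> ha; apply/mpolyP => m; rewrite raddf_sum /=.
under eq_bigr => j _ do rewrite mcoeffZ mcoeffX.
have [/mdeg1P[i /eqP ->]|m1] := boolP (mdeg m == 1%N); last first.
  rewrite (dhomog_nemf_coeff ha) // big1 // => j _.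
  by case: eqP => [e|]; rewrite ?mulr0 //; move: m1; rewrite -e mdeg1.
rewrite (bigD1 i) //= eqxx mulr1 big1 ?addr0 // => j ji.
by rewrite eq_mnm1 (negPf ji) mulr0.
Qed.

End LinearChange.

Section Change.
Variables (k : fieldType) (n : nat).
Local Notation S := {mpoly k[n.+3]}.
Local Notation x := (coord_x k n).
Local Notation y := (coord_y k n).
Local Notation z0 := (coord_z0 k n).
Local Notation ix := (index_x n).
Local Notation iy := (index_y n).
Local Notation rho := (restr (zvars n)).
Variables (alpha beta gamma delta : k) (a : S).

Lemma coordinate_change : gamma * beta - delta * alpha != 0 ->
  a \is 1.-homog -> rho a = a -> a != 0 ->
  exists2 g : 'M[k]_n.+3, g \in unitmx &
    [/\ z0 \mPo linear_forms g = a, x \mPo linear_forms g = form1 n gamma delta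
       & y \mPo linear_forms g = form2 n alpha beta].
Proof.
move=> det0 ha ra a0.
have [j0 aj0] : exists j, a@_U_(j) != 0.
  apply: contrapT => nex; case/eqP: a0; rewrite (linear_form_coefs ha) big1 // => j _.
  by have [->|aj] := eqVneq a@_U_(j) 0; rewrite ?scale0r //; case: nex; exists j.
have zj0 : j0 \in zvars n.
  apply: contraNT aj0 => nj; rewrite -ra mcoeff_restr ifF //.
  by apply/forallP => /(_ j0); rewrite nj mnm1E eqxx.
have zN j : j \in zvars n -> (j == ix) = false /\ (j == iy) = false.
  by rewrite !inE negb_or => /andP[/negPf-> /negPf->].
have [[jx jy] [ox oy]] := (zN _ zj0, zN _ (ord0_zvars n)).
(* z_0, x and y go to [a], [form1] and [form2]. A variable [j0] occurring in [a] goes to z_0 unless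
   it is z_0 itself, and the remaining variables are fixed. *)
pose g : 'M[k]_n.+3 := \matrix_(i, j)
  if i == ix then gamma * (j == ix)%:R + delta * (j == iy)%:R else
  if i == iy then alpha * (j == ix)%:R + beta * (j == iy)%:R else
  if i == ord0 then a@_U_(j) else (j == if i == j0 then ord0 else i)%:R.
have yx : (iy == ix) = false by rewrite eq_sym index_xy.
have dsum (V : lmodType k) (F : 'I_n.+3 -> V) i : \sum_j (j == i)%:R *: F j = F i.
  rewrite (bigD1 i) //= eqxx scale1r big1 ?addr0 // => j /negPf->; exact: scale0r.
have dsum2 (V : lmodType k) (F : 'I_n.+3 -> V) (c d : k) i l :
    \sum_j (c * (j == i)%:R + d * (j == l)%:R) *: F j = c *: F i + d *: F l.
  under eq_bigr => j _ do rewrite scalerDl -!scalerA.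
  by rewrite big_split /= -!scaler_sumr !dsum.
exists g; last first.
  have e i : ('X_i : S) \mPo linear_forms g = \sum_j g i j *: 'X_j.
    exact: comp_linear_formsX.
  split; rewrite e; under eq_bigr => j _ do rewrite mxE.
  - by rewrite ox oy eqxx [RHS](linear_form_coefs ha).
  - by rewrite eqxx dsum2 /form1 !mul_mpolyC.
  - by rewrite yx eqxx dsum2 /form2 !mul_mpolyC.
(* For a vector killed by [g], the x and y entries vanish by [det0], the other entries apart from
   [j0] by the rows that pick a single variable, and the last one because [a] involves [j0]. *)
rewrite -unitmx_tr -row_free_unit; apply: inj_row_free => u ug.
have E i : \sum_j g i j *: (u 0 j : k^o) = 0.
  transitivity ((u *m g^T) 0 i); last by rewrite ug mxE.
  by rewrite [RHS]mxE; apply: eq_bigr => j _; rewrite [g^T _ _]mxE [LHS]mulrC.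
have := E ix; under eq_bigr => j _ do rewrite mxE.
rewrite eqxx dsum2 => Ex.
have := E iy; under eq_bigr => j _ do rewrite mxE.
rewrite yx eqxx dsum2 => Ey.
have [ux uy] : u 0 ix = 0 /\ u 0 iy = 0.
  have e (c d : k) : c *: (gamma *: (u 0 ix : k^o) + delta *: (u 0 iy : k^o)) +
      d *: (alpha *: (u 0 ix : k^o) + beta *: (u 0 iy : k^o)) = 0.
    by rewrite Ex Ey !scaler0 addr0.
  split; apply: (mulfI det0); rewrite mulr0.
    by rewrite -[RHS](e beta (- delta)) /GRing.scale /=; ring.
  by rewrite -[RHS](e (- alpha) gamma) /GRing.scale /=; ring.
have uz i : i != j0 -> u 0 i = 0.
  move=> ij; have [->//|nix] := eqVneq i ix; have [->//|niy] := eqVneq i iy.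
  have [e|ni0] := eqVneq i ord0; last first.
    have := E i; under eq_bigr => j _ do rewrite mxE.
    by rewrite (negPf nix) (negPf niy) (negPf ni0) (negPf ij) dsum.
  have := E j0; under eq_bigr => j _ do rewrite mxE.
  by rewrite jx jy -e [_ == i]eq_sym (negPf ij) eqxx dsum.
apply/rowP => i; rewrite mxE; have [->|/uz//] := eqVneq i j0.
have := E ord0; under eq_bigr => j _ do rewrite mxE.
rewrite ox oy eqxx (bigD1 j0) //= big1 ?addr0 => [|j /uz->]; last exact: scaler0.
by move/eqP; rewrite mulf_eq0 (negPf aj0) => /eqP.
Qed.

End Change.

(** * Reduction to the normal forms *)

Section Final.
Variables (k : fieldType) (n : nat).
Hypothesis hn : (2 <= n)%N.
Local Notation S := {mpoly k[n.+3]}.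
Local Notation x := (coord_x k n).
Local Notation y := (coord_y k n).
Local Notation z0 := (coord_z0 k n).
Local Notation I := (@IX k n).
Local Notation rho := (restr (zvars n)).
Implicit Types (f a : S) (Y : closed_subscheme k n.+2).

(** Completing l to a basis (l', l) of the linear forms in x and y turns (l) + I^2 into (l'^2,
    l). *)
Lemma double_structure_forms Y :
  multiple_structure Y -> cohen_macaulay Y -> ideal_pow I 2 `<=` ideal_of Y ->
  ~ (I `<=` ideal_of Y) ->
  ideal_of Y `<=` ideal_pow I 2 \/ exists alpha beta gamma delta : k,
    gamma * beta - delta * alpha != 0 /\ forall f, ideal_of Y f <->
      exists u v, f = u * form1 n gamma delta ^+ 2 + v * form2 n alpha beta.
Proof.
move=> mY CM I2J nIJ; have iJ := ideal_of_ideal Y.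
have [|[alpha [beta [nz Jl JE]]]] := double_structure hn mY CM I2J nIJ; first by left.
have [gamma [delta det0]] : exists gamma delta : k, gamma * beta - delta * alpha != 0.
  have [b0|b0] := eqVneq beta 0; last by exists 1, 0; rewrite mul1r mul0r subr0.
  exists 0, 1; rewrite mul0r sub0r mul1r oppr_eq0.
  by move: nz; rewrite b0 eqxx orbF.
right; exists alpha, beta, gamma, delta; split=> // f; split=> [/JE[h [g [Ig ->]]]|[u [v ->]]].
  have [u [v [w ->]]] := IX_pow2_forms det0 Ig.
  exists u, (h + v * form1 n gamma delta + w * form2 n alpha beta).
  by rewrite [RHS]addrC [in LHS]addrC; ring.
apply: (ideal_D iJ); last exact: ideal_Ml.
apply: (ideal_Ml _ iJ); apply: I2J; rewrite expr2.
by apply: IX_pow2M; apply: IX_form1 det0.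
Qed.

(** The chain J < I^2 < (x, y^2) < I < S is strict at the generic point. *)
Lemma first_neighbourhood_multiplicity Y mu :
  IX_saturated (ideal_of Y) -> ideal_of Y `<=` ideal_pow I 2 ->
  ~ (ideal_pow I 2 `<=` ideal_of Y) -> multiplicity Y mu -> (4 <= mu)%N.
Proof.
move=> sJ JI2 nI2J mult; have iJ := ideal_of_ideal Y; have i2 := ideal_pow_ideal I 2.
have iI := IX_ideal k n.
pose A i := nth [set: S] [:: ideal_of Y; ideal_pow I 2; lincomb [:: x; y ^+ 2]; I] i.
have I2A : ideal_pow I 2 `<=` A 2%N.
  move=> f /IX_pow2_sub/lincomb3P[u [v [w ->]]].
  by apply/lincomb2P; exists (u * x + v * y), w; ring.
have AI : A 2%N `<=` I.
  move=> f /lincomb2P[u [v ->]]; apply: (ideal_D iI); apply: (ideal_Ml _ iI).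
    exact: IX_x.
  by rewrite expr2; apply: (ideal_Ml _ iI); apply: IX_y.
have I2I : ideal_pow I 2 `<=` I by apply: subset_trans AI.
apply: (multiplicity_ge (A := A)) mult _ _.
  case=> [|[|[|[|[|//]]]]] _; split=> //; try exact: lincomb_ideal.
  - exact: subset_trans I2A.
  - exact: subset_trans I2I.
case=> [|[|[|[|//]]]] _; split=> //.
- have [s I2s nJs] : exists2 s, ideal_pow I 2 s & ~ ideal_of Y s.
    apply: contrapT => nex; apply: nI2J => s I2s.
    by apply: contrapT => nJs; apply: nex; exists s.
  have [f [hf If nJf]] := homogeneous_witness iJ (@IX_pow_homogeneous k n 2) I2s nJs.
  by exists f; split=> // /(saturated_loc sJ).
- exists x; split; first by exists 1%N; apply: coord_homog.
    by apply: (@lincomb_in _ [:: x; y ^+ 2]); rewrite inE eqxx.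
  move=> [t [nIt _ /IX_pow2_sub]]; rewrite -[t * x]addr0 -(mul0r y).
  by move=> /IX_pow2_linear[].
- exists y; split; [by exists 1%N; apply: coord_homog | exact: IX_y |].
  move=> [t [nIt _ /lincomb2P[u [v e]]]].
  have [|_ It] := @IX_pow2_linear k n (- u) (t - v * y).
    have -> : - u * x + (t - v * y) * y = 0.
      transitivity (t * y - (u * x + v * y ^+ 2)); first by ring.
      by rewrite e subrr.
    by apply: ideal_0; apply: lincomb_ideal.
  apply: nIt; rewrite -(subrK (v * y) t); apply: (ideal_D iI It).
  by apply: (ideal_Ml _ iI); apply: IX_y.
- exists 1; split=> //; first by exists 0%N; apply: dhomog1.
  by move=> [t [nIt _]]; rewrite mulr1.
Qed.

Lemma type_I_normal_form Y : type_I Y -> (exists2 mu, multiplicity Y mu & (mu <= 3)%N) ->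
  exists2 G : seq S, G \in normal_forms k n &
  exists2 Z : closed_subscheme k n.+2,
    ideal_of Z = ideal_gen [set` G] & linearly_equivalent Y Z.
Proof.
move=> [mY CM [m [Yj [[ImJ nImJ comp] CMj]]]] [mu mult lemu].
have iJ := ideal_of_ideal Y; have sJ := cohen_macaulay_saturated mY CM.
have JI := multiple_sub mY.
have ltm := filtration_length sJ ImJ nImJ mult.
set goal := (exists2 G, _ & _).
have nf G g : G \in normal_forms k n -> g \in unitmx ->
    ideal_of Y = lincomb [seq f \mPo linear_forms g | f <- G] -> goal.
  move=> GN ug eY; exists G => //; have [Z [eZ _ _]] := normal_form_scheme GN.
  exists Z => //; apply: linearly_equivalentP ug _ eY; rewrite eZ; exact: ideal_gen_seq.
have nf1 G : G \in normal_forms k n -> ideal_of Y = lincomb G -> goal.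
  move=> GN eY; apply: (nf G 1%:M) => //; first exact: unitmx1.
  by rewrite map_id_in // => f _; apply: linear_forms1.
(* Where no linear form in the z_i has to be moved, the change of coordinates is taken to fix
   z_0. *)
have [h0 rz0 nz0] : [/\ z0 \is 1.-homog, rho z0 = z0 & z0 != 0].
  by split; [exact: coord_homog | exact: rho_z0 | exact: mpolyX_neq0].
case: m => [|[|[|m]]] in ImJ nImJ comp CMj ltm *; last by lia.
- apply: (nf1 [:: x; y]); first by rewrite !inE eqxx.
  rewrite -IX_lincomb; apply/seteqP; split=> //.
  by move=> f If; apply: ImJ; rewrite ideal_pow1.
- have nIJ : ~ (I `<=` ideal_of Y) by move=> IJ; apply: nImJ; rewrite ideal_pow1.
  have [JI2|[alpha [beta [gamma [delta [det0 JE]]]]]] := double_structure_forms mY CM ImJ nIJ.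
    apply: (nf1 [:: x ^+ 2; x * y; y ^+ 2]); first by rewrite !inE eqxx !orbT.
    apply/seteqP; split=> [f /JI2|]; first exact: IX_pow2_sub.
    apply: lincomb_subP => // f; rewrite !inE => /or3P[] /eqP ->; apply: ImJ.
    - by rewrite expr2; apply: IX_pow2M; exact: IX_x.
    - by apply: IX_pow2M; [exact: IX_x | exact: IX_y].
    - by rewrite expr2; apply: IX_pow2M; exact: IX_y.
  have [g ug [_ gx gy]] := coordinate_change det0 h0 rz0 nz0.
  apply: (nf [:: x ^+ 2; y] g) => //; first by rewrite !inE eqxx !orbT.
  rewrite /= rmorphXn /= gx gy; apply/seteqP; split=> f.
    by move=> /JE ?; apply/lincomb2P.
  by move=> /lincomb2P ?; apply/JE.
have iI2 := ideal_pow_ideal I 2.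
have iK : is_ideal (ideal_add (ideal_of Y) (ideal_pow I 2)) by exact: ideal_add_ideal.
have comp1 := comp 1%N isT; set J1 := ideal_of (Yj 1%N) in comp1.
have iJ1 : is_ideal J1 := ideal_of_ideal _.
have [sJ1 KJ1 J1K] := primary_component_props iK (ideal_addr iJ) comp1.
have I2J1 : ideal_pow I 2 `<=` J1 by apply: subset_trans KJ1; apply: ideal_addr.
have JJ1 : ideal_of Y `<=` J1 by apply: subset_trans KJ1; apply: ideal_addl.
have mY1 : multiple_structure (Yj 1%N).
  by have [r [q [_ [i ri eq]]]] := comp1; rewrite /multiple_structure -/J1 -eq.
(* Y_1 is not X: otherwise I would be contained in J + I^2 at the generic point, against Nakayama's
   lemma. *)
have nIJ1 : ~ (I `<=` J1).
  have := IX_pow_strict iJ sJ ImJ nImJ (isT : 1 <= 2)%N; rewrite ideal_pow1 => h IJ1.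
  apply: h => f /IJ1; apply: loc_of_saturation => //.
    apply: homogeneous_add; [exact: ideal_of_homogeneous | exact: IX_pow_homogeneous].
  exact: ideal_of_homogeneous.
have [J1I2|[alpha [beta [gamma [delta [det0 J1E]]]]]] :=
    double_structure_forms mY1 (CMj 1%N isT) I2J1 nIJ1.
  (* If Y_1 were the whole first neighbourhood, Y would have multiplicity at least four. *)
  have := first_neighbourhood_multiplicity sJ (subset_trans JJ1 J1I2) nImJ mult.
  by lia.
have J1l : exists s, ~ I s /\ ideal_add (ideal_of Y) (ideal_pow I 2) (s * form2 n alpha beta).
  have [|s nIs Ks] := J1K (form2 n alpha beta); last by exists s.
  by apply/J1E; exists 0, 1; rewrite mul0r add0r mul1r.
have [JE|[a [ha ra a0 JE]]] :=
    triple_structure hn mY CM ImJ det0 iJ1 sJ1 JJ1 J1E J1l nImJ.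
  have [g ug [_ gx gy]] := coordinate_change det0 h0 rz0 nz0.
  apply: (nf [:: x ^+ 3; y] g) => //; first by rewrite !inE eqxx !orbT.
  rewrite /= rmorphXn /= gx gy; apply/seteqP; split=> f.
    by move=> /JE ?; apply/lincomb2P.
  by move=> /lincomb2P ?; apply/JE.
have [g ug [gz gx gy]] := coordinate_change det0 ha ra a0.
apply: (nf [:: x ^+ 2 + z0 * y; x * y; y ^+ 2] g) => //; first by rewrite !inE eqxx !orbT.
rewrite /= rmorphD !rmorphXn !rmorphM /= gx gy gz; apply/seteqP; split=> f.
  by move=> /JE ?; apply/lincomb3P.
by move=> /lincomb3P ?; apply/JE.
Qed.

End Final.

Theorem theorem3p7 (k : fieldType) (n : nat) (hn : (2 <= n)%N) :
  (forall G : seq {mpoly k[n.+3]}, G \in normal_forms k n ->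
     exists Z : closed_subscheme k n.+2,
       [/\ ideal_of Z = ideal_gen [set` G]%classic,
           type_I Z
         & exists2 mu, multiplicity Z mu & (mu <= 3)%N]) /\
  (forall Y : closed_subscheme k n.+2,
     type_I Y -> (exists2 mu, multiplicity Y mu & (mu <= 3)%N) ->
     exists2 G : seq {mpoly k[n.+3]}, G \in normal_forms k n &
     exists2 Z : closed_subscheme k n.+2,
       ideal_of Z = ideal_gen [set` G]%classic & linearly_equivalent Y Z).
Proof.
by split=> [G|Y]; [exact: normal_form_scheme | exact: type_I_normal_form].
Qed.
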